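(* Let $N\ge3$, $\alpha>1/2$, $0\le s\le2$. Suppose $K,\widehat K\in C^1(\mathbb{R}^N)\cap L^\infty(\mathbb{R}^N)$, where $\widehat K(x)=K(x/|x|^2)$. If $u\in X_\alpha(\mathbb{R}^N)$ is a weak solution of $$-\mathrm{div}(|x_N|^{2\alpha}\nabla u)=K(x)|x_N|^{\alpha\cdot2^*(s)-s}|u|^{2^*(s)-2}u\quad\text{in }\mathbb{R}^N,$$ then $$\int_{\mathbb{R}^N}(x\cdot\nabla K(x))\,|x_N|^{\alpha\cdot2^*(s)-s}|u(x)|^{2^*(s)}\,dx=0.$$
   Context: $x=(x_1,\dots,x_N)\in\mathbb{R}^N$; $2^*(s)=2(N-s)/(N-2)$. $X_\alpha(\mathbb{R}^N)$ is the completion of $C_0^\infty(\mathbb{R}^N)$ under the norm $\left(\int_{\mathbb{R}^N}|x_N|^{2\alpha}|\nabla u|^2\right)^{1/2}$. ''$\widehat K\in C^1(\mathbb{R}^N)$'' means that $\widehat K$, defined on $\mathbb{R}^N\setminus\{0\}$, extends to a $C^1$ function on $\mathbb{R}^N$. ''Weak solution'' means $\int_{\mathbb{R}^N}|x_N|^{2\alpha}\nabla u\cdot\nabla\varphi\,dx=\int_{\mathbb{R}^N}K|x_N|^{\alpha\cdot2^*(s)-s}|u|^{2^*(s)-2}u\varphi\,dx$ for every $\varphi\in C_0^\infty(\mathbb{R}^N)$. *)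

(* Defs.v *)
From HB Require Import structures.
From mathcomp Require Import all_boot all_order all_algebra.
From mathcomp Require Import all_classical all_reals all_analysis.

Set Implicit Arguments.
Unset Strict Implicit.
Unset Printing Implicit Defensive.
Import Order.TTheory GRing.Theory Num.Theory.
Import numFieldNormedType.Exports.

Local Open Scope classical_set_scope.
Local Open Scope ring_scope.

(* Points of R^N are row vectors 'rV[R]_N. The library's norm on 'rV[R]_N is
   the sup norm: it is used below only through the topology and the notion of
   differentiability it induces; Euclidean lengths go through [dot]. *)

Section measurable_rV.
Context {R : realType} (N : nat).

Let coord (i : 'I_N) (x : 'rV[R]_N) : measurableTypeR R := x ord0 i.

Let rV_set0 : g_sigma_preimage coord set0.
Proof. exact: sigma_algebra0. Qed.

Let rV_setC A : g_sigma_preimage coord A -> g_sigma_preimage coord (~` A).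
Proof. exact: sigma_algebraC. Qed.

Let rV_bigcup (F : (set 'rV[R]_N)^nat) :
  (forall i, g_sigma_preimage coord (F i)) ->
  g_sigma_preimage coord (\bigcup_i (F i)).
Proof. exact: sigma_algebra_bigcup. Qed.

(* The product (= Borel) sigma-algebra of R^N. *)
HB.instance Definition _ :=
  @isMeasurable.Build (measure_tuple_display (R.-ocitv.-measurable).-sigma)
    'rV[R]_N (g_sigma_preimage coord) rV_set0 rV_setC rV_bigcup.

Lemma measurable_coord (i : 'I_N) :
  measurable_fun [set: 'rV[R]_N]
    (fun x : 'rV[R]_N => x ord0 i : measurableTypeR R).
Proof.
move=> _ Y mY; rewrite setTI; apply: sub_sigma_algebra => /=.
rewrite -bigcup_seq/=; exists i => /=; first by rewrite mem_index_enum.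
by exists Y => //; rewrite setTI.
Qed.

Lemma measurable_fun_rV d (T : measurableType d) (f : T -> 'rV[R]_N) :
  (forall i, measurable_fun setT
     (fun t => f t ord0 i : measurableTypeR R)) ->
  measurable_fun setT f.
Proof.
move=> mf _ Y mY; rewrite setTI.
pose F := [set A : set 'rV[R]_N | measurable (f @^-1` A)].
suff : g_sigma_preimage coord `<=` F by apply.
apply: smallest_sub.
  split; rewrite /F /=.
  - by rewrite preimage_set0.
  - by move=> A /= mA; rewrite setTD preimage_setC; exact: measurableC.
  - by move=> A mA; rewrite preimage_bigcup; exact: bigcup_measurable.
move=> A; rewrite -bigcup_seq => -[i _ [B mB <-]].
by have := mf i measurableT B mB; rewrite /F /= !setTI.
Qed.

End measurable_rV.

Section lebesgue_rV.
Context {R : realType}.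

Definition cons_rV n (p : measurableTypeR R * 'rV[R]_n) : 'rV[R]_n.+1 :=
  \row_i oapp (fun j => p.2 ord0 j) p.1 (unlift ord0 i).

Definition uncons_rV n (x : 'rV[R]_n.+1) : measurableTypeR R * 'rV[R]_n :=
  (x ord0 ord0, \row_j x ord0 (lift ord0 j)).

Lemma cons_rVK n : cancel (@cons_rV n) (@uncons_rV n).
Proof.
case=> a y; rewrite /uncons_rV /cons_rV; congr pair; first by rewrite mxE unlift_none.
by apply/rowP => j; rewrite !mxE liftK.
Qed.

Lemma measurable_cons_rV n : measurable_fun setT (@cons_rV n).
Proof.
apply: measurable_fun_rV => i.
under eq_fun do rewrite mxE.
case: (unliftP ord0 i) => [j _|_] /=; last exact: measurable_fst.
exact: (measurableT_comp (measurable_coord j) measurable_snd).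
Qed.

Lemma measurable_uncons_rV n : measurable_fun setT (@uncons_rV n).
Proof.
apply: measurable_fun_pair; first exact: measurable_coord.
apply: measurable_fun_rV => j; under eq_fun do rewrite mxE.
exact: measurable_coord.
Qed.

Section step.
Variables (n : nat) (mu : {sigma_finite_measure set 'rV[R]_n -> \bar R}).

Definition leb_step : set 'rV[R]_n.+1 -> \bar R :=
  pushforward (@lebesgue_measure R \x mu)%E (@cons_rV n).

HB.instance Definition _ := Measure.copy leb_step
  (measure_function_pushforward__canonical__measure_function_Measure
    (@lebesgue_measure R \x mu)%E (@measurable_cons_rV n)).

Lemma leb_step_sigma_finite : sigma_finite setT leb_step.
Proof.
have /sigma_finiteP[F [TF ndF Foo]] := sigma_finiteT (@lebesgue_measure R).
have /sigma_finiteP[G [TG ndG Goo]] := sigma_finiteT mu.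
exists (fun k => @uncons_rV n @^-1` (F k `*` G k)).
  rewrite -preimage_bigcup (_ : \bigcup_k _ = setT) ?preimage_setT//.
  rewrite -subTset => -[x y] _.
  have [i _ Fix] : (\bigcup_i F i) x by rewrite -TF.
  have [j _ Gjy] : (\bigcup_i G i) y by rewrite -TG.
  exists (maxn i j) => //; split => /=.
  - by move: x Fix; exact/subsetPset/ndF/leq_maxl.
  - by move: y Gjy; exact/subsetPset/ndG/leq_maxr.
move=> k; have [mF Fk] := Foo k; have [mG Gk] := Goo k; split.
  rewrite -[X in measurable X]setTI.
  by apply: measurable_uncons_rV => //; exact: measurableX.
rewrite /leb_step /pushforward -comp_preimage.
rewrite (_ : _ \o _ = id); last by apply/funext => p /=; rewrite cons_rVK.
rewrite preimage_id.
rewrite (product_measure1E (@lebesgue_measure R) mu mF mG).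
by rewrite lte_mul_pinfty// ge0_fin_numE.
Qed.

HB.instance Definition _ :=
  @Measure_isSigmaFinite.Build _ _ _ leb_step leb_step_sigma_finite.

End step.

(* Lebesgue measure on R^N, as the N-fold product of [lebesgue_measure]. *)
Fixpoint leb (N : nat) : {sigma_finite_measure set 'rV[R]_N -> \bar R} :=
  match N with
  | 0 => [the {sigma_finite_measure set _ -> \bar R} of dirac (0 : 'rV[R]_0)]
  | n.+1 => [the {sigma_finite_measure set _ -> \bar R} of leb_step (leb n)]
  end.

Lemma leb_box (N : nat) (A : 'I_N -> set (measurableTypeR R)) :
  (forall i, measurable (A i)) ->
  (leb N [set x | forall i, A i (x ord0 i)] =
   \prod_(i < N) lebesgue_measure (A i))%E.
Proof.
elim: N A => [|n IH] A mA.
  by rewrite big_ord0 /= diracE mem_set// => -[].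
rewrite big_ord_recl -IH//.
set B := [set y : 'rV[R]_n | forall i, A (lift ord0 i) (y ord0 i)].
have mB : measurable B.
  have -> : B = \bigcap_(i in setT)
      (fun x : 'rV[R]_n => x ord0 i : measurableTypeR R) @^-1`
        A (lift ord0 i).
    by apply/seteqP; split => x /= H i => [_|]; exact: H.
  apply: fin_bigcap_measurable => // i _.
  by rewrite -[X in measurable X]setTI; exact: measurable_coord.
rewrite -[RHS](product_measure1E (@lebesgue_measure R) (leb n) (mA ord0) mB).
rewrite [LHS]/= /leb_step /pushforward; congr (product_measure1 _ _ _).
apply/seteqP; split => -[a y] /=.
- move=> H; split => [|i].
    by have := H ord0; rewrite mxE unlift_none.
  by have := H (lift ord0 i); rewrite mxE liftK.
- move=> [Aa Ay] i; rewrite mxE.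
  by case: (unliftP ord0 i) => [j ->|->].
Qed.

End lebesgue_rV.

Section calculus.
Context {R : realType} {N : nat}.
Implicit Types (x v w : 'rV[R]_N) (f phi : 'rV[R]_N -> R).

Definition dot v w : R := \sum_(i < N) v ord0 i * w ord0 i.

Definition partial (i : 'I_N) f : 'rV[R]_N -> R := 'D_(delta_mx ord0 i) f.

Definition grad f x : 'rV[R]_N := \row_i partial i f x.

Fixpoint Ck (k : nat) f : Prop :=
  match k with
  | 0 => continuous f
  | k'.+1 => (forall x, differentiable f x) /\ forall i, Ck k' (partial i f)
  end.

Definition test_function phi : Prop :=
  (forall k, Ck k phi) /\ compact (closure [set x | phi x != 0]).

Definition C1_Linfty f : Prop := Ck 1 f /\ f \in Lfun (leb N) +oo%E.

(* This is x / |x|^2 with |x| Euclidean. *)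
Definition inversion x : 'rV[R]_N := (dot x x)^-1 *: x.

End calculus.

(* x_N, the last coordinate; the value for N = 0 is irrelevant. *)
Definition last_coord {R : realType} {N : nat} : 'rV[R]_N -> R :=
  match N with
  | 0 => fun=> 0
  | n.+1 => fun x => x ord0 ord_max
  end.

Definition crit_exp {R : realType} (N : nat) (s : R) : R :=
  2 * (N%:R - s) / (N%:R - 2).

Section weighted_space.
Context {R : realType} {N : nat}.
Implicit Types (u phi : 'rV[R]_N -> R) (G : 'rV[R]_N -> 'rV[R]_N).

Definition weighted_norm (alpha : R) G : \bar R :=
  poweR (\int[leb N]_x
    (`|last_coord x| `^ (2 * alpha) * dot (G x) (G x))%:E)%E 2^-1.

Definition X_norm (alpha : R) phi : \bar R := weighted_norm alpha (grad phi).

(* A point of the completion of C_0^oo is the class of a Cauchy sequence of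
   test functions. For alpha > 1/2 Hardy's inequality
     \int |x_N|^(2 alpha - 2) phi^2 <= C \int |x_N|^(2 alpha) |grad phi|^2
   makes such a sequence converge, after extraction, almost everywhere; the
   completion is identified with the space of these a.e. limits, and the
   gradient extends from C_0^oo by continuity. *)
Definition X_approx (alpha : R) (phi : nat -> 'rV[R]_N -> R) u : Prop :=
  [/\ forall k, test_function (phi k),
      forall e : R, 0 < e -> exists k0 : nat, forall k l : nat,
        (k0 <= k)%N -> (k0 <= l)%N ->
        (X_norm alpha (fun x => phi k x - phi l x)%R < e%:E)%E
    & {ae leb N, forall x, phi k x @[k --> \oo] --> u x}].

Definition in_X (alpha : R) u : Prop :=
  measurable_fun setT u /\ exists phi : nat -> _ -> R, X_approx alpha phi u.

Definition X_gradient (alpha : R) u G : Prop :=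
  measurable_fun setT G /\
  exists2 phi : nat -> _ -> R, X_approx alpha phi u
    & weighted_norm alpha (fun x => grad (phi k) x - G x) @[k --> \oo] --> 0%E.

(* The integrals are extended-real valued; for u in X_alpha and K bounded both
   are absolutely convergent. *)
Definition weak_solution (alpha s : R) (K : 'rV[R]_N -> R) u : Prop :=
  exists2 Du, X_gradient alpha u Du &
  forall phi, test_function phi ->
    (\int[leb N]_x
       (`|last_coord x| `^ (2 * alpha) * dot (Du x) (grad phi x))%:E =
     \int[leb N]_x
       (K x * `|last_coord x| `^ (alpha * crit_exp N s - s) *
        `|u x| `^ (crit_exp N s - 2) * u x * phi x)%:E)%E.

End weighted_space.

(* Main.v *)
Require Import Defs.
From mathcomp Require Import all_boot all_order all_algebra.
From mathcomp Require Import all_classical all_reals all_analysis.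
From mathcomp Require Import measurable_realfun.
From mathcomp Require Import ring lra.
Import Order.TTheory GRing.Theory Num.Theory.
Import numFieldNormedType.Exports.
Local Open Scope classical_set_scope.
Local Open Scope ring_scope.
Set Implicit Arguments.
Unset Strict Implicit.
Unset Printing Implicit Defensive.

(** The identity is the infinitesimal form of a scaling law. Write p for the
    exponent crit_exp N s, a = |x_N|^(2 alpha), w = |x_N|^(alpha p - s), and let
    v(x) = l^gamma u(l x) with gamma = (N - 2) / 2 + alpha. This dilation
    preserves the energy, int a |grad v|^2 = int a |grad u|^2, and the mass, int w
    |v|^p = int w |u|^p, and it turns K into K(l x). Formally one tests the
    equation with the generator gamma u + x.grad u of the dilations and integrates
    by parts. The generator has no reason to lie in the energy space, and the
    solution no second derivatives to integrate by parts with, so the proof tests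
    with the admissible difference v - u and lets l tend to 1 in finite
    differences.

    The functional tools are a weighted Hardy inequality (hardy_test, where alpha
    > 1/2 enters) and a weighted Sobolev inequality (sobolev_crit, from the
    Gagliardo-Nirenberg product inequality), which interpolate to int w |z|^p <= C
    (int a |grad z|^2)^(p/2) (hardy_sobolev). They pass by Fatou from test
    functions to limits of test functions, and the weak equation extends to such
    limits (Rint_weak_form).

    The heart is a comparison of u with v. Testing both equations with u - v
    (energy_identity) bounds d = int a |grad (u - v)|^2 by a multiple of int Q +
    (l - 1)^2, where Q = w (|u| + |v|)^(p-2) (u - v)^2. Conversely int Q is
    controlled as follows. Where the potential w (|u| + |v|)^(p-2) is at most T
    rho, rho = a / |x|^2, the elementary estimate int rho (v - u)^2 <= C (l - 1)^2
    (dilate_dist) applies. The mass of |u|^p and |v|^p on the remaining set tends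
    to 0 as T grows, uniformly in l (tail_small, itg_tail_pair). If p > 2,
    Hoelder's inequality with this small factor bounds the remaining part of int Q
    by a small multiple of d + (l - 1)^2, which is absorbed, and both d and int Q
    are O((l - 1)^2) (quadratic_bounds). If p = 2 there is no small power to
    spare, and only int Q -> 0 follows (gap_small).

    For p > 2, the second-order Taylor formula for |t|^p and the equation of u
    give int w K (|v|^p - |u|^p) = - (p/2) d + O(int Q) = O((l - 1)^2), and the
    change of variables turns the left side into int w (K(x / l) - K(x)) |u|^p
    (dilation_gt2). For p = 2 the equation is linear: testing the equation of u
    with v and that of v with u gives int w (K(l x) - K(x)) u v = 0, and 2 u v =
    u^2 + v^2 - (u - v)^2 (dilation_eq2). In both cases, dividing by l - 1 and
    letting l -> 1 gives int (x.grad K) w |u|^p = 0. The limit is taken by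
    dominated convergence: K(l x) is Lipschitz in l near 1 uniformly in x (K_lip),
    because x.grad K(x) is bounded, on the unit ball by continuity and outside it
    because it equals - y.grad Khat(y) at the inverse point y = x / |x|^2
    (K_ray_out). *)

(** * Lebesgue measure on row vectors: Tonelli, dilations, lines *)

Section lebesgue_row_vectors.
Context {R : realType}.

Lemma le_of_eq d (T : porderType d) (x y : T) : x = y -> (x <= y)%O.
Proof. by move=> ->. Qed.

Lemma ge0T_integralZl d (T : measurableType d) (mu : {measure set T -> \bar R})
    (f : T -> \bar R) (k : R) :
  measurable_fun setT f -> (forall x, 0 <= f x)%E -> 0 <= k ->
  (\int[mu]_x (k%:E * f x) = k%:E * \int[mu]_x f x)%E.
Proof. by move=> mf f0 k0; rewrite ge0_integralZl. Qed.

Lemma rV_normP n (x : 'rV[R]_n) (e : R) : 0 < e ->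
  (forall i, `|x ord0 i| < e) -> `|x| < e.
Proof.
move=> e0 h; rewrite [ltLHS]/Num.Def.normr /= mx_normrE; apply/bigmax_ltP => /=;
  split => // -[i j] _ /=.
by rewrite ord1; exact: h.
Qed.

(** The sigma-algebra on row vectors is generated by the coordinates, so the
    measurability of a continuous function needs an argument: it is the
    pointwise limit of its values at the points of the grid of mesh 1 / (k + 1),
    and each of these approximations takes countably many values, on boxes. *)
Lemma continuous_measurable_rV n (f : 'rV[R]_n -> R) :
  continuous f -> measurable_fun setT f.
Proof.
move=> cf.
pose q (k : nat) (x : 'rV[R]_n) : 'rV[int]_n := \row_i Num.floor (k.+1%:R * x ord0 i).
pose e (k : nat) (z : 'rV[int]_n) : 'rV[R]_n := \row_i ((z ord0 i)%:~R / k.+1%:R).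
apply: (@measurable_realfun.measurable_fun_cvg _ _ _ setT (fun k x => f (e k (q k x)))).
  move=> k _ Y mY; rewrite setTI.
  have -> : (fun x => f (e k (q k x))) @^-1` Y =
     \bigcup_(z in [set z | Y (f (e k z))]) \bigcap_(i in [set: 'I_n])
        (fun x : 'rV[R]_n => x ord0 i) @^-1`
           [set t | (z ord0 i)%:~R <= k.+1%:R * t < (z ord0 i + 1)%:~R].
    apply/seteqP; split => [x /= Yx|x [z /= Yz] h].
      by exists (q k x) => // i _ /=; rewrite mxE floor_itv.
    rewrite /= (_ : q k x = z)//; apply/rowP => i; rewrite mxE.
    by apply/eqP; rewrite floor_eq; exact: h.
  rewrite bigcup_mkcond; apply: countable_bigcupT_measurable => // z.
  case: ifP => // _.
  apply: fin_bigcap_measurable => // i _.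
  rewrite -[X in measurable X]setTI; apply: measurable_coord => //.
  rewrite (_ : [set t | _] = `[(z ord0 i)%:~R / k.+1%:R,
    (z ord0 i + 1)%:~R / k.+1%:R[%classic) //.
  apply/seteqP; split => t /=; rewrite in_itv/=.
    by rewrite ler_pdivrMr ?ltr0n// ltr_pdivlMr ?ltr0n// ![t * _]mulrC.
  by rewrite ler_pdivrMr ?ltr0n// ltr_pdivlMr ?ltr0n// ![t * _]mulrC.
move=> x _ /=.
suff h : (fun k => e k (q k x)) @ \oo --> x by exact: (cvg_comp _ _ h (cf x)).
apply/cvgrPdist_lt => eps eps0.
near=> k.
apply: rV_normP => // i; rewrite !mxE.
have k0 : (0 < k.+1%:R :> R) by rewrite ltr0n.
rewrite (_ : _ - _ = (k.+1%:R * x ord0 i - (Num.floor (k.+1%:R * x ord0 i))%:~R)/k.+1%:R);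
  last first.
  by field; rewrite nat1r gt_eqF.
have /andP[h1 h2] := floor_itv (k.+1%:R * x ord0 i).
rewrite normrM [X in _ * X]gtr0_norm ?invr_gt0// ger0_norm ?subr_ge0//.
rewrite ltr_pdivrMr// ltrBlDr (lt_le_trans h2)// intrD addrC lerD2r.
rewrite -ler_pdivrMl//.
near: k.
exists (Num.truncn (eps^-1 *1)) => // k /= hk.
by rewrite (le_trans (ltW (truncnS_gt _)))// ler_nat.
Unshelve. all: by end_near.
Qed.

Lemma integral_leb_S n (f : 'rV[R]_n.+1 -> \bar R) :
  measurable_fun setT f -> (forall x, 0 <= f x)%E ->
  (\int[leb n.+1]_x f x = \int[lebesgue_measure]_a \int[leb n]_y f (cons_rV (a, y)))%E.
Proof.
move=> mf f0.
have -> : (\int[leb n.+1]_x f x = \int[lebesgue_measure \x leb n]_p f (cons_rV p))%E.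
  by rewrite [LHS](@ge0_integral_pushforward _ _ _ _ _ _ (@measurable_cons_rV R n))//;
    rewrite preimage_setT.
rewrite fubini_tonelli1//=.
by apply: measurableT_comp => //; exact: measurable_cons_rV.
Qed.

Lemma integral_leb_S2 n (f : 'rV[R]_n.+1 -> \bar R) :
  measurable_fun setT f -> (forall x, 0 <= f x)%E ->
  (\int[leb n.+1]_x f x = \int[leb n]_y \int[lebesgue_measure]_a f (cons_rV (a, y)))%E.
Proof.
move=> mf f0; rewrite integral_leb_S//.
apply: (fubini_tonelli (fun p => f (cons_rV p))) => //.
by apply: measurableT_comp => //; exact: measurable_cons_rV.
Qed.

Lemma measurable_slice n (f : 'rV[R]_n.+1 -> \bar R) :
  measurable_fun setT f -> (forall x, 0 <= f x)%E ->
  measurable_fun setT (fun a : measurableTypeR R => \int[leb n]_y f (cons_rV (a, y)))%E.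
Proof.
move=> mf f0; apply: (@measurable_fun_fubini_tonelli_F _ _ _ _ _ (leb n)
  (fun p => f (cons_rV p))) => //.
by apply: measurableT_comp => //; exact: measurable_cons_rV.
Qed.

Lemma measurable_slice2 n (f : 'rV[R]_n.+1 -> \bar R) :
  measurable_fun setT f -> (forall x, 0 <= f x)%E ->
  measurable_fun setT (fun y => \int[lebesgue_measure]_a f (cons_rV (a, y)))%E.
Proof.
move=> mf f0; apply: (@measurable_fun_fubini_tonelli_G _ _ _ _ _ lebesgue_measure
  (fun p => f (cons_rV p))) => //.
by apply: measurableT_comp => //; exact: measurable_cons_rV.
Qed.

Lemma measurable_fun_slice n (f : 'rV[R]_n.+1 -> \bar R) (a : R) :
  measurable_fun setT f -> measurable_fun setT (fun y => f (cons_rV (a, y))).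
Proof.
move=> mf; apply: (measurableT_comp mf); apply:
  (measurableT_comp (@measurable_cons_rV R n)).
exact: pair1_measurable.
Qed.

Lemma ge0_integral_lebesgue_scale (l : R) (f : R -> \bar R) : 0 < l ->
  measurable_fun setT f -> (forall x, 0 <= f x)%E ->
  (\int[lebesgue_measure]_x f (l * x)%R = (l^-1)%:E * \int[lebesgue_measure]_x f x)%E.
Proof.
move=> l0 mf f0.
have l00 : 0 <= l by exact: ltW.
have ml : measurable_fun [set: measurableTypeR R]
  ( *%R l : measurableTypeR R -> measurableTypeR R).
  exact: measurable_realfun.mulrl_measurable.
(* Lebesgue measure is the push-forward of its multiple l under multiplication
   by l: both agree on intervals. *)
pose m := mscale (NngNum l00) (measure_function_pushforward__canonical__measure_function_Measure
    (@lebesgue_measure R) ml).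
have E : (\int[m]_x f x = \int[lebesgue_measure]_x f x)%E.
  apply/esym/eq_measure_integral => A mA _.
  apply: lebesgue_measure_unique => // X [[a b] _ <-].
  transitivity (l%:E * lebesgue_measure `](a / l)%R, (b / l)%R]%classic)%E; last first.
    congr (_ * lebesgue_measure _)%E.
    by apply/seteqP; split => t /=; rewrite !in_itv/= ltr_pdivrMr// ler_pdivlMr// mulrC.
  rewrite !lebesgue_measure_itv/= !lte_fin ltr_pM2r ?invr_gt0//.
  case: ifPn => ab; last by rewrite mule0.
  by rewrite -!EFinB -EFinM -mulrBl mulrCA divff ?gt_eqF// mulr1.
rewrite -E ge0_integral_mscale//= muleA -EFinM mulVf ?gt_eqF// mul1e.
rewrite [in RHS](@ge0_integral_pushforward _ _ _ _ _ _ ml)//.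
Qed.

Lemma measurable_scale m (l : R) : measurable_fun setT (fun x : 'rV[R]_m => l *: x).
Proof.
apply: measurable_fun_rV => i; under eq_fun do rewrite mxE.
by apply: measurable_funM => //; exact: measurable_coord.
Qed.

Lemma integral_leb_scale n (l : R) (f : 'rV[R]_n -> \bar R) : 0 < l ->
  measurable_fun setT f -> (forall x, 0 <= f x)%E ->
  (\int[leb n]_x f (l *: x)%R = (l^-1 ^+ n)%:E * \int[leb n]_x f x)%E.
Proof.
move=> l0; elim: n f => [|n IH] f mf f0.
  rewrite expr0 mul1e; apply: eq_integral => x _; congr f; apply/rowP; case=> //.
have mfl : measurable_fun setT (fun x : 'rV[R]_n.+1 => f (l *: x)) by exact:
  (measurableT_comp mf (measurable_scale _)).
rewrite (integral_leb_S mfl)// (integral_leb_S mf)//.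
have E a y : (l *: cons_rV (a, y) = cons_rV (l * a, l *: y) :> 'rV[R]_n.+1).
  by apply/rowP => i; rewrite !mxE; case: unliftP => [j _|_] //=; rewrite mxE.
under eq_integral => a _.
  under eq_integral do rewrite E.
  rewrite (IH (fun y => f (cons_rV (l * a, y))))//; last exact: measurable_fun_slice.
  over.
have mF := measurable_slice mf f0.
set F := (fun a : measurableTypeR R => \int[leb n]_y f (cons_rV (a, y)))%E in mF *.
have F0 a : (0 <= F a)%E by exact: integral_ge0.
have mFl : measurable_fun setT (fun a : measurableTypeR R => F (l * a)).
  by apply: (measurableT_comp mF); exact: mulrl_measurable.
transitivity (\int[lebesgue_measure]_a ((l^-1 ^+ n)%:E * F (l * a)%R))%E; first by [].
have k0 : 0 <= l^-1 ^+ n by rewrite exprn_ge0// invr_ge0 ltW.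
rewrite (ge0T_integralZl _ mFl (fun a => F0 _) k0).
rewrite (ge0_integral_lebesgue_scale l0 mF F0).
by rewrite muleA -EFinM -exprSr.
Qed.

(** The line through x parallel to the i-th axis. *)
Definition upd n (x : 'rV[R]_n) (i : 'I_n) (t : R) : 'rV[R]_n :=
  \row_j (if j == i then t else x ord0 j).

Lemma upd_cons0 n a (y : 'rV[R]_n) t : upd (cons_rV (a, y)) ord0 t = cons_rV (t, y).
Proof.
apply/rowP => i; rewrite !mxE; case: unliftP => [j ->|->] /=; rewrite ?eqxx//.
Qed.

Lemma upd_consS n a (y : 'rV[R]_n) j t :
  upd (cons_rV (a, y)) (lift ord0 j) t = cons_rV (a, upd y j t).
Proof.
apply/rowP => i; rewrite !mxE; case: unliftP => [k ->|->] /=; last by [].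
by rewrite (inj_eq lift_inj) mxE.
Qed.

Lemma upd_id n (x : 'rV[R]_n) i : upd x i (x ord0 i) = x.
Proof. by apply/rowP => j; rewrite mxE; case: eqP => [->|]. Qed.

Lemma measurable_upd n (x : 'rV[R]_n) i :
  measurable_fun setT (upd x i : measurableTypeR R -> _).
Proof.
apply: measurable_fun_rV => j; under eq_fun do rewrite mxE.
by case: (j == i); [exact: measurable_id|exact: measurable_cst].
Qed.

(** By Tonelli, an inequality between integrals may be proved on the lines
    parallel to one axis. *)
Lemma line_le n (f g : 'rV[R]_n -> \bar R) (i : 'I_n) :
  measurable_fun setT f -> measurable_fun setT g ->
  (forall x, 0 <= f x)%E -> (forall x, 0 <= g x)%E ->
  (forall x, \int[lebesgue_measure]_t f (upd x i t) <=
    \int[lebesgue_measure]_t g (upd x i t))%E ->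
  (\int[leb n]_x f x <= \int[leb n]_x g x)%E.
Proof.
elim: n f g i => [|n IH] f g i mf mg f0 g0 h; first by case: i h.
case: (unliftP ord0 i) => [j ij|i0]; subst i.
  rewrite !integral_leb_S//; apply: ge0_le_integral => //.
  - by move=> a _; exact: integral_ge0.
  - exact: measurable_slice.
  - exact: measurable_slice.
  move=> a _; apply: (IH _ _ j) => //; [exact: measurable_fun_slice|exact:
    measurable_fun_slice|].
  by move=> y; have := h (cons_rV (a, y)); under eq_integral do rewrite upd_consS;
   under [in X in (_ <= X)%E -> _]eq_integral do rewrite upd_consS.
rewrite !integral_leb_S2//; apply: ge0_le_integral => //.
- by move=> a _; exact: integral_ge0.
- exact: measurable_slice2.
- exact: measurable_slice2.
by move=> y _; have := h (cons_rV (0, y)); under eq_integral do rewrite upd_cons0;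
   under [in X in (_ <= X)%E -> _]eq_integral do rewrite upd_cons0.
Qed.

(** A product of intervals, one of them reduced to a point. *)
Lemma hyperplane_null n (i : 'I_n) : (leb n [set x : 'rV[R]_n | x ord0 i = 0%R] = 0)%E.
Proof.
pose A (j : 'I_n) : set (measurableTypeR R) := if j == i then [set 0] else setT.
transitivity (leb n [set x | forall j, A j (x ord0 j)]).
  congr (leb n _).
  apply/seteqP; split => x /=; first by move=> x0 j; rewrite /A; case: eqP => [->|].
  by move=> /(_ i); rewrite /A eqxx.
rewrite leb_box; last by move=> j; rewrite /A; case: ifP => _; [exact: measurable_set1|].
by rewrite (bigD1 i)//= /A eqxx lebesgue_measure_set1 mul0e.
Qed.

End lebesgue_row_vectors.

(** * Hoelder and Gagliardo-Nirenberg inequalities *)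

Section hoelder_gagliardo.
Context {R : realType}.

Lemma measurable_fun_powR d (T : measurableType d) (f : T -> R) (r : R) :
  measurable_fun setT f -> measurable_fun setT (fun x => f x `^ r).
Proof. by move=> mf; exact: (measurableT_comp (measurable_powR r) mf). Qed.

(** The weighted arithmetic-geometric inequality, with the exponents t = 0 and t
    = 1 included. *)
Lemma powR_young (t x y : R) : 0 <= t <= 1 -> 0 <= x -> 0 <= y ->
  x `^ t * y `^ (1 - t) <= t * x + (1 - t) * y.
Proof.
move=> /andP[t0 t1] x0 y0.
have [->|tn0] := eqVneq t 0; first by rewrite powRr0 subr0 powRr1// !mul1r mul0r add0r.
have [->|tn1] := eqVneq t 1; first by rewrite subrr powRr0 powRr1// mul0r mulr1 mul1r addr0.
have tp : 0 < t by rewrite lt_def tn0.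
have t1p : 0 < 1 - t by rewrite subr_gt0 lt_def eq_sym tn1.
have := @conjugate_powR R (x `^ t) (y `^ (1 - t)) t^-1 (1 - t)^-1 (powR_ge0 _ _)
  (powR_ge0 _ _).
rewrite !invr_gt0 !invrK => /(_ tp t1p); rewrite addrC subrK => /(_ erefl).
by rewrite -!powRrM !divff ?gt_eqF// !powRr1// [x * _]mulrC [y * _]mulrC.
Qed.

(** Hoelder's inequality in terms of upper bounds A and B of the two integrals.
    Dividing F by A and G by B and integrating powR_young proves it without
    separate treatment of vanishing or infinite integrals. *)
Lemma le_integral_powRM d (T : measurableType d) (mu : {measure set T -> \bar R})
    (F G : T -> R) (t A B : R) :
  measurable_fun setT F -> measurable_fun setT G ->
  (forall x, 0 <= F x) -> (forall x, 0 <= G x) -> 0 <= t <= 1 -> 0 < A -> 0 < B ->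
  (\int[mu]_x (F x)%:E <= A%:E -> \int[mu]_x (G x)%:E <= B%:E ->
   \int[mu]_x (F x `^ t * G x `^ (1 - t))%:E <= (A `^ t * B `^ (1 - t))%:E)%E.
Proof.
move=> mF mG F0 G0 t01 A0 B0 FA GB.
have /andP[t0 t1] := t01.
pose c := A `^ t * B `^ (1 - t).
have c0 : 0 <= c by rewrite mulr_ge0 ?powR_ge0.
have t1' : 0 <= 1 - t by rewrite subr_ge0.
have mFE : measurable_fun setT (fun x => (F x)%:E) by exact/measurable_EFinP.
have mGE : measurable_fun setT (fun x => (G x)%:E) by exact/measurable_EFinP.
have tA : 0 <= t / A by rewrite divr_ge0 // ltW.
have tB : 0 <= (1 - t) / B by rewrite divr_ge0 // ltW.
have mm1 : measurable_fun setT (fun x => (t / A)%:E * (F x)%:E)%E.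
  by apply: emeasurable_funM => //; exact: measurable_cst.
have mm2 : measurable_fun setT (fun x => ((1 - t) / B)%:E * (G x)%:E)%E.
  by apply: emeasurable_funM => //; exact: measurable_cst.
apply: (@le_trans _ _ (\int[mu]_x (c%:E * ((t / A)%:E * (F x)%:E +
  ((1 - t) / B)%:E * (G x)%:E)))%E).
  apply: ge0_le_integral => //.
  - by move=> x _; rewrite lee_fin mulr_ge0 ?powR_ge0.
  - apply/measurable_EFinP/measurable_funM.
      exact: measurable_fun_powR.
    exact: measurable_fun_powR.
  - by apply: emeasurable_funM; [exact: measurable_cst|exact: emeasurable_funD].
  - move=> x _; rewrite lee_fin.
    have -> : F x `^ t * G x `^ (1 - t) = c * ((F x / A) `^ t * (G x / B) `^ (1 - t)).
      rewrite /c {1}(_ : F x = A * (F x / A)); last by rewrite mulrC divfK ?gt_eqF.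
      rewrite {1}(_ : G x = B * (G x / B)); last by rewrite mulrC divfK ?gt_eqF.
      rewrite !(powRM _ (ltW A0)) ?(powRM _ (ltW B0)) ?divr_ge0 ?(ltW A0) ?(ltW B0)//.
      by rewrite mulrACA.
    apply: ler_wpM2l => //; apply: le_trans (powR_young _ _ _) _ => //;
     rewrite ?divr_ge0 ?(ltW A0) ?(ltW B0)//.
    by rewrite mulrAC mulrA lerD2l mulrAC mulrA.
rewrite ge0T_integralZl//; last 2 first.
- exact: emeasurable_funD.
- by move=> x; rewrite adde_ge0// lee_fin mulr_ge0.
rewrite ge0_integralD//; last 2 first.
- by move=> x _; rewrite lee_fin mulr_ge0.
- by move=> x _; rewrite lee_fin mulr_ge0.
rewrite !ge0T_integralZl// -[leRHS]mule1; apply: lee_pmul => //.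
- by rewrite adde_ge0// mule_ge0 ?lee_fin// integral_ge0// => x _; rewrite lee_fin.
apply: (@le_trans _ _ ((t / A)%:E * A%:E + ((1 - t) / B)%:E * B%:E)%E).
  by apply: leeD; apply: lee_wpmul2l => //; rewrite lee_fin.
by rewrite -!EFinM -EFinD !divfK ?gt_eqF// addrC subrK.
Qed.

(** What the fundamental theorem of calculus gives for a compactly supported u
    whose partial derivatives are all bounded by G. *)
Definition line_dominated n (u G : 'rV[R]_n -> R) :=
  forall x i, ((u x)%:E <= \int[lebesgue_measure]_t (G (upd x i t))%:E)%E.

(** The Gagliardo-Nirenberg inequality is proved by induction on the dimension,
    through two alternating statements. T_ is linear in the integral of G, hence
    can be integrated over slices x_0 = a; on each slice the integral of u is
    bounded by the whole integral of G, because u is dominated along the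
    x_0-axis. This yields S_ one dimension higher, and Hoelder's inequality
    between u and its power turns S_ back into T_. *)
Let T_ n := forall (u G : 'rV[R]_n.+1 -> R) (A : R),
  measurable_fun setT u -> measurable_fun setT G -> (forall x, 0 <= u x) ->
    (forall x, 0 <= G x) ->
  line_dominated u G -> 0 < A -> (\int[leb n.+1]_x (u x)%:E <= A%:E ->
  \int[leb n.+1]_x (u x `^ (1 + n.+1%:R^-1))%:E <=
    (A `^ n.+1%:R^-1)%:E * \int[leb n.+1]_x (G x)%:E)%E.
Let S_ n := forall (u G : 'rV[R]_n.+2 -> R) (B : R),
  measurable_fun setT u -> measurable_fun setT G -> (forall x, 0 <= u x) ->
    (forall x, 0 <= G x) ->
  line_dominated u G -> 0 < B -> (\int[leb n.+2]_x (G x)%:E <= B%:E ->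
  \int[leb n.+2]_x (u x `^ (1 + n.+1%:R^-1))%:E <= (B `^ (1 + n.+1%:R^-1))%:E)%E.

Lemma integral_leb1 (f : 'rV[R]_1 -> \bar R) (x : 'rV[R]_1) (i : 'I_1) :
  measurable_fun setT f -> (forall x, 0 <= f x)%E ->
  (\int[leb 1]_x f x = \int[lebesgue_measure]_t f (upd x i t))%E.
Proof.
move=> mf f0; rewrite integral_leb_S2//= integral_dirac//; last exact: measurable_slice2.
rewrite diracT mul1e; apply: eq_integral => t _; congr f.
by apply/rowP => j; rewrite !mxE !ord1 eqxx unlift_none.
Qed.

Let T0 : T_ 0.
Proof.
move=> u G A mu mG u0 G0 uG A0 uA.
have mGE : measurable_fun setT (fun x => (G x)%:E) by exact/measurable_EFinP.
have muE : measurable_fun setT (fun x => (u x)%:E) by exact/measurable_EFinP.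
have g0 : (0 <= \int[leb 1]_x (G x)%:E)%E by apply: integral_ge0 => x _; rewrite lee_fin.
have uGx x : ((u x)%:E <= \int[leb 1]_x (G x)%:E)%E.
  by rewrite (integral_leb1 x ord0)//; exact: uG.
rewrite invr1 powRr1 ?(ltW A0)//.
case: (\int[leb 1]_x (G x)%:E)%E g0 uGx => [g| |]//; last first.
  by rewrite gt0_muley ?lte_fin// ?leey.
rewrite lee_fin => g0 uGx.
apply: (@le_trans _ _ (\int[leb 1]_x (g%:E * (u x)%:E))%E).
  apply: ge0_le_integral => //.
  - by move=> x _; rewrite lee_fin powR_ge0.
  - by apply/measurable_EFinP; exact: measurable_fun_powR.
  - by apply: emeasurable_funM => //; exact: measurable_cst.
  - move=> x _; rewrite lee_fin (_ : 1 + 1 = 2%:R)// powR_mulrn// expr2 ler_wpM2r//.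
    by rewrite -lee_fin.
rewrite ge0T_integralZl// muleC; apply: lee_wpmul2r => //.
Qed.

Let TS n : T_ n -> S_ n.
Proof.
move=> Tn u G B mu mG u0 G0 uG B0 GB.
have mGE : measurable_fun setT (fun x => (G x)%:E) by exact/measurable_EFinP.
have muE : measurable_fun setT (fun x => (u x)%:E) by exact/measurable_EFinP.
have mupE : measurable_fun setT (fun x => (u x `^ (1 + n.+1%:R^-1))%:E).
  by apply/measurable_EFinP; exact: measurable_fun_powR.
have usl (a : R) : (\int[leb n.+1]_y (u (cons_rV (a, y)))%:E <= B%:E)%E.
  apply: le_trans GB; rewrite (integral_leb_S2 mGE); last by move=> x; rewrite lee_fin.
  apply: ge0_le_integral => //.
  - by move=> y _; rewrite lee_fin.
  - exact: (measurable_fun_slice _ muE).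
  - by apply: (measurable_slice2 mGE) => x; rewrite lee_fin.
  - move=> y _; have := uG (cons_rV (a, y)) ord0.
    by under eq_integral do rewrite upd_cons0.
rewrite (integral_leb_S mupE); last by move=> x; rewrite lee_fin powR_ge0.
apply: (@le_trans _ _ (\int[lebesgue_measure]_a
  ((B `^ n.+1%:R^-1)%:E * \int[leb n.+1]_y (G (cons_rV (a, y)))%:E))%E).
  apply: ge0_le_integral => //.
  - by move=> y _; apply: integral_ge0 => x _; rewrite lee_fin powR_ge0.
  - by apply: (measurable_slice mupE) => x; rewrite lee_fin powR_ge0.
  - apply: emeasurable_funM; first exact: measurable_cst.
    by apply: (measurable_slice mGE) => x; rewrite lee_fin.
  - move=> a _; apply: (Tn (fun y => u (cons_rV (a, y))) (fun y => G (cons_rV (a, y))))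
    => //.
    + by apply/measurable_EFinP; exact: (measurable_fun_slice _ muE).
    + by apply/measurable_EFinP; exact: (measurable_fun_slice _ mGE).
    + move=> y i; have := uG (cons_rV (a, y)) (lift ord0 i).
      by under eq_integral do rewrite upd_consS.
rewrite ge0T_integralZl ?powR_ge0//; last 2 first.
- by apply: (measurable_slice mGE) => x; rewrite lee_fin.
- by move=> a; apply: integral_ge0 => x _; rewrite lee_fin.
rewrite -(integral_leb_S mGE)//.
rewrite addrC powRD ?powRr1 ?(ltW B0)//; last by rewrite (gt_eqF B0) implybT.
by rewrite EFinM; apply: lee_wpmul2l => //; rewrite lee_fin powR_ge0.
Qed.

Let ST n : S_ n -> T_ n.+1.
Proof.
move=> Sn u G A mu mG u0 G0 uG A0 uA.
set th : R := n.+2%:R^-1.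
have g0 : (0 <= \int[leb n.+2]_x (G x)%:E)%E by apply: integral_ge0 => x _; rewrite lee_fin.
have Ath : 0 < A `^ th by exact: powR_gt0.
case E : (\int[leb n.+2]_x (G x)%:E)%E g0 => [g| |]//; last first.
  by rewrite gt0_muley ?lte_fin// ?leey.
rewrite lee_fin => g0.
apply/lee_addgt0Pr => e e0.
(* S_ requires a positive bound, whereas the integral g of G may vanish. *)
pose B := g + e / A `^ th.
have B0 : 0 < B by rewrite ltr_wpDl// divr_gt0.
have := Sn u G B mu mG u0 G0 uG B0; rewrite E lee_fin lerDl ltW ?divr_gt0// => /(_ isT) SB.
have th01 : 0 <= th <= 1 by rewrite invr_ge0 ler0n invf_le1 ?ltr0n// ler1n.
have thE : (1 + n.+1%:R^-1) * (1 - th) = 1 :> R.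
  by rewrite /th; field; rewrite !nat1r -!natrD !pnatr_eq0.
have := le_integral_powRM mu (measurable_fun_powR (1 + n.+1%:R^-1) mu) u0
  (fun x => powR_ge0 _ _) th01 A0 (powR_gt0 (1 + n.+1%:R^-1) B0) uA SB.
rewrite -powRrM thE powRr1 ?(ltW B0)// => H.
rewrite -EFinM -EFinD (_ : _ + e = A `^ th * B); last first.
  by rewrite /B mulrDr mulrC [X in _ = _ + X]mulrC divfK ?gt_eqF// mulrC.
apply: le_trans H; apply: le_of_eq; apply: eq_integral => x _.
congr EFin; rewrite -powRrM thE powRr1// addrC powRD ?powRr1//.
by rewrite gt_eqF// ltr_wpDl// invr_ge0.
Qed.

(** In dimension m = n + 2 the exponent is m / (m - 1). *)
Lemma gagliardo n : S_ n.
Proof. by elim: n => [|n IH]; apply: TS => //; exact: ST. Qed.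

End hoelder_gagliardo.

(** * Powers of absolute values *)

Section normed_powers.
Context {R : realType}.

(** The odd power sgn(t) |t|^r; up to constants, |t|^r and spow r t are the
    derivatives of spow (r + 1) t and |t|^(r + 1). *)
Definition spow (r t : R) : R := `|t| `^ (r - 1) * t.

Lemma normr_spow r t : r != 0 -> `|spow r t| = `|t| `^ r.
Proof.
move=> r0; rewrite /spow normrM (ger0_norm (powR_ge0 _ _)).
have [->|t0] := eqVneq t 0; first by rewrite normr0 mulr0 powR0.
by rewrite -{2}(powRr1 (normr_ge0 t)) -powRD ?subrK// normr_eq0 t0 implybT.
Qed.

Lemma nbhs_pos (t : R) : 0 < t -> \forall s \near t, 0 < s.
Proof. by move=> t0; exact: lt_nbhsr. Qed.

Lemma is_derive_powR_pos (r t : R) : 0 < t -> is_derive t 1 (fun s => `|s| `^ r)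
  (r * spow (r - 1) t).
Proof.
move=> t0; rewrite /spow (gtr0_norm t0).
have -> : t `^ (r - 1 - 1) * t = t `^ (r - 1).
  by rewrite mulrC -{1}(powRr1 (ltW t0)) -powRD ?(gt_eqF t0) ?implybT// addrC subrK.
apply: (@near_eq_is_derive _ _ _ (fun s => s `^ r)); last exact: is_derive1_powR.
by near=> s; rewrite ger0_norm// ltW//; near: s; exact: nbhs_pos.
Unshelve. all: by end_near. Qed.

Lemma is_derive_spow_pos (r t : R) : 0 < t -> is_derive t 1 (spow r) (r * `|t| `^ (r - 1)).
Proof.
move=> t0; rewrite (gtr0_norm t0).
apply: (@near_eq_is_derive _ _ _ (fun s => s `^ r)); last exact: is_derive1_powR.
near=> s; have s0 : 0 < s by near: s; exact: nbhs_pos.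
rewrite /spow gtr0_norm// mulrC -{2}(powRr1 (ltW s0)) -powRD ?(gt_eqF s0) ?implybT//.
by rewrite addrC subrK.
Unshelve. all: by end_near. Qed.

Lemma is_derive_comp_opp (f : R -> R) (t d : R) : is_derive (- t) 1 f d ->
  is_derive t 1 (fun s => f (- s)) (- d).
Proof.
move=> h; have h2 : is_derive t 1 (-%R : R -> R) (-1) by exact: is_deriveNid.
have := @is_derive1_comp R f -%R t d (-1) h h2.
by rewrite mulrN1.
Qed.

Lemma is_derive_normpowR (r t : R) : t != 0 ->
  is_derive t 1 (fun s => `|s| `^ r) (r * spow (r - 1) t).
Proof.
rewrite neq_lt => /orP[t0|]; last exact: is_derive_powR_pos.
have := @is_derive_comp_opp (fun s => `|s| `^ r) t _ (is_derive_powR_pos r (_ : 0 < - t)).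
rewrite oppr_gt0 => /(_ t0); rewrite (_ : - _ = r * spow (r - 1) t); last first.
  by rewrite /spow normrN mulrN mulrN opprK.
by rewrite (_ : (fun s => _) = (fun s => `|s| `^ r))//; apply/funext => s; rewrite normrN.
Qed.

Lemma is_derive_spow_neq0 (r t : R) : t != 0 ->
  is_derive t 1 (spow r) (r * `|t| `^ (r - 1)).
Proof.
rewrite neq_lt => /orP[t0|]; last exact: is_derive_spow_pos.
have := @is_derive_comp_opp (spow r) t _ (is_derive_spow_pos r (_ : 0 < - t)).
rewrite oppr_gt0 => /(_ t0) h; have := is_deriveN h.
rewrite opprK normrN (_ : - _ = spow r)//; apply/funext => s.
by rewrite /= /spow /GRing.opp /= normrN mulrN opprK.
Qed.

Lemma is_derive_continuous (f : R -> R) (t d : R) : is_derive t 1 f d ->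
  {for t, continuous f}.
Proof.
by move=> [h _]; apply: differentiable_continuous; exact/derivable1_diffP.
Qed.

Lemma continuous_normpowR_neq0 (r t : R) : t != 0 ->
  {for t, continuous (fun s => `|s| `^ r)}.
Proof.
by move=> t0; exact: is_derive_continuous (is_derive_normpowR r t0).
Qed.

Lemma powR_norm_cvg0 (r : R) : 0 < r -> `|s| `^ r @[s --> (0 : R)] --> (0 : R).
Proof.
move=> r0; apply/cvgrPdist_lt => e e0; near=> s.
rewrite sub0r normrN ger0_norm ?powR_ge0//.
rewrite (_ : e = (e `^ r^-1) `^ r); last by rewrite -powRrM mulVf ?gt_eqF// powRr1// ltW.
apply: gt0_ltr_powR => //; rewrite ?inE ?nnegrE ?powR_ge0 //=.
near: s; have := @nbhs0_lt R R (e `^ r^-1); apply; exact: powR_gt0.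
Unshelve. all: by end_near. Qed.

Lemma continuous_normpowR (r : R) : 0 < r -> continuous (fun s : R => `|s| `^ r).
Proof.
move=> r0 t; have [->|] := eqVneq t 0; last exact: continuous_normpowR_neq0.
rewrite /continuous_at normr0 powR0 ?gt_eqF//; exact: powR_norm_cvg0.
Qed.

Lemma continuous_spow (r : R) : 0 < r -> continuous (spow r).
Proof.
move=> r0 t; have [->|t0] := eqVneq t 0.
  rewrite /continuous_at /spow mulr0; apply/norm_cvg0P.
  have := powR_norm_cvg0 r0; apply: cvg_trans; apply: near_eq_cvg; near=> s.
  by rewrite -[RHS]/(`|spow r s|) normr_spow ?gt_eqF.
exact: is_derive_continuous (is_derive_spow_neq0 r t0).
Unshelve. all: by end_near. Qed.

Lemma is_derive_at0 (g : R -> R) (r : R) : 1 < r -> g 0 = 0 ->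
  (forall s, `|g s| <= `|s| `^ r) ->
  is_derive (0 : R) 1 g 0.
Proof.
move=> r1 g0 gr.
have r10 : 0 < r - 1 by rewrite subr_gt0.
suff h : (fun h => h^-1 *: (g (h *: 1 + 0) - g 0)) @ 0^' --> (0 : R).
  by apply: DeriveDef; [apply/cvg_ex; exists 0|exact: cvg_lim].
apply/norm_cvg0P.
apply: (@squeeze_cvgr _ _ _ _ (cst 0) (fun s : R => `|s| `^ (r - 1))); last 2 first.
- exact: cvg_cst.
- by apply: cvg_trans (powR_norm_cvg0 r10); apply: cvg_app; exact: cvg_within.
near=> s; have s0 : s != 0 by near: s; exact: nbhs_dnbhs_neq.
rewrite normr_ge0/= g0 subr0 addr0 normrZ [_ *: _]mulr1 normfV.
have sp : 0 < `|s| by rewrite normr_gt0.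
rewrite ler_pdivrMl//.
by rewrite mulr_powRB1// (lt_trans _ r1).
Unshelve. all: by end_near. Qed.

Lemma is_derive_normpowR1 (r t : R) : 1 < r ->
  is_derive t 1 (fun s => `|s| `^ r) (r * spow (r - 1) t).
Proof.
move=> r1; have [->|] := eqVneq t 0; last exact: is_derive_normpowR.
rewrite /spow !mulr0; apply: (is_derive_at0 r1).
  by rewrite normr0 powR0// gt_eqF// (lt_trans _ r1).
by move=> s; rewrite ger0_norm// powR_ge0.
Qed.

Lemma is_derive_spow (r t : R) : 1 < r -> is_derive t 1 (spow r) (r * `|t| `^ (r - 1)).
Proof.
move=> r1; have [->|] := eqVneq t 0; last exact: is_derive_spow_neq0.
rewrite normr0 powR0 ?mulr0; last by rewrite subr_eq0 gt_eqF.
apply: (is_derive_at0 r1); first by rewrite /spow mulr0.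
by move=> s; rewrite normr_spow// gt_eqF// (lt_trans _ r1).
Qed.

Lemma between_norm (u v c : R) : c \in `[Num.min u v, Num.max u v] -> `|c| <= `|u| + `|v|.
Proof.
rewrite in_itv /= => /andP[h1 h2]; rewrite ler_norml; apply/andP; split.
  apply: le_trans h1; rewrite le_min; apply/andP; split.
    by rewrite lerNl (le_trans (ler_norm _))// normrN lerDl.
  by rewrite lerNl (le_trans (ler_norm _))// normrN lerDr.
apply: (le_trans h2); rewrite ge_max; apply/andP; split.
  by rewrite (le_trans (ler_norm _))// lerDl.
by rewrite (le_trans (ler_norm _))// lerDr.
Qed.

Lemma mean_value (g g' : R -> R) (u v : R) : (forall t : R, is_derive t 1 g (g' t)) ->
  exists2 c, c \in `[Num.min u v, Num.max u v] & g v - g u = g' c * (v - u).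
Proof.
move=> dg.
have cg (a b : R) : {within `[a, b], continuous g}.
  apply: derivable_within_continuous => x _; exact: ex_derive.
have [uv|vu] := leP u v.
  have [c cuv e] := @MVT_segment R g g' u v uv (fun x _ => dg x) (cg _ _).
  by exists c.
have [c cuv e] := @MVT_segment R g g' v u (ltW vu) (fun x _ => dg x) (cg _ _).
by exists c => //; rewrite -opprB e -mulrN opprB.
Qed.

Lemma spow_diff_le (r u v : R) : 1 < r ->
  `|spow r v - spow r u| <= r * (`|u| + `|v|) `^ (r - 1) * `|v - u|.
Proof.
move=> r1; have r0 : 0 < r by exact: lt_trans r1.
have [c cuv ->] := @mean_value (spow r) _ u v (fun t => is_derive_spow t r1).
rewrite normrM ler_wpM2r// normrM (gtr0_norm r0) ler_wpM2l ?(ltW r0)//.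
rewrite ger0_norm ?powR_ge0// ge0_ler_powR ?nnegrE ?subr_ge0 ?addr_ge0 ?(ltW r1)//.
exact: between_norm.
Qed.

(** Two applications of the mean value theorem, to |t|^p and to its derivative p
    spow (p - 1); the latter is differentiable because p > 2. *)
Lemma powR_taylor_le (p u v : R) : 2 < p ->
  `| `|v| `^ p - `|u| `^ p - p * spow (p - 1) u * (v - u)| <=
  p * (p - 1) * ((`|u| + `|v|) *+ 2) `^ (p - 2) * (v - u) ^+ 2.
Proof.
move=> p2; have p1 : 1 < p - 1 by rewrite ltrBrDr.
have p0 : 0 < p by exact: lt_trans p2.
have pp : 1 < p by apply: lt_trans p2; rewrite ltr1n.
have [c cuv ->] := @mean_value (fun t => `|t| `^ p) _ u v
  (fun t => is_derive_normpowR1 t pp).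
rewrite -mulrBl -mulrBr normrM -[(v - u) ^+ 2]real_normK ?num_real// expr2 mulrA
  ler_wpM2r//.
rewrite normrM (gtr0_norm p0) -!mulrA ler_wpM2l ?(ltW p0)//.
apply: le_trans (spow_diff_le _ _ p1) _; rewrite -!mulrA ler_wpM2l
  ?(le_trans ler01 (ltW p1))//.
rewrite (_ : p - 1 - 1 = p - 2); last by ring.
have cn := between_norm cuv.
apply: ler_pM => //; rewrite ?powR_ge0//.
  rewrite ge0_ler_powR ?nnegrE ?subr_ge0 ?addr_ge0 ?mulrn_wge0 ?addr_ge0 ?(ltW p2)//.
  by rewrite mulr2n lerD// lerDl.
move: cuv; rewrite in_itv/= => /andP[c1 c2].
have [uv|vu] := leP u v; rewrite ?(min_l uv) ?(max_r uv) ?(min_r (ltW vu))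
  ?(max_l (ltW vu)) in c1 c2.
  by rewrite !ger0_norm ?subr_ge0// lerD2r.
by rewrite !ler0_norm ?subr_le0// ?(ltW vu)// lerN2 lerD2r.
Qed.

End normed_powers.

(** * Fatou and the Hardy inequality on the line *)

Section hardy_one_dim.
Context {R : realType}.

Lemma limn_einf_le (u : (\bar R)^nat) (b : R) :
  (forall e, 0 < e -> \forall k \near \oo, (u k <= (b + e)%:E)%E) ->
    (limn_einf u <= b%:E)%E.
Proof.
move=> h; apply/lee_addgt0Pr => e e0; rewrite -EFinD limn_einf_lim.
apply: lime_le; first exact: is_cvg_einfs.
have [k0 _ hk] := h _ e0.
near=> n; rewrite /einfs.
apply: le_trans (hk (maxn n k0) (leq_maxr _ _)).
by apply: ereal_inf_lbound; exists (maxn n k0) => //=; exact: leq_maxl.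
Unshelve. all: by end_near. Qed.

(** Fatou's lemma in the form that carries an inequality from test functions to
    their limits: the bound is only required eventually and up to any e > 0. *)
Lemma fatou_le d (T : measurableType d) (mu : {measure set T -> \bar R})
   (f_ : nat -> T -> R) (f : T -> R) (b : R) :
  (forall k, measurable_fun setT (f_ k)) -> measurable_fun setT f ->
  (forall k x, 0 <= f_ k x) -> (forall x, 0 <= f x) ->
  {ae mu, forall x, f_ k x @[k --> \oo] --> f x} ->
  (forall e, 0 < e -> \forall k \near \oo, (\int[mu]_x (f_ k x)%:E <= (b + e)%:E)%E) ->
  (\int[mu]_x (f x)%:E <= b%:E)%E.
Proof.
move=> mf_ mf f_0 f0 cv le.
have mfE k : measurable_fun setT (EFin \o f_ k) by exact/measurable_EFinP.
have := @fatou _ _ _ mu setT measurableT (fun k => EFin \o f_ k) mfE.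
move=> /(_ (fun k x _ => f_0 k x)) F.
apply: (@le_trans _ _ (\int[mu]_x limn_einf (fun k => (f_ k x)%:E))%E); last first.
  by apply: le_trans F _; exact: limn_einf_le.
apply: le_of_eq; apply: ae_eq_integral => //.
- exact/measurable_EFinP.
- rewrite /limn_einf; apply: measurableT_comp => //; apply: measurable_fun_limn_esup => k.
  exact/measurable_EFinP/measurable_funN.
- move: cv; apply: filterS => x cx _.
  have cE : (fun k => (f_ k x)%:E) @ \oo --> (f x)%:E by apply: cvg_EFin => //;
    exact: nearW.
  by have [-> _] := cvg_limn_einf_sup cE.
Qed.

Lemma Rcontinuous_measurable (f : R -> R) : continuous f -> measurable_fun [set: R] f.
Proof. exact: continuous_measurable_fun. Qed.

Lemma ftc_segment (f f' : R -> R) (a b : R) : a < b ->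
  (forall t : R, a <= t <= b -> is_derive t 1 f (f' t)) ->
  (forall t : R, a <= t <= b -> {for t, continuous f'}) ->
  (\int[lebesgue_measure]_(x in `[a, b]) (f' x)%:E = (f b - f a)%:E)%E.
Proof.
move=> ab df cf'.
have cf (t : R) : a <= t <= b -> {for t, continuous f}.
  by move=> tab; exact: is_derive_continuous (df t tab).
rewrite EFinB; apply: continuous_FTC2 => //.
- apply: continuous_in_subspaceT => t; rewrite inE/= in_itv/=; exact: cf'.
- split.
  + by move=> t; rewrite in_itv/= => /andP[/ltW h1 /ltW h2]; have [|] := df t;
    rewrite ?h1 ?h2.
  + by apply: cvg_at_right_filter; apply: cf; rewrite lexx ltW.
  + by apply: cvg_at_left_filter; apply: cf; rewrite lexx ltW.
- move=> t; rewrite in_itv/= => /andP[/ltW h1 /ltW h2]; rewrite derive1E.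
  by have [|_ ->] := df t; rewrite ?h1 ?h2.
Qed.

Lemma le_integral_derive (f f' G : R -> R) (L : R) :
  (forall t : R, is_derive t 1 f (f' t)) -> continuous f' ->
  (forall t, L < `|t| -> f t = 0) -> measurable_fun setT G ->
  (forall t, `|f' t| <= G t) ->
  forall x, ((f x)%:E <= \int[lebesgue_measure]_t (G t)%:E)%E.
Proof.
move=> df cf' fL mG f'G x.
pose a : R := - (`|L| + `|x| + 1).
have ax : a < x.
  rewrite /a ltrNl; apply: le_lt_trans (_ : `|x| < _); first by rewrite -normrN ler_norm.
  by rewrite -addrA addrCA ltrDl ltr_wpDl.
have fa : f a = 0.
  apply: fL; rewrite /a normrN; apply: le_lt_trans (ler_norm L) _.
  apply: lt_le_trans (ler_norm _).
  by rewrite -addrA ltrDl ltr_wpDl.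
have mGE : measurable_fun [set: R] (fun t => (G t)%:E) by exact/measurable_EFinP.
have G0 t : 0 <= G t by apply: le_trans (f'G t).
rewrite (_ : (f x)%:E = \int[lebesgue_measure]_(t in `[a, x]) (f' t)%:E)%E; last first.
  by rewrite (@ftc_segment f)// ?fa ?subr0// => t _; exact: cf'.
have mf'E : measurable_fun `[a, x] (fun t => (f' t)%:E).
  by apply/measurable_EFinP; apply: measurable_funTS; exact: Rcontinuous_measurable.
apply: (@le_trans _ _ (\int[lebesgue_measure]_(t in `[a, x]) `|(f' t)%:E|)%E).
  apply: le_trans (lee_abs _) _; exact: le_abse_integral.
apply: (@le_trans _ _ (\int[lebesgue_measure]_(t in `[a, x]) (G t)%:E)%E).
  apply: ge0_le_integral => //.
  - by apply: measurableT_comp.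
  - exact: measurable_funTS.
  by move=> t _; rewrite lee_fin.
by apply: ge0_subset_integral => // t _; rewrite lee_fin.
Qed.

Lemma continuous_sqr (T : topologicalType) (g : T -> R) (t : T) :
  {for t, continuous g} -> {for t, continuous (fun s => g s ^+ 2)}.
Proof.
move=> h; rewrite (_ : (fun s => _) = (fun s => g s * g s)); first exact: cvgM.
by apply/funext => s; rewrite expr2.
Qed.

Lemma is_derive_sqr (f : R -> R) (t df : R) :
  is_derive t 1 f df -> is_derive t 1 (fun s => f s ^+ 2) (2 * f t * df).
Proof.
move=> h; rewrite (_ : (fun s => _) = f * f); last by apply/funext => s; rewrite expr2.
by apply: is_derive_eq; rewrite /GRing.scale /=; ring.
Qed.

(** For F = (2 / c) sgn(t) |t|^c f^2, the difference F' + (4 / c^2) |t|^(c + 1)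
    f'^2 - |t|^(c - 1) f^2 is the square |t|^(c - 1) (f + (2 / c) t f')^2.
    Integrating, the end terms have the favourable sign. *)
Lemma hardy_segment (c a b : R) (f f' : R -> R) : 0 < c -> a < b ->
  (forall t, a <= t <= b -> t != 0) ->
  (forall t : R, is_derive t 1 f (f' t)) -> continuous f' ->
  spow c b * f b ^+ 2 <= spow c a * f a ^+ 2 ->
  (\int[lebesgue_measure]_(t in `[a, b]) (`|t| `^ (c - 1) * f t ^+ 2)%:E <=
   \int[lebesgue_measure]_(t in `[a, b]) ((4 / c ^+ 2) *
     (`|t| `^ (c + 1) * f' t ^+ 2))%:E)%E.
Proof.
move=> c0 ab ne0 df cf' ends.
have cf : continuous f by move=> t; exact: is_derive_continuous (df t).
pose F t := (2 / c) * (spow c t * f t ^+ 2).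
pose F' t := (2 / c) * (c * `|t| `^ (c - 1) * f t ^+ 2 + 2 * spow c t * f t * f' t).
pose B t := (4 / c ^+ 2) * (`|t| `^ (c + 1) * f' t ^+ 2).
have cB t : a <= t <= b -> {for t, continuous B}.
  move=> /ne0 t0; apply: cvgM; first exact: cvg_cst.
  apply: cvgM; first exact: continuous_normpowR_neq0.
  by apply: continuous_sqr; exact: cf'.
have cspow t : a <= t <= b -> {for t, continuous (spow c)}.
  by move=> _; exact: continuous_spow.
have cF' t : a <= t <= b -> {for t, continuous F'}.
  move=> tab; have t0 := ne0 _ tab; apply: cvgM; first exact: cvg_cst.
  apply: cvgD.
    apply: cvgM; last by apply: continuous_sqr; exact: cf.
    by apply: cvgM; [exact: cvg_cst|exact: continuous_normpowR_neq0].
  apply: cvgM; last exact: cf'.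
  apply: cvgM; last exact: cf.
  by apply: cvgM; [exact: cvg_cst|exact: cspow].
have dF (t : R) : a <= t <= b -> is_derive t 1 F (F' t).
  move=> /ne0 t0; have d1 := is_derive_spow_neq0 c t0.
  have dft := df t.
  have dsq := is_derive_sqr dft.
  have d2 : is_derive t 1 (fun s => spow c s * f s ^+ 2)
    (spow c t *: (2 * f t * f' t) + f t ^+ 2 *: (c * `|t| `^ (c - 1))).
    exact: (is_deriveM d1 dsq).
  have -> : F = (2 / c) *: (fun s => spow c s * f s ^+ 2) by [].
  apply: is_derive_eq; rewrite /F' /GRing.scale /=; ring.
have int (g : R -> R) : (forall t, a <= t <= b -> {for t, continuous g}) ->
   lebesgue_measure.-integrable `[a, b] (EFin \o g).
  move=> cg; apply: continuous_compact_integrable; first exact: segment_compact.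
  by apply: continuous_in_subspaceT => t; rewrite inE/= in_itv/=; exact: cg.
have main t : a <= t <= b -> `|t| `^ (c - 1) * f t ^+ 2 <= F' t + B t.
  move=> /ne0 t0; rewrite /F' /B /spow.
  have tp : 0 < `|t| by rewrite normr_gt0.
  have -> : `|t| `^ (c + 1) = `|t| `^ (c - 1) * t ^+ 2.
    rewrite -[t ^+ 2]real_normK ?num_real// -[`|t| ^+ 2]powR_mulrn// -powRD.
      by congr (_ `^ _); ring.
    by rewrite (gt_eqF tp) implybT.
  set m := `|t| `^ (c - 1).
  have m0 : 0 <= m by rewrite powR_ge0.
  rewrite -subr_ge0.
  rewrite (_ : _ - _ = m * (f t + 2 / c * t * f' t) ^+ 2); last by field; rewrite gt_eqF.
  by rewrite mulr_ge0// sqr_ge0.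
apply: (@le_trans _ _ (\int[lebesgue_measure]_(t in `[a, b]) ((F' t)%:E + (B t)%:E))%E).
  apply: ge0_le_integral => //.
  - by move=> t _; rewrite lee_fin mulr_ge0 ?powR_ge0 ?sqr_ge0.
  - apply/measurable_EFinP; apply: measurable_funTS; apply: measurable_funM.
      apply: measurable_fun_powR; exact: normr_measurable.
    by apply: measurable_funX; exact: Rcontinuous_measurable.
  - apply: emeasurable_funD; [have /measurable_int := int _ cF'|have /measurable_int :=
    int _ cB]; by [].
rewrite integralD//; [|exact: int|exact: int].
rewrite (@ftc_segment F)// [leRHS](_ : _ = 0 +
  \int[lebesgue_measure]_(t in `[a, b]) (B t)%:E)%E; last by rewrite add0e.
apply: leeD => //; rewrite lee_fin /F -mulrBr pmulr_rle0 ?divr_gt0// subr_le0//.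
Qed.

(** The singularity at 0 is cut out: away from [- 1 / (k + 1), 1 / (k + 1)] the
    end terms of hardy_segment are favourable, f being zero at the outer ends.
    Fatou's lemma gives the limit k -> oo. *)
Lemma hardy_line (c L : R) (f f' : R -> R) : 0 < c ->
  (forall t : R, is_derive t 1 f (f' t)) -> continuous f' ->
  (forall t, L < `|t| -> f t = 0) ->
  (\int[lebesgue_measure]_t (`|t| `^ (c - 1) * f t ^+ 2)%:E <=
   \int[lebesgue_measure]_t ((4 / c ^+ 2) * (`|t| `^ (c + 1) * f' t ^+ 2))%:E)%E.
Proof.
move=> c0 df cf' fL.
have cf : continuous f by move=> t; exact: is_derive_continuous (df t).
pose A t := `|t| `^ (c - 1) * f t ^+ 2.
pose B t := (4 / c ^+ 2) * (`|t| `^ (c + 1) * f' t ^+ 2).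
have A0 t : 0 <= A t by rewrite mulr_ge0 ?powR_ge0 ?sqr_ge0.
have B0 t : 0 <= B t by rewrite mulr_ge0 ?divr_ge0 ?sqr_ge0// mulr_ge0 ?powR_ge0 ?sqr_ge0.
have mA : measurable_fun [set: R] A.
  apply: measurable_funM; first by apply: measurable_fun_powR; exact: normr_measurable.
  by apply: measurable_funX; exact: Rcontinuous_measurable.
have mB : measurable_fun [set: R] B.
  apply: measurable_funM; first exact: measurable_cst.
  apply: measurable_funM; first by apply: measurable_fun_powR; exact: normr_measurable.
  by apply: measurable_funX; exact: Rcontinuous_measurable.
have mAE : measurable_fun [set: R] (fun t => (A t)%:E) by exact/measurable_EFinP.
have mBE : measurable_fun [set: R] (fun t => (B t)%:E) by exact/measurable_EFinP.
have iB0 : (0 <= \int[lebesgue_measure]_t (B t)%:E)%E by apply: integral_ge0 => t _;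
  rewrite lee_fin.
case EB : (\int[lebesgue_measure]_t (B t)%:E)%E iB0 => [b| |] // _; last by rewrite leey.
pose M : R := `|L| + 2.
have ML t : M <= `|t| -> f t = 0.
  by move=> h; apply: fL; apply: le_lt_trans (ler_norm L) _; apply: lt_le_trans h;
    rewrite /M ltrDl.
pose e (k : nat) : R := k.+1%:R^-1.
have e0 k : 0 < e k by rewrite invr_gt0 ltr0n.
have eM k : e k < M.
  rewrite /e (@le_lt_trans _ _ 1)// ?invf_le1 ?ler1n ?ltr0n//.
  by rewrite /M ltr_wpDl// ltr1n.
pose D k : set R := `[e k, M] `|` `[- M, - e k].
have mD k : measurable (D k) by apply: measurableU.
apply: (@fatou_le _ _ lebesgue_measure (fun k t => A t * \1_(D k) t)) => //.
- by move=> k; apply: measurable_funM; [exact: mA|apply: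
  (@measurable_indic _ (measurableTypeR R)); exact: mD].
- by move=> k t; rewrite mulr_ge0.
- exists [set 0]; split; [exact: measurable_set1|exact: lebesgue_measure_set1|].
  move=> t /=; apply: contra_notP => /eqP t0.
  apply: cvg_near_cst; near=> k.
  have [tM|Mt] := ltP `|t| M; last by rewrite /A ML// expr0n/= mulr0 mul0r.
  rewrite indicE mem_set ?mulr1//.
  have et : e k <= `|t|.
    rewrite /e invf_ple ?posrE ?normr_gt0 ?ltr0n//.
    near: k; exists (Num.truncn (`|t|^-1)) => // k /= hk.
    by rewrite (le_trans (ltW (truncnS_gt _)))// ler_nat.
  rewrite /D; have [t_ge0|t_lt0] := leP 0 t.
    by left; rewrite /= in_itv/= -(ger0_norm t_ge0) et ltW.
  right; rewrite /= in_itv/= lerNl lerNr -(ltr0_norm t_lt0) et andbT ltW//.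
- move=> eps eps0; near=> k.
  apply: (@le_trans _ _ b%:E); last by rewrite lee_fin lerDl ltW.
  rewrite -EB.
  have -> : (\int[lebesgue_measure]_x (A x * \1_(D k) x)%:E =
    \int[lebesgue_measure]_(x in D k) (A x)%:E)%E.
    rewrite [RHS]integral_mkcond; apply: eq_integral => x _; rewrite /patch indicE.
    by case: ifP; rewrite ?mulr1 ?mulr0.
  apply: (@le_trans _ _ (\int[lebesgue_measure]_(x in D k) (B x)%:E)%E); last first.
    apply: ge0_subset_integral; [exact: mD|exact: measurableT|exact: mBE| |by []].
    by move=> x _; rewrite lee_fin.
  have dis : [disjoint `[e k, M] & `[- M, - e k]].
    apply/disj_setPS => x /= []; rewrite !in_itv/= => /andP[h1 _] /andP[_ h2].
    by have := lt_le_trans (e0 k) h1; rewrite ltNge (le_trans h2)// oppr_le0 ltW.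
  have splitD (g : R -> R) : measurable_fun [set: R] (fun t => (g t)%:E) ->
    (forall t, 0 <= g t) ->
    (\int[lebesgue_measure]_(x in D k) (g x)%:E =
      \int[lebesgue_measure]_(x in `[(e k)%R, M%R]) (g x)%:E
      + \int[lebesgue_measure]_(x in `[(- M)%R, (- e k)%R]) (g x)%:E)%E.
    move=> mg g0; apply: ge0_integral_setU => //; first exact: measurable_funTS.
    by move=> x _; rewrite lee_fin.
  rewrite (splitD _ mAE A0) (splitD _ mBE B0).
  apply: leeD.
    apply: hardy_segment => //.
      by move=> t /andP[h _]; rewrite gt_eqF// (lt_le_trans _ h).
    rewrite (ML M (ler_norm M)) expr0n/= mulr0 mulr_ge0 ?sqr_ge0// /spow mulr_ge0
      ?powR_ge0//.
    exact: ltW.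
  apply: hardy_segment => //.
  + by rewrite ltrN2.
  + by move=> t /andP[_ h]; rewrite lt_eqF// (le_lt_trans h)// oppr_lt0.
  + rewrite (ML (- M)) ?expr0n/= ?mulr0; last by rewrite normrN ler_norm.
    by rewrite mulr_le0_ge0 ?sqr_ge0// /spow mulr_ge0_le0 ?powR_ge0// oppr_le0 ltW.
Unshelve. all: by end_near. Qed.

End hardy_one_dim.

(** * Calculus of test functions *)

Section test_calculus.
Context {R : realType} {N : nat}.
Implicit Types (x v a : 'rV[R]_N) (f g phi psi : 'rV[R]_N -> R).

Lemma le_coord_norm x i : `|x ord0 i| <= `|x|.
Proof.
rewrite [leRHS]/Num.Def.normr /= mx_normrE.
by apply/bigmax_geP; right => /=; exists (ord0, i).
Qed.

Lemma is_derive_line f a v (t : R) : differentiable f (a + t *: v) ->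
  is_derive t 1 (fun s : R => f (a + s *: v)) ('D_v f (a + t *: v)).
Proof.
move=> df; have [h1 h2] : is_derive (a + t *: v) v f ('D_v f (a + t *: v)).
  by apply: DeriveDef => //; exact: diff_derivable.
have E : (fun h : R => h^-1 *: (f (a + (h *: (1 : R) + t) *: v) - f (a + t *: v))) =
   (fun h : R => h^-1 *: (f (h *: v + (a + t *: v)) - f (a + t *: v))).
  by apply/funext => h; rewrite [_%:A]mulr1 scalerDl addrCA.
by apply: DeriveDef; rewrite /derivable /derive /= E.
Qed.

Lemma updE x i (t : R) : upd x i t = upd x i 0 + t *: delta_mx ord0 i.
Proof.
apply/rowP => j; rewrite !mxE eqxx /=.
by case: (j == i); rewrite ?mulr1 ?add0r// mulr0 addr0.
Qed.

Lemma is_derive_upd f x i (t : R) : (forall y, differentiable f y) ->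
  is_derive t 1 (fun s : R => f (upd x i s)) (partial i f (upd x i t)).
Proof.
move=> df; have := @is_derive_line f (upd x i 0) (delta_mx ord0 i) t (df _).
by rewrite -updE; under eq_fun do rewrite -updE.
Qed.

Lemma derive_dot f x v : differentiable f x -> 'D_v f x = dot v (grad f x).
Proof.
move=> df; rewrite deriveE// /dot {1}(row_sum_delta v) linear_sum; apply: eq_bigr => i _.
by rewrite linearZ /= mxE /partial deriveE.
Qed.

Lemma is_derive_ray f x (t : R) : (forall y, differentiable f y) ->
  is_derive t 1 (fun s : R => f (s *: x)) (dot x (grad f (t *: x))).
Proof.
move=> df; have := @is_derive_line f 0 x t (df _).
by rewrite add0r derive_dot//; under eq_fun do rewrite add0r.
Qed.

Lemma continuous_upd x i : continuous (fun t : R => upd x i t).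
Proof.
rewrite (_ : (fun t => _) = (fun t => upd x i 0 + t *: delta_mx ord0 i)); last first.
  by apply/funext => t; exact: updE.
move=> t; by apply: cvgD; [exact: cvg_cst|apply: cvgZr_tmp => //; exact: cvg_cst].
Qed.

Lemma scaler_continuous_rV (l : R) : continuous (fun x => l *: x).
Proof. by move=> x; exact: scaler_continuous. Qed.

Lemma Ck_continuous k f : Ck k f -> continuous f.
Proof. by case: k => [//|k [df _] x]; exact: differentiable_continuous. Qed.

Lemma partialB f g i x : differentiable f x -> differentiable g x ->
  partial i (fun y => f y - g y) x = partial i f x - partial i g x.
Proof.
move=> df dg; apply: (@deriveB _ _ _ f g); exact: diff_derivable.
Qed.

Lemma CkB k f g : Ck k f -> Ck k g -> Ck k (fun x => f x - g x).
Proof.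
elim: k f g => [|k IH] f g /=; first by move=> cf cg x; exact: cvgB (cf x) (cg x).
move=> [df pf] [dg pg]; split => [x|i]; first exact: differentiableB.
rewrite (_ : partial i _ = (fun x => partial i f x - partial i g x)); first exact: IH.
by apply/funext => x; exact: partialB.
Qed.

Lemma differentiable_dilation (c l : R) f x : differentiable f (l *: x) ->
  differentiable (fun y => c * f (l *: y)) x.
Proof.
move=> df; apply: differentiableM; first exact: differentiable_cst.
apply: (@differentiable_comp _ _ _ _ (fun y => l *: y) f) => //.
Qed.

Lemma partial_dilation (c l : R) f i x : differentiable f (l *: x) ->
  partial i (fun y => c * f (l *: y)) x = c * l * partial i f (l *: x).
Proof.
move=> df; have := differentiable_dilation c df; set g := fun y => _ => dg.
set e := delta_mx ord0 i : 'rV[R]_N.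
have A : is_derive (0 : R) 1 (fun s : R => g (x + s *: e)) (partial i g x).
  by have := @is_derive_line g x e 0; rewrite scale0r addr0; exact.
have B : is_derive (0 : R) 1 (fun s : R => f (l *: x + s *: (l *: e)))
  (l * partial i f (l *: x)).
  have := @is_derive_line f (l *: x) (l *: e) 0; rewrite scale0r addr0 => /(_ df).
  by rewrite deriveE// linearZ /= -deriveE.
have := @is_deriveZ _ _ _ _ c _ _ _ B.
rewrite (_ : c \*: _ = (fun s : R => g (x + s *: e))); last first.
  apply/funext => s; rewrite /g scalerDr /GRing.scale /=; congr (c * f (_ + _)).
  by apply/rowP => j; rewrite !mxE mulrCA.
move=> [_ h]; have [_ <-] := A; by rewrite h /GRing.scale /= mulrA.
Qed.

Lemma Ck_dilation k (c l : R) f : Ck k f -> Ck k (fun x => c * f (l *: x)).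
Proof.
elim: k c f => [|k IH] c f /=.
  move=> cf x.
  have h : {for x, continuous (f \o (fun y => l *: y))}.
    by apply: continuous_comp; [exact: scaler_continuous_rV|exact: cf].
  exact: (cvgMl_tmp h).
move=> [df pf]; split => [x|i]; first exact: differentiable_dilation.
rewrite (_ : partial i _ = (fun x => c * l * partial i f (l *: x))); first exact: IH.
by apply/funext => x; exact: partial_dilation.
Qed.

Definition compact_support phi := compact (closure [set x | phi x != 0]).

Lemma compact_supportP phi (C : set 'rV[R]_N) : compact C ->
  (forall x, phi x != 0 -> C x) -> compact_support phi.
Proof.
move=> cC h; apply: (subclosed_compact _ cC); first exact: closed_closure.
have clC : closed C by apply: compact_closed => //; exact: norm_hausdorff.
by rewrite (closure_id C).1//; exact: closureS.
Qed.

Lemma compact_support_sub phi x : phi x != 0 -> closure [set x | phi x != 0] x.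
Proof. by move=> h; exact: subset_closure. Qed.

Lemma test_functionB phi psi : test_function phi -> test_function psi ->
  test_function (fun x => phi x - psi x).
Proof.
move=> [cp sp] [cq sq]; split; first by move=> k; exact: CkB.
apply: (compact_supportP (compactU sp sq)) => x h.
have [p0|p0] := eqVneq (phi x) 0; last by left; exact: compact_support_sub.
by right; apply: compact_support_sub; move: h; rewrite p0 sub0r oppr_eq0.
Qed.

Lemma test_function_dilation (c l : R) phi : l != 0 -> test_function phi ->
  test_function (fun x => c * phi (l *: x)).
Proof.
move=> l0 [cp sp]; split; first by move=> k; exact: Ck_dilation.
have cl : compact ((fun x => l^-1 *: x) @` (closure [set x | phi x != 0])).
  apply: continuous_compact => //; apply: continuous_subspaceT.
  exact: scaler_continuous_rV.
apply: (compact_supportP cl) => x; rewrite mulf_eq0 negb_or => /andP[_ h].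
exists (l *: x); first exact: compact_support_sub.
by rewrite scalerA mulVf// scale1r.
Qed.

Lemma gradB f g x : differentiable f x -> differentiable g x ->
  grad (fun y => f y - g y) x = grad f x - grad g x.
Proof. by move=> df dg; apply/rowP => i; rewrite !mxE partialB. Qed.

Lemma grad_dilation (c l : R) f x : differentiable f (l *: x) ->
  grad (fun y => c * f (l *: y)) x = (c * l) *: grad f (l *: x).
Proof. by move=> df; apply/rowP => i; rewrite !mxE partial_dilation. Qed.

Lemma compact_support_bounded phi : compact_support phi ->
  exists2 L : R, 0 < L & forall x i, L < `|x ord0 i| -> phi x = 0.
Proof.
move=> /compact_bounded[M [_ h]].
exists (`|M| + 1); first by rewrite ltr_wpDl.
move=> x i xi; apply/eqP; apply/negPn/negP => p0.
have := h (`|M| + 1); rewrite ltr_pwDr ?ler_norm//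
  => /(_ isT) /(_ x (compact_support_sub p0)).
by rewrite /= leNgt (lt_le_trans xi)// le_coord_norm.
Qed.

Section test.
Variable phi : 'rV[R]_N -> R.
Hypothesis tphi : test_function phi.

Lemma test_differentiable x : differentiable phi x.
Proof. by case: tphi => /(_ 1%N) [? _] _. Qed.

Lemma test_continuous : continuous phi.
Proof. by case: tphi => /(_ 0%N). Qed.

Lemma test_partial_continuous i : continuous (partial i phi).
Proof. by case: tphi => /(_ 1%N) [_ /(_ i)]. Qed.

Lemma test_measurable : measurable_fun setT phi.
Proof. exact: continuous_measurable_rV test_continuous. Qed.

Lemma test_partial_measurable i : measurable_fun setT (partial i phi).
Proof. exact: continuous_measurable_rV (@test_partial_continuous i). Qed.

Lemma test_grad_measurable : measurable_fun setT (grad phi).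
Proof.
apply: measurable_fun_rV => i; under eq_fun do rewrite mxE.
exact: test_partial_measurable.
Qed.

End test.

Lemma dotC v w : dot v w = dot w v.
Proof. by apply: eq_bigr => i _; rewrite mulrC. Qed.

Lemma dotDl u v w : dot (u + v) w = dot u w + dot v w :> R.
Proof. by rewrite -big_split; apply: eq_bigr => i _ /=; rewrite mxE mulrDl. Qed.

Lemma dotZl (c : R) v w : dot (c *: v) w = c * dot v w.
Proof. by rewrite /dot mulr_sumr; apply: eq_bigr => i _; rewrite mxE mulrA. Qed.

Lemma dotDr (u v w : 'rV[R]_N) : dot u (v + w) = dot u v + dot u w.
Proof. by rewrite dotC dotDl ![dot _ u]dotC. Qed.

Lemma dotZr (c : R) v w : dot v (c *: w) = c * dot v w.
Proof. by rewrite dotC dotZl dotC. Qed.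

Lemma dotNr v w : dot v (- w) = - dot v w.
Proof. by rewrite -scaleN1r dotZr mulN1r. Qed.

Lemma dotNl v w : dot (- v) w = - dot v w.
Proof. by rewrite -scaleN1r dotZl mulN1r. Qed.

Lemma dot_ge0 v : 0 <= dot v v.
Proof. by apply: sumr_ge0 => i _; rewrite -expr2 sqr_ge0. Qed.

Lemma le_coord_dot v i : v ord0 i ^+ 2 <= dot v v.
Proof. by rewrite /dot (bigD1 i)//= -expr2 lerDl sumr_ge0// => j _;
  rewrite -expr2 sqr_ge0. Qed.

Lemma dot_eq0 v : dot v v = 0 -> v = 0.
Proof.
move=> v0; apply/rowP => i; apply/eqP; rewrite mxE -sqrf_eq0.
by rewrite eq_le sqr_ge0 andbT -v0 le_coord_dot.
Qed.

Lemma dot_sqrD v w : dot (v + w) (v + w) <= 2 * dot v v + 2 * dot w w.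
Proof.
rewrite -subr_ge0 (_ : _ - _ = dot (v - w) (v - w)) ?dot_ge0//.
rewrite !dotDl !dotDr !dotNl !dotNr [dot w v]dotC; ring.
Qed.

Lemma dot_sqrB v w : dot (v - w) (v - w) <= 2 * dot v v + 2 * dot w w.
Proof. by apply: le_trans (dot_sqrD _ _) _; rewrite dotNl dotNr opprK. Qed.

(** Both signs follow from |e v -/+ w|^2 >= 0. *)
Lemma dot_young v w (e : R) : 0 < e -> `|dot v w| <= e * dot v v + e^-1 * dot w w.
Proof.
move=> e0.
have key (z : 'rV[R]_N) : dot v z *+ 2 <= e * dot v v + e^-1 * dot z z.
  have := dot_ge0 (e *: v - z); rewrite !dotDl !dotDr !dotNl !dotNr !dotZl !dotZr
    [dot z v]dotC.
  rewrite -(pmulr_rge0 _ (_ : 0 < e^-1)) ?invr_gt0// => h; rewrite -subr_ge0.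
  apply: le_trans h _; apply: le_of_eq; field.
  by rewrite gt_eqF.
have pos : 0 <= e * dot v v + e^-1 * dot w w.
  by rewrite addr_ge0// mulr_ge0 ?dot_ge0 ?invr_ge0 ?(ltW e0).
have h1 := key w; have h2 := key (- w).
rewrite dotNr dotNr dotNl opprK in h2.
rewrite ler_norml; apply/andP; split; move: h1 h2 pos; set a := _ + _ => *; lra.
Qed.

Lemma dot_CS v w : dot v w ^+ 2 <= dot v v * dot w w.
Proof.
have [w0|w0] := eqVneq (dot w w) 0.
  rewrite (dot_eq0 w0) (_ : dot v 0 = 0) ?expr0n/= ?mulr_ge0 ?dot_ge0//.
  by rewrite /dot big1// => i _; rewrite mxE mulr0.
have wp : 0 < dot w w by rewrite lt_def w0 dot_ge0.
have := dot_ge0 (dot w w *: v - dot v w *: w).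
rewrite !dotDl !dotDr !dotNl !dotNr !dotZl !dotZr [dot w v]dotC => h.
rewrite -subr_ge0 -(pmulr_rge0 _ wp); apply: le_trans h _.
by apply: le_of_eq; ring.
Qed.

End test_calculus.

(** * The Hardy inequality in the last coordinate *)

Section hardy_last_coord.
Context {R : realType}.

Lemma compact_coord_bounded n (C : set 'rV[R]_n) : compact C ->
  exists2 L : R, 0 < L & forall x, C x -> forall i, `|x ord0 i| <= L.
Proof.
move=> /compact_bounded[M [_ h]].
exists (`|M| + 1); first by rewrite ltr_wpDl.
move=> x Cx i; have := h (`|M| + 1); rewrite ltr_pwDr ?ler_norm// => /(_ isT) /(_ x Cx) /=.
exact: le_trans (le_coord_norm _ _).
Qed.

(** A bounded function supported in a box. *)
Lemma integral_compact_lty n (g : 'rV[R]_n -> R) (C : set 'rV[R]_n) :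
  continuous g -> compact C -> (forall x, 0 <= g x) -> (forall x, ~ C x -> g x = 0) ->
  (\int[leb n]_x (g x)%:E < +oo)%E.
Proof.
move=> cg cC g0 gC.
have [L L0 CL] := compact_coord_bounded cC.
have [M gM] : exists M : R, forall x, g x <= M.
  have /compact_bounded[M [_ h]] : compact (g @` C).
    by apply: continuous_compact => //; exact: continuous_subspaceT.
  exists (`|M| + 1) => x; have [Cx|/gC ->] := pselect (C x); last by rewrite addr_ge0.
  have := h (`|M| + 1); rewrite ltr_pwDr ?ler_norm// => /(_ isT) /(_ (g x)) /=.
  by move=> h2; apply: le_trans (h2 _); [exact: ler_norm|exists x].
have M0 : 0 <= M by apply: le_trans (gM 0).
pose A (i : 'I_n) : set (measurableTypeR R) := `[(- L)%R, L]%classic.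
pose box : set 'rV[R]_n := [set x | forall i, A i (x ord0 i)].
have mbox : measurable box.
  have -> : box = \bigcap_(i in setT) (fun x : 'rV[R]_n => x ord0 i : measurableTypeR R)
    @^-1` A i.
    by apply/seteqP; split => x /= H i => [_|]; exact: H.
  apply: fin_bigcap_measurable => // i _.
  by rewrite -[X in measurable X]setTI; apply: measurable_coord => //;
    exact: measurable_itv.
apply: (@le_lt_trans _ _ (\int[leb n]_x (M%:E * (\1_box x)%:E))%E).
  apply: ge0_le_integral => //.
  - by move=> x _; rewrite lee_fin.
  - by apply/measurable_EFinP; exact: continuous_measurable_rV.
  - apply: emeasurable_funM; first exact: measurable_cst.
    by apply/measurable_EFinP; exact: measurable_indic.
  - move=> x _; rewrite lee_fin indicE.
    have [Cx|/gC ->] := pselect (C x); last by rewrite mulr_ge0.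
    rewrite mem_set ?mulr1// => i; rewrite /A /= in_itv/= -ler_norml; exact: CL.
rewrite ge0T_integralZl//; last by apply/measurable_EFinP; exact: measurable_indic.
have lb : (leb n box = \prod_(i < n) lebesgue_measure (A i))%E.
  by apply: leb_box => i; exact: measurable_itv.
have -> : (\int[leb n]_x (\1_box x)%:E = \prod_(i < n) lebesgue_measure (A i))%E.
  by rewrite integral_indic// setIT; exact: lb.
rewrite ltey_eq fin_numM//; apply: (big_ind (fun y : \bar R => y \is a fin_num)) => //.
  by move=> y z; exact: fin_numM.
move=> i _; rewrite /A lebesgue_measure_itv/=; case: ifP => _ //.
Qed.

Section last.
Variable n : nat.
Local Notation N := n.+1.
Implicit Types (x : 'rV[R]_N) (phi : 'rV[R]_N -> R) (G H : 'rV[R]_N -> 'rV[R]_N).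

Lemma last_coordE x : last_coord x = x ord0 ord_max. Proof. by []. Qed.

Lemma last_coord_continuous : continuous (@last_coord R N).
Proof. exact: coord_continuous. Qed.

Lemma measurable_last_coord : measurable_fun setT (@last_coord R N).
Proof. exact: measurable_coord. Qed.

Lemma measurable_last_powR (r : R) : measurable_fun setT (fun x => `|last_coord x| `^ r).
Proof.
apply: measurable_fun_powR; apply: measurableT_comp; first exact: normr_measurable.
exact: measurable_last_coord.
Qed.

Lemma continuous_normpowR_comp (T : topologicalType) (f : T -> R) (r : R) : 0 < r ->
  continuous f ->
  continuous (fun x : T => `|f x| `^ r).
Proof.
move=> r0 cf x; apply: (@continuous_comp _ _ _ f (fun t => `|t| `^ r)); first exact: cf.
exact: continuous_normpowR.
Qed.

Lemma continuousM_fun (T : topologicalType) (f g : T -> R) : continuous f -> continuous g ->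
  continuous (fun x : T => f x * g x).
Proof. by move=> cf cg x; apply: cvgM; [exact: cf|exact: cg]. Qed.

Lemma continuous_sum_fun (T : topologicalType) m (F : 'I_m -> T -> R) :
  (forall i, continuous (F i)) -> continuous (fun x : T => \sum_(i < m) F i x).
Proof. by move=> cF; apply: continuous_big => //; exact: add_continuous. Qed.

Lemma partial_out phi x i : ~ closure [set x : 'rV[R]_N | phi x != 0] x ->
  partial i phi x = 0.
Proof.
move=> h.
have near0 : \forall y \near x, phi y = 0.
  have : nbhs x (~` closure [set x : 'rV[R]_N | phi x != 0]).
    by apply: open_nbhs_nbhs; split => //; exact/closed_openC/closed_closure.
  apply: filterS => y /= cy; apply/eqP/negPn/negP => p0; apply: cy.
  exact: compact_support_sub.
rewrite /partial (@near_eq_derive _ _ _ phi (cst 0)) ?derive_cst//.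
Qed.

Lemma out_support phi x : ~ closure [set x : 'rV[R]_N | phi x != 0] x -> phi x = 0.
Proof. by move=> h; apply/eqP/negPn/negP => p0; apply: h; exact: compact_support_sub. Qed.

(** The density of the weighted energy of a vector field; G need not be a
    gradient, since gradients in the completed space are only limits. *)
Definition dens (alpha : R) (G : 'rV[R]_N -> 'rV[R]_N) x : R :=
  `|last_coord x| `^ (2 * alpha) * dot (G x) (G x).

Lemma dens_ge0 alpha G x : 0 <= dens alpha G x.
Proof. by rewrite mulr_ge0 ?powR_ge0 ?dot_ge0. Qed.

Lemma measurable_dot (G H : 'rV[R]_N -> 'rV[R]_N) : measurable_fun setT G ->
  measurable_fun setT H ->
  measurable_fun setT (fun x => dot (G x) (H x)).
Proof.
move=> mG mH; apply: measurable_sum => i; apply: measurable_funM.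
  exact: (measurableT_comp (@measurable_coord R N i) mG).
exact: (measurableT_comp (@measurable_coord R N i) mH).
Qed.

Lemma measurable_dens alpha G : measurable_fun setT G -> measurable_fun setT (dens alpha G).
Proof. by move=> mG; apply: measurable_funM; [exact: measurable_last_powR|exact:
  measurable_dot]. Qed.

Lemma test_dens_lty alpha phi : 0 < alpha -> test_function phi ->
  (\int[leb N]_x (dens alpha (grad phi) x)%:E < +oo)%E.
Proof.
move=> a0 tp; have [_ cs] := tp.
apply: (integral_compact_lty _ cs) => [|x|x h].
- apply: continuousM_fun.
    by apply: continuous_normpowR_comp; [rewrite mulr_gt0|exact: last_coord_continuous].
  apply: continuous_sum_fun => i; apply: continuousM_fun;
   under [X in continuous X]eq_fun do rewrite mxE; exact: (test_partial_continuous tp).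
- exact: dens_ge0.
- rewrite /dens /dot big1 ?mulr0// => i _; rewrite mxE partial_out ?mul0r//.
Qed.

(** The Hardy inequality with c = 2 alpha - 1 on every line parallel to the last
    axis, where only the last partial derivative of phi occurs. *)
Lemma hardy_test alpha phi (D : R) : 2^-1 < alpha -> test_function phi ->
  (\int[leb N]_x (dens alpha (grad phi) x)%:E <= D%:E)%E ->
  (\int[leb N]_x (`|last_coord x| `^ (2 * alpha - 2) * phi x ^+ 2)%:E <=
     (4 / (2 * alpha - 1) ^+ 2 * D)%:E)%E.
Proof.
move=> a12 tp hD.
have c0 : 0 < 2 * alpha - 1 by rewrite subr_gt0 -ltr_pdivrMl// mulr1.
have k0 : 0 <= 4 / (2 * alpha - 1) ^+ 2 by rewrite divr_ge0 ?sqr_ge0.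
pose g x := `|last_coord x| `^ (2 * alpha) * partial ord_max phi x ^+ 2.
have mg : measurable_fun setT g.
  apply: measurable_funM; first exact: measurable_last_powR.
  by apply: measurable_funX; exact: test_partial_measurable.
apply: (@le_trans _ _ (\int[leb N]_x (4 / (2 * alpha - 1) ^+ 2 * g x)%:E)%E).
  apply: (line_le (i := ord_max)).
  - apply/measurable_EFinP/measurable_funM; first exact: measurable_last_powR.
    by apply: measurable_funX; exact: test_measurable.
  - by apply/measurable_EFinP/measurable_funM.
  - by move=> x; rewrite lee_fin mulr_ge0 ?powR_ge0 ?sqr_ge0.
  - by move=> x; rewrite lee_fin mulr_ge0// mulr_ge0 ?powR_ge0 ?sqr_ge0.
  move=> x.
  have [L L0 hL] := compact_support_bounded tp.2.
  have := @hardy_line R (2 * alpha - 1) L (fun t => phi (upd x ord_max t))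
    (fun t => partial ord_max phi (upd x ord_max t)) c0.
  rewrite (_ : 2 * alpha - 1 - 1 = 2 * alpha - 2) ?subrK; last by ring.
  move=> H; rewrite /g.
  under eq_integral do rewrite last_coordE {1}/upd mxE eqxx.
  under [in X in (_ <= X)%E]eq_integral do rewrite last_coordE {1}/upd mxE eqxx.
  apply: H.
  - by move=> t; apply: is_derive_upd; exact: test_differentiable.
  - move=> t; apply: (continuous_comp (f := upd x ord_max)); first exact: continuous_upd.
    exact: test_partial_continuous.
  - by move=> t Lt; apply: (hL _ ord_max); rewrite mxE eqxx.
rewrite (@eq_integral _ _ _ _ _ (fun x => (4 / (2 * alpha - 1) ^+ 2)%:E * (g x)%:E)%E)//.
rewrite ge0T_integralZl//; last 2 first.
- exact/measurable_EFinP.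
- by move=> x; rewrite lee_fin mulr_ge0 ?powR_ge0 ?sqr_ge0.
rewrite [leRHS]EFinM; apply: lee_wpmul2l; first by rewrite lee_fin.
apply: le_trans hD; apply: ge0_le_integral => //.
- by move=> x _; rewrite lee_fin mulr_ge0 ?powR_ge0 ?sqr_ge0.
- exact/measurable_EFinP.
- by apply/measurable_EFinP; apply: measurable_dens; exact: test_grad_measurable.
- move=> x _; rewrite lee_fin ler_wpM2l ?powR_ge0//.
  by have := le_coord_dot (grad phi x) ord_max; rewrite mxE.
Qed.

End last.
End hardy_last_coord.

(** * The weighted Sobolev inequality *)

Section sobolev_lines.
Context {R : realType}.

Lemma le_sum_norm_dot m (v : 'rV[R]_m) : (\sum_(i < m) `|v ord0 i|) ^+ 2 <=
  m%:R ^+ 2 * dot v v.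
Proof.
have h : \sum_(i < m) `|v ord0 i| <= m%:R * Num.sqrt (dot v v).
  apply: le_trans (_ : \sum_(i < m) Num.sqrt (dot v v) <= _); last first.
    by rewrite sumr_const card_ord mulr_natl.
  apply: ler_sum => i _; rewrite -sqrtr_sqr ler_sqrt ?dot_ge0//; exact: le_coord_dot.
by rewrite -(sqr_sqrtr (dot_ge0 v)) -exprMn ler_pXn2r// nnegrE ?sumr_ge0// mulr_ge0//
  sqrtr_ge0.
Qed.

Section line_dom.
Variable n : nat.
Local Notation N := n.+1.
Variables (alpha q : R) (phi : 'rV[R]_N -> R).
Hypotheses (tphi : test_function phi) (aq : 1 < alpha * q) (q1 : 1 < q) (a0 : 0 < alpha).

Let U (x : 'rV[R]_N) : R := `|last_coord x| `^ (alpha * q) * `|phi x| `^ q.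
Let G (x : 'rV[R]_N) : R := alpha * q * `|last_coord x| `^ (alpha * q - 1) * `|phi x| `^ q +
  q * `|last_coord x| `^ (alpha * q) * `|phi x| `^ (q - 1) * \sum_(j < N) `|partial j phi
    x|.

(** The condition alpha q > 1 makes |x_N|^(alpha q) continuously differentiable
    across the hyperplane x_N = 0; then G bounds the partial derivatives of U. *)
Lemma sobolev_line_dominated : line_dominated U G.
Proof.
move=> x i.
have q0 : 0 < q by exact: lt_trans q1.
have aq0 : 0 < alpha * q by exact: lt_trans aq.
have aq10 : 0 < alpha * q - 1 by rewrite subr_gt0.
have q10 : 0 < q - 1 by rewrite subr_gt0.
pose y (t : R) := last_coord (upd x i t).
pose d : R := (ord_max == i)%:R.
have yE t : y t = if ord_max == i then t else last_coord x by rewrite /y last_coordE mxE.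
have dy (t : R) : is_derive t 1 y d.
  rewrite /d (_ : y = if ord_max == i then id else cst (last_coord x)); last first.
    by apply/funext => s; rewrite yE; case: ifP.
  by case: eqP => _; [exact: is_derive_id|exact: is_derive_cst].
have cy : continuous y by move=> t; exact: is_derive_continuous (dy t).
pose f (t : R) := phi (upd x i t).
pose f' (t : R) := partial i phi (upd x i t).
have df (t : R) : is_derive t 1 f (f' t).
  by apply: is_derive_upd; exact: test_differentiable.
have cf : continuous f by move=> t; exact: is_derive_continuous (df t).
have cf' : continuous f'.
  move=> t; apply: (continuous_comp (f := upd x i)); first exact: continuous_upd.
  exact: test_partial_continuous.
pose g t := `|y t| `^ (alpha * q) * `|f t| `^ q.
pose g' t := `|y t| `^ (alpha * q) * (q * spow (q - 1) (f t) * f' t) +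
   `|f t| `^ q * (alpha * q * spow (alpha * q - 1) (y t) * d).
have dg (t : R) : is_derive t 1 g (g' t).
  have d1 := is_derive1_comp (is_derive_normpowR1 (y t) aq) (dy t).
  have d2 := is_derive1_comp (is_derive_normpowR1 (f t) q1) (df t).
  exact: (is_deriveM d1 d2).
have cspow (h : R -> R) (r : R) : 0 < r -> continuous h ->
  continuous (fun t => spow r (h t)).
  move=> r0 ch t; apply: (continuous_comp (f := h)); first exact: ch.
  exact: continuous_spow.
have cg' : continuous g'.
  move=> t; apply: cvgD; apply: cvgM.
  - exact: (continuous_normpowR_comp aq0 cy).
  - apply: cvgM; last exact: cf'.
    apply: cvgMl_tmp; exact: cspow.
  - exact: (continuous_normpowR_comp q0 cf).
  - apply: cvgMr_tmp; apply: cvgMl_tmp; exact: cspow.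
have [L L0 hL] := compact_support_bounded tphi.2.
have mGu : measurable_fun [set: R] (fun t => G (upd x i t)).
  suff mG : measurable_fun setT G by exact: (measurableT_comp mG (measurable_upd x i)).
  have mphi := test_measurable tphi.
  have mnphi : measurable_fun setT (fun x => `|phi x|) by exact:
    (measurableT_comp (@normr_measurable R setT)).
  apply: measurable_funD; apply: measurable_funM.
  - by apply: measurable_funM; [exact: measurable_cst|exact: measurable_last_powR].
  - exact: measurable_fun_powR.
  - apply: measurable_funM; last exact: measurable_fun_powR.
    by apply: measurable_funM; [exact: measurable_cst|exact: measurable_last_powR].
  - apply: measurable_sum => j; apply: measurableT_comp; first exact: normr_measurable.
    exact: test_partial_measurable.
have := @le_integral_derive R g g' (fun t => G (upd x i t)) L dg cg' _ mGu _ (x ord0 i).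
rewrite /g /y /f upd_id; apply.
- by move=> t Lt; rewrite (hL (upd x i t) i) ?mxE ?eqxx// normr0 powR0 ?mulr0// gt_eqF.
- move=> t; rewrite /g' -/(f t) -/(y t) /G -/(f t) -/(y t) addrC.
  apply: le_trans (ler_normD _ _) _; apply: lerD.
    have := normr_spow (y t) (lt0r_neq0 aq10); move: (spow _ _) => S hS.
    rewrite !normrM hS !(ger0_norm (powR_ge0 _ _)) (ger0_norm (ltW q0))
      (ger0_norm (ltW a0)) mulrC.
    rewrite ler_wpM2r ?powR_ge0// ler_piMr ?mulr_ge0 ?powR_ge0 ?(ltW q0) ?(ltW a0)//.
    by rewrite /d; case: eqP => _; rewrite ?normr1 ?normr0.
  have := normr_spow (f t) (lt0r_neq0 q10); move: (spow _ _) => S hS.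
  rewrite !normrM hS !(ger0_norm (powR_ge0 _ _)) (ger0_norm (ltW q0)).
  rewrite !mulrA [_ `^ _ * q]mulrC ler_wpM2l ?mulr_ge0 ?powR_ge0 ?(ltW q0)//.
  by rewrite (bigD1 i)//= lerDl sumr_ge0.
Qed.

End line_dom.
End sobolev_lines.

Section sobolev.
Context {R : realType}.

Lemma powR_sqr (x r : R) : (x `^ r) ^+ 2 = x `^ (2 * r).
Proof. by rewrite -powR_mulrn ?powR_ge0// -powRrM mulrC. Qed.

Lemma powR_split (x r t : R) : 0 <= x -> r + t != 0 -> x `^ r * x `^ t = x `^ (r + t).
Proof. by move=> x0 rt; rewrite powRD// (negbTE rt). Qed.

Section crit.
Variable n : nat.
Local Notation N := n.+3.
Variable alpha : R.
Hypothesis a12 : 2^-1 < alpha.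

Let q : R := 2 * n.+2%:R / n.+1%:R.
Let sg : R := 2 * n.+3%:R / n.+1%:R.
Let B0 : R := 2 * q ^+ 2 * (alpha ^+ 2 * (4 / (2 * alpha - 1) ^+ 2) + N%:R ^+ 2).

Let a0 : 0 < alpha. Proof. by apply: lt_trans a12; rewrite invr_gt0. Qed.
Let n1 : (0 : R) < n.+1%:R. Proof. by rewrite ltr0n. Qed.
Let q2 : 2 < q.
Proof. by rewrite /q ltr_pdivlMr// ltr_pM2l// ltr_nat. Qed.
Let q1 : 1 < q. Proof. by apply: lt_trans q2; rewrite ltr1n. Qed.
Let q0 : 0 < q. Proof. by apply: lt_trans q1. Qed.
Let aq : 1 < alpha * q.
Proof.
apply: (@lt_trans _ _ (2^-1 * q)); first by rewrite ltr_pdivlMl// mulr1.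
by rewrite ltr_pM2r.
Qed.
Let sgq : sg * 2^-1 = q - 1.
Proof. by rewrite /sg /q; field; rewrite nat1r pnatr_eq0. Qed.
Let sg0 : 0 < sg. Proof. by rewrite /sg divr_gt0// mulr_gt0// ltr0n. Qed.
Let B00 : 0 < B0.
Proof.
rewrite /B0 mulr_gt0 ?mulr_gt0 ?exprn_gt0// ltr_wpDl// ?exprn_gt0 ?ltr0n//.
by rewrite mulr_ge0 ?divr_ge0 ?sqr_ge0.
Qed.

(** The Gagliardo-Nirenberg inequality for U = |x_N|^(alpha q) |phi|^q with q =
    2 (N - 1) / (N - 2): the power N / (N - 1) of U is psi^sg with psi =
    |x_N|^alpha |phi|. The bound G for the derivatives of U equals psi^(q - 1) H
    and psi^(2 (q - 1)) = psi^sg, so by Cauchy-Schwarz the integral of G is at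
    most the geometric mean of those of psi^sg and H^2. The latter is bounded by
    the energy through the Hardy inequality; the former is finite and is
    absorbed on the left. *)
Lemma sobolev_crit phi (D : R) : test_function phi -> 0 < D ->
  (\int[leb N]_x (dens alpha (grad phi) x)%:E <= D%:E)%E ->
  (\int[leb N]_x ((`|last_coord x| `^ alpha * `|phi x|) `^ sg)%:E <=
    ((B0 * D) `^ (n.+3%:R / n.+1%:R))%:E)%E.
Proof.
move=> tp D0 hD.
pose psi (x : 'rV[R]_N) : R := `|last_coord x| `^ alpha * `|phi x|.
pose S (x : 'rV[R]_N) : R := \sum_(j < N) `|partial j phi x|.
pose H (x : 'rV[R]_N) : R := q * (alpha * `|last_coord x| `^ (alpha - 1) * `|phi x| +
  `|last_coord x| `^ alpha * S x).
pose U (x : 'rV[R]_N) : R := `|last_coord x| `^ (alpha * q) * `|phi x| `^ q.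
pose G (x : 'rV[R]_N) : R := alpha * q * `|last_coord x| `^ (alpha * q - 1) * `|phi x| `^
  q +
  q * `|last_coord x| `^ (alpha * q) * `|phi x| `^ (q - 1) * S x.
have psi0 x : 0 <= psi x by rewrite mulr_ge0 ?powR_ge0.
have S0 x : 0 <= S x by rewrite sumr_ge0.
have H0 x : 0 <= H x.
  by rewrite mulr_ge0 ?(ltW q0)// addr_ge0// mulr_ge0 ?mulr_ge0 ?powR_ge0 ?(ltW a0).
have U0 x : 0 <= U x by rewrite mulr_ge0 ?powR_ge0.
have mphi := test_measurable tp.
have mnphi : measurable_fun setT (fun x => `|phi x|) by exact:
  (measurableT_comp (@normr_measurable R setT)).
have mS : measurable_fun setT S.
  apply: measurable_sum => j; apply: measurableT_comp; first exact: normr_measurable.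
  exact: test_partial_measurable.
have mpsi : measurable_fun setT psi.
  by apply: measurable_funM => //; exact: measurable_last_powR.
have mU : measurable_fun setT U.
  by apply: measurable_funM; [exact: measurable_last_powR|exact: measurable_fun_powR].
have mH : measurable_fun setT H.
  apply: measurable_funM; first exact: measurable_cst.
  apply: measurable_funD; apply: measurable_funM => //; last exact: measurable_last_powR.
  by apply: measurable_funM; [exact: measurable_cst|exact: measurable_last_powR].
have GE x : G x = psi x `^ (q - 1) * H x.
  rewrite /G /H /psi powRM ?powR_ge0// -powRrM.
  have [x0|x0] := eqVneq (last_coord x) 0.
    have z1 : 0 `^ (alpha * q - 1) = 0 :> R by rewrite powR0// subr_eq0 (gt_eqF aq).
    have z2 : 0 `^ (alpha * q) = 0 :> R by rewrite powR0// (gt_eqF (lt_trans ltr01 aq)).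
    have z3 : 0 `^ (alpha * (q - 1)) = 0 :> R.
      by rewrite powR0// mulf_eq0 subr_eq0 (gt_eqF a0) (gt_eqF q1).
    by rewrite x0 normr0 z1 z2 z3 !(mulr0, mul0r, addr0).
  have xp : 0 < `|last_coord x| by rewrite normr_gt0.
  set t := `|last_coord x| in xp *.
  have e1 : t `^ (alpha * q - 1) = t `^ (alpha * (q - 1)) * t `^ (alpha - 1).
    by rewrite -powRD ?(gt_eqF xp) ?implybT//; congr (_ `^ _); ring.
  have e2 : t `^ (alpha * q) = t `^ (alpha * (q - 1)) * t `^ alpha.
    by rewrite -powRD ?(gt_eqF xp) ?implybT//; congr (_ `^ _); ring.
  rewrite e1 e2 -(mulr_powRB1 (normr_ge0 (phi x)) q0); ring.
have UE x : U x `^ (1 + n.+2%:R^-1) = psi x `^ sg.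
  rewrite /U /psi !powRM ?powR_ge0// -!powRrM.
  have e : q * (1 + n.+2%:R^-1) = sg.
    by rewrite /q /sg; field; rewrite !nat1r -?natrD !pnatr_eq0.
  by rewrite -mulrA e.
have yfin : (\int[leb N]_x (psi x `^ sg)%:E < +oo)%E.
  have [_ cs] := tp.
  apply: (integral_compact_lty _ cs) => [|x|x h].
  - rewrite (_ : (fun x => _) = (fun x => `|psi x| `^ sg)); last first.
      by apply/funext => x; rewrite ger0_norm.
    apply: continuous_normpowR_comp => //; apply: continuousM_fun.
      by apply: continuous_normpowR_comp => //; exact: last_coord_continuous.
    move=> x; apply: (continuous_comp (f := phi)); first exact: test_continuous.
    exact: norm_continuous.
  - exact: powR_ge0.
  - by rewrite /psi (out_support h) normr0 mulr0 powR0// gt_eqF.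
have G0 x : 0 <= G x by rewrite GE mulr_ge0 ?powR_ge0.
have mG : measurable_fun setT G.
  by rewrite (_ : G = fun x => psi x `^ (q - 1) * H x);
    [apply: measurable_funM => //; exact: measurable_fun_powR|exact/funext].
have HB : (\int[leb N]_x (H x ^+ 2)%:E <= (B0 * D)%:E)%E.
  pose h1 x := `|last_coord x| `^ (2 * alpha - 2) * phi x ^+ 2.
  pose c1 : R := 2 * q ^+ 2 * alpha ^+ 2.
  pose c2 : R := 2 * q ^+ 2 * N%:R ^+ 2.
  have c10 : 0 <= c1 by rewrite /c1 mulr_ge0 ?sqr_ge0// mulr_ge0 ?sqr_ge0.
  have c20 : 0 <= c2 by rewrite /c2 mulr_ge0 ?sqr_ge0// mulr_ge0 ?sqr_ge0.
  have mh1 : measurable_fun setT (fun x => (h1 x)%:E).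
    by apply/measurable_EFinP; apply: measurable_funM;
      [exact: measurable_last_powR|exact: measurable_funX].
  have mdens : measurable_fun setT (fun x => (dens alpha (grad phi) x)%:E).
    by apply/measurable_EFinP; apply: measurable_dens; exact: test_grad_measurable.
  have h10 x : 0 <= h1 x by rewrite mulr_ge0 ?powR_ge0 ?sqr_ge0.
  apply: (@le_trans _ _ (\int[leb N]_x (c1%:E * (h1 x)%:E +
    c2%:E * (dens alpha (grad phi) x)%:E))%E).
    apply: ge0_le_integral => //.
    - by move=> x _; rewrite lee_fin sqr_ge0.
    - by apply/measurable_EFinP; exact: measurable_funX.
    - by apply: emeasurable_funD; apply: emeasurable_funM => //; exact: measurable_cst.
    - move=> x _; rewrite lee_fin /H /c1 /c2 /h1 /dens.
      have -> : `|last_coord x| `^ (2 * alpha - 2) = (`|last_coord x| `^ (alpha - 1)) ^+ 2.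
        by rewrite powR_sqr; congr (_ `^ _); ring.
      rewrite -powR_sqr -(real_normK (num_real (phi x))).
      have := le_sum_norm_dot (grad phi x).
      under eq_bigr do rewrite mxE; rewrite -/(S x).
      set t := _ `^ (alpha - 1); set r := _ `^ alpha; set f := `|phi x|; set d :=
        dot _ _ => hS.
      apply: (@le_trans _ _ (2 * q ^+ 2 * (alpha ^+ 2 * t ^+ 2 * f ^+ 2 +
        r ^+ 2 * S x ^+ 2))).
        rewrite -subr_ge0 (_ : _ - _ = q ^+ 2 * (alpha * t * f - r * S x) ^+ 2);
          last by ring.
        by rewrite mulr_ge0 ?sqr_ge0.
      rewrite [leRHS](_ : _ = 2 * q ^+ 2 * (alpha ^+ 2 * t ^+ 2 * f ^+ 2 +
        r ^+ 2 * (N%:R ^+ 2 * d))); last by ring.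
      apply: ler_wpM2l; first by rewrite mulr_ge0 ?sqr_ge0.
      by rewrite lerD2l; apply: ler_wpM2l => //; exact: sqr_ge0.
  rewrite ge0_integralD//; last 4 first.
  - by move=> x _; rewrite mule_ge0 ?lee_fin.
  - by apply: emeasurable_funM => //; exact: measurable_cst.
  - by move=> x _; rewrite mule_ge0 ?lee_fin ?dens_ge0.
  - by apply: emeasurable_funM => //; exact: measurable_cst.
  rewrite !ge0T_integralZl//; last by move=> x; rewrite lee_fin dens_ge0.
  have hH := hardy_test a12 tp hD.
  apply: (@le_trans _ _ (c1%:E * (4 / (2 * alpha - 1) ^+ 2 * D)%:E + c2%:E * D%:E)%E).
    by apply: leeD; apply: lee_wpmul2l; rewrite ?lee_fin.
  by rewrite -!EFinM -EFinD lee_fin; apply: le_of_eq; rewrite /c1 /c2 /B0; ring.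
pose y := fine (\int[leb N]_x (psi x `^ sg)%:E)%E.
have yE : (\int[leb N]_x (psi x `^ sg)%:E = y%:E)%E.
  by rewrite /y fineK// ge0_fin_numE// integral_ge0// => x _; rewrite lee_fin powR_ge0.
have y_ge0 : 0 <= y by rewrite /y fine_ge0// integral_ge0// => x _;
  rewrite lee_fin powR_ge0.
have BD0 : 0 < B0 * D by rewrite mulr_gt0.
rewrite yE lee_fin.
move: y_ge0; rewrite le_eqVlt => /predU1P[<-|y0]; first exact: powR_ge0.
have GB : (\int[leb N]_x (G x)%:E <= (y `^ 2^-1 * (B0 * D) `^ (1 - 2^-1))%:E)%E.
  have half01 : 0 <= (2^-1 : R) <= 1 by rewrite invr_ge0 ler0n invf_le1// ler1n.
  have := @le_integral_powRM R _ _ (leb N) (fun x => psi x `^ sg) (fun x => H x ^+ 2) 2^-1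
    y (B0 * D)
    (measurable_fun_powR sg mpsi) (measurable_funX 2 mH) (fun x => powR_ge0 _ _)
      (fun x => sqr_ge0 _) half01 y0 BD0.
  rewrite yE lexx => /(_ isT HB).
  rewrite (@eq_integral _ _ _ _ _ (fun x => (G x)%:E))//.
  move=> x _; rewrite GE -powRrM sgq; congr (_ * _)%:E.
  rewrite -powR_mulrn// -powRrM (_ : _ * _ = 1) ?powRr1//; by field.
have B'0 : 0 < y `^ 2^-1 * (B0 * D) `^ (1 - 2^-1) by rewrite mulr_gt0 ?powR_gt0.
have := gagliardo mU mG U0 G0 (@sobolev_line_dominated R n.+2 alpha q phi tp aq q1 a0) B'0
  GB.
under eq_integral do rewrite UE.
rewrite yE lee_fin => hy.
(* The integral y now appears on both sides, with exponents 1 and k < 1. *)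
set k : R := (1 + n.+2%:R^-1) / 2.
have yk : y <= y `^ k * (B0 * D) `^ k.
  apply: le_trans hy _; rewrite powRM ?powR_ge0// -!powRrM.
  have h2 : 1 - 2^-1 = 2^-1 :> R by field.
  by rewrite h2 ![2^-1 * _]mulrC.
have yk2 : y `^ (1 - k) <= (B0 * D) `^ k.
  rewrite powRB ?(gt_eqF y0) ?implybT// powRr1 ?(ltW y0)//.
  by rewrite ler_pdivrMr ?powR_gt0// mulrC.
have k1 : 0 < 1 - k.
  rewrite /k subr_gt0 ltr_pdivrMr// mul1r -[ltRHS]/(1 + 1) ltrD2l invf_lt1 ?ltr0n// ltr1n//.
have yk3 : y = (y `^ (1 - k)) `^ (1 - k)^-1.
  by rewrite -powRrM divff ?(gt_eqF k1)// powRr1// ltW.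
have kE : n.+3%:R / n.+1%:R = k * (1 - k)^-1.
  rewrite /k -[n.+3]addn3 -[n.+2]addn2 -[n.+1]addn1 !natrD.
  have : (0 : R) <= n%:R by exact: ler0n.
  move: (n%:R : R) => a a_ge0.
  by field; repeat (apply/andP; split); apply: lt0r_neq0; lra.
rewrite [leLHS]yk3 kE [leRHS]powRrM; apply: ge0_ler_powR => //.
- by rewrite invr_ge0 ltW.
- by rewrite nnegrE powR_ge0.
- by rewrite nnegrE powR_ge0.
Qed.

End crit.
End sobolev.

(** * The Hardy-Sobolev inequality *)

Section hardy_sobolev_test_functions.
Context {R : realType}.

Lemma integral_leb_subst n (l : R) (f : 'rV[R]_n -> R) : 0 < l ->
  measurable_fun setT f -> (forall x, 0 <= f x) ->
  (\int[leb n]_x (l ^+ n * f (l *: x))%:E = \int[leb n]_x (f x)%:E)%E.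
Proof.
move=> l0 mf f0.
have ln0 : 0 <= l ^+ n by rewrite exprn_ge0// ltW.
have mfE : measurable_fun setT (fun x => (f x)%:E) by exact/measurable_EFinP.
have mflE : measurable_fun setT (fun x : 'rV[R]_n => (f (l *: x))%:E).
  exact: (measurableT_comp mfE (measurable_scale l)).
under eq_integral do rewrite EFinM.
rewrite ge0T_integralZl//; last by move=> x; rewrite lee_fin.
rewrite (integral_leb_scale l0 mfE)//.
by rewrite muleA -EFinM -exprMn divff ?(gt_eqF l0)// expr1n mul1e.
Qed.

Lemma measurable_hyperplane n (i : 'I_n) : measurable [set x : 'rV[R]_n | x ord0 i = 0].
Proof.
have := @measurable_coord R n i measurableT [set 0] (measurable_set1 0).
by rewrite setTI.
Qed.

(** Cauchy-Schwarz from the square (g' - c)^2, where c is the mean slope of g. *)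
Lemma segment_CS (g g' : R -> R) (l : R) : 1 < l ->
  (forall t : R, 1 <= t <= l -> is_derive t 1 g (g' t)) ->
  (forall t : R, 1 <= t <= l -> {for t, continuous g'}) ->
  (((g l - g 1) ^+ 2)%:E <= (l - 1)%:E * \int[lebesgue_measure]_(t in `[1%R, l])
    (g' t ^+ 2)%:E)%E.
Proof.
move=> l1 dg cg'.
have l10 : 0 < l - 1 by rewrite subr_gt0.
set I := g l - g 1.
pose c := I / (l - 1).
have int (h : R -> R) : (forall t, 1 <= t <= l -> {for t, continuous h}) ->
   lebesgue_measure.-integrable `[1, l] (EFin \o h).
  move=> ch; apply: continuous_compact_integrable; first exact: segment_compact.
  by apply: continuous_in_subspaceT => t; rewrite inE/= in_itv/=; exact: ch.
have csq t : 1 <= t <= l -> {for t, continuous (fun t => g' t ^+ 2)}.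
  by move=> tl; apply: continuous_sqr; exact: cg'.
have clin t : 1 <= t <= l -> {for t, continuous (fun t => 2 * c * g' t - c ^+ 2)}.
  by move=> tl; apply: cvgB; [apply: cvgMl_tmp; exact: cg'|exact: cvg_cst].
have L : (\int[lebesgue_measure]_(t in `[1%R, l]) (2 * c * g' t - c ^+ 2)%:E =
  (I ^+ 2 / (l - 1))%:E)%E.
  have dF (t : R) : 1 <= t <= l ->
      is_derive t 1 (fun t => 2 * c * g t - c ^+ 2 * t) (2 * c * g' t - c ^+ 2).
    move=> tl; have d1 := dg t tl.
    have d2 := @is_deriveZ _ _ _ _ (2 * c) _ _ _ d1.
    have d3 := @is_deriveZ _ _ _ _ (c ^+ 2) _ _ _ (is_derive_id t (1 : R)).
    rewrite (_ : 2 * c * g' t - c ^+ 2 = (2 * c) *: g' t - (c ^+ 2)%:A);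
      first exact: (is_deriveB d2 d3).
    by rewrite /GRing.scale /= mulr1.
  have -> := @ftc_segment R _ _ 1 l l1 dF clin.
  by congr EFin; rewrite /c /I; field; rewrite gt_eqF.
have le2 : (\int[lebesgue_measure]_(t in `[1%R, l]) (2 * c * g' t - c ^+ 2)%:E <=
  \int[lebesgue_measure]_(t in `[1%R, l]) (g' t ^+ 2)%:E)%E.
  apply: le_integral => //; [exact: int|exact: int|].
  move=> t _; rewrite lee_fin -subr_ge0 (_ : _ - _ = (g' t - c) ^+ 2) ?sqr_ge0//; ring.
rewrite L in le2.
apply: (@le_trans _ _ ((l - 1)%:E * (I ^+ 2 / (l - 1))%:E)%E).
  by rewrite -EFinM mulrC divfK// gt_eqF.
by apply: lee_wpmul2l => //; rewrite lee_fin ltW.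
Qed.

Section hs.
Variable n : nat.
Local Notation N := n.+3.
Variables (alpha s : R).
Hypotheses (a12 : 2^-1 < alpha) (s02 : 0 <= s <= 2).
Local Notation p := (@crit_exp R N s).

Definition wt (al : R) (r : R) (x : 'rV[R]_N) : R :=
  `|last_coord x| `^ (al * (@crit_exp R N r) - r).

Lemma wt_ge0 al r x : 0 <= wt al r x. Proof. exact: powR_ge0. Qed.

Lemma measurable_wt al r : measurable_fun setT (wt al r).
Proof. exact: measurable_last_powR. Qed.

Lemma N2E : N%:R - 2 = n.+1%:R :> R.
Proof. by rewrite -[n.+3]addn2 natrD addrK. Qed.

Lemma crit_ge2 : 2 <= p.
Proof.
move/andP: s02 => [s0 s2]; rewrite /crit_exp N2E ler_pdivlMr ?ltr0n// ler_pM2l//.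
by rewrite -N2E lerD2l lerN2.
Qed.

Let k : R := n.+3%:R / n.+1%:R.

(** Interpolation by Hoelder's inequality with exponent s / 2 between the Hardy
    inequality, which is the case s = 2, and the Sobolev inequality, which is
    the case s = 0. The weights match off the null set x_N = 0. *)
Lemma hardy_sobolev_test : exists2 C : R, 0 < C & forall phi (D : R), test_function phi ->
  0 < D ->
  (\int[leb N]_x (dens alpha (grad phi) x)%:E <= D%:E)%E ->
  (\int[leb N]_x (wt alpha s x * `|phi x| `^ p)%:E <= (C * D `^ (p / 2))%:E)%E.
Proof.
pose B0 : R := 2 * (2 * n.+2%:R / n.+1%:R) ^+ 2 *
  (alpha ^+ 2 * (4 / (2 * alpha - 1) ^+ 2) + N%:R ^+ 2).
pose CH : R := 4 / (2 * alpha - 1) ^+ 2.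
pose th : R := s / 2.
have a0 : 0 < alpha by apply: lt_trans a12; rewrite invr_gt0.
have c0 : 0 < 2 * alpha - 1 by rewrite subr_gt0 -ltr_pdivrMl// mulr1.
have CH0 : 0 < CH by rewrite divr_gt0// exprn_gt0.
have B00 : 0 < B0.
  rewrite /B0 mulr_gt0 ?mulr_gt0 ?exprn_gt0 ?divr_gt0 ?mulr_gt0 ?ltr0n// ltr_wpDl//
    ?exprn_gt0 ?ltr0n//.
  by rewrite mulr_ge0 ?sqr_ge0 ?(ltW CH0).
have [s0 s2] := andP s02.
have th01 : 0 <= th <= 1 by rewrite /th divr_ge0//= ler_pdivrMr// mul1r.
have p0 : 0 < p by apply: lt_le_trans crit_ge2.
have pE : p = 2 * th + k * 2 * (1 - th).
  rewrite /crit_exp /th /k -[n.+3]addn3 -[n.+1]addn1 !natrD.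
  have : (0 : R) <= n%:R by exact: ler0n.
  move: (n%:R : R) => a a_ge0; field; repeat (apply/andP; split); apply: lt0r_neq0; lra.
exists (CH `^ th * (B0 `^ k) `^ (1 - th)); first by rewrite mulr_gt0 ?powR_gt0.
move=> phi D tp D0 hD.
have mphi := test_measurable tp.
have mnphi : measurable_fun setT (fun x => `|phi x|) by exact:
  (measurableT_comp (@normr_measurable R setT)).
pose F x := `|last_coord x| `^ (2 * alpha - 2) * phi x ^+ 2.
pose G x := (`|last_coord x| `^ alpha * `|phi x|) `^ (2 * n.+3%:R / n.+1%:R).
have mF : measurable_fun setT F.
  by apply: measurable_funM; [exact: measurable_last_powR|exact: measurable_funX].
have mG : measurable_fun setT G.
  by apply: measurable_fun_powR; apply: measurable_funM => //; exact: measurable_last_powR.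
have F0 x : 0 <= F x by rewrite mulr_ge0 ?powR_ge0 ?sqr_ge0.
have hF : (\int[leb N]_x (F x)%:E <= (CH * D)%:E)%E by exact: hardy_test a12 tp hD.
have hG : (\int[leb N]_x (G x)%:E <= ((B0 * D) `^ k)%:E)%E.
  by have h := sobolev_crit a12 tp D0 hD; rewrite /G; exact: h.
have := le_integral_powRM mF mG F0 (fun x => powR_ge0 _ _) th01 (mulr_gt0 CH0 D0)
  (powR_gt0 k (mulr_gt0 B00 D0)) hF hG.
have split_D (a b : R) : 0 < a -> 0 < b ->
    (a * D) `^ th * ((b * D) `^ k) `^ (1 - th) =
      a `^ th * (b `^ k) `^ (1 - th) * D `^ (p / 2).
  move=> a_gt0 b_gt0; rewrite (powRM _ (ltW a_gt0) (ltW D0)) (powRM _ (ltW b_gt0) (ltW D0)).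
  rewrite (powRM _ (powR_ge0 _ _) (powR_ge0 _ _)) mulrACA; congr (_ * _).
  rewrite -powRrM -powRD ?(gt_eqF D0) ?implybT//; congr (_ `^ _).
  by rewrite pE; field.
rewrite (split_D _ _ CH0 B00).
apply: le_trans; apply: le_of_eq.
apply: ge0_ae_eq_integral => //.
- apply/measurable_EFinP/measurable_funM; [exact: measurable_wt|exact: measurable_fun_powR].
- by apply/measurable_EFinP/measurable_funM; exact: measurable_fun_powR.
- by move=> x _; rewrite lee_fin mulr_ge0 ?powR_ge0.
- by move=> x _; rewrite lee_fin mulr_ge0 ?powR_ge0.
exists [set x : 'rV[R]_N | x ord0 ord_max = 0]; split.
- exact: measurable_hyperplane.
- exact: hyperplane_null.
move=> x /=; apply: contra_notP => /eqP x0 _; congr EFin.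
rewrite /wt /F /G last_coordE.
have tp0 : 0 < `|x ord0 ord_max| by rewrite normr_gt0.
move: `|x ord0 ord_max| tp0 => t t0.
rewrite -(real_normK (num_real (phi x))); have : 0 <= `|phi x| by [].
move: `|phi x| => f f0.
rewrite -powR_mulrn// !powRM ?powR_ge0// -!powRrM mulrACA; congr (_ * _).
  rewrite -powRD ?(gt_eqF t0) ?implybT//; congr (_ `^ _).
  by rewrite {1}pE /k /th; field.
have e : p = 2%:R * th + 2 * n.+3%:R / n.+1%:R * (1 - th) by rewrite {1}pE /k; ring.
by rewrite powR_split// -e// gt_eqF.
Qed.

End hs.
End hardy_sobolev_test_functions.

(** * Dilations of test functions *)

Section dilations_test_functions.
Context {R : realType}.
Variable n : nat.
Local Notation N := n.+3.
Variable alpha : R.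
Hypothesis a12 : 2^-1 < alpha.
Implicit Types (x : 'rV[R]_N) (phi z : 'rV[R]_N -> R) (l : R).

(** The exponent for which dilations preserve the energy and, for every s, the
    integral of |x_N|^(alpha p - s) |u|^p. *)
Definition dil_exp : R := n.+1%:R / 2 + alpha.
Definition dilate l z x : R := l `^ dil_exp * z (l *: x).

(** The weight that compares the generator of dilations with the energy: rho
    (x.v)^2 is at most |x_N|^(2 alpha) |v|^2. *)
Definition rho x : R := `|last_coord x| `^ (2 * alpha) / dot x x.

Lemma rho_ge0 x : 0 <= rho x.
Proof. by rewrite divr_ge0 ?powR_ge0 ?dot_ge0. Qed.

Lemma measurable_rho : measurable_fun setT rho.
Proof.
apply: measurable_funM; first exact: measurable_last_powR.
rewrite (_ : (fun x => _) = (fun x => (dot x x) `^ (-1))); last first.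
  by apply/funext => x; rewrite powR_inv1 ?dot_ge0.
by apply: measurable_fun_powR; exact: measurable_dot.
Qed.

Lemma last_powR_scale l x (r : R) : 0 < l ->
  `|last_coord (l *: x)| `^ r = l `^ r * `|last_coord x| `^ r.
Proof.
by move=> l0; rewrite last_coordE mxE normrM (gtr0_norm l0) powRM// ltW.
Qed.

Lemma rho_scale l x : 0 < l -> rho (l *: x) = l `^ (2 * alpha - 2) * rho x.
Proof.
move=> l0; rewrite /rho last_powR_scale// dotZl dotZr powRB ?(gt_eqF l0) ?implybT//.
rewrite (_ : l `^ 2 = l ^+ 2); last by rewrite powR_mulrn// ltW.
by rewrite mulrA -expr2 invfM mulrACA.
Qed.

Lemma powR_dil_exp_sqr l : 0 < l -> (l `^ dil_exp) ^+ 2 = l ^+ N * l `^ (2 * alpha - 2).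
Proof.
move=> l0; rewrite powR_sqr -powR_mulrn ?(ltW l0)// -powRD ?(gt_eqF l0) ?implybT//.
by congr (_ `^ _); rewrite /dil_exp -[n.+3]addn2 natrD; field.
Qed.

Lemma continuousD_fun (T : topologicalType) (f g : T -> R) : continuous f -> continuous g ->
  continuous (fun t : T => f t + g t).
Proof. by move=> cf cg t; apply: cvgD; [exact: cf|exact: cg]. Qed.

(** The generator of the dilations: the derivative of l |-> dilate l phi is
    dilate l (euler phi) / l. *)
Definition euler phi x : R := dil_exp * phi x + dot x (grad phi x).

Lemma measurable_euler phi : test_function phi -> measurable_fun setT (euler phi).
Proof.
move=> tp; apply: measurable_funD.
  by apply: measurable_funM; [exact: measurable_cst|exact: test_measurable].
by apply: measurable_dot => //; exact: test_grad_measurable.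
Qed.

Lemma continuous_euler phi : test_function phi -> continuous (euler phi).
Proof.
move=> tp; apply: continuousD_fun.
  by apply: continuousM_fun; [exact: cst_continuous|exact: test_continuous].
apply: continuous_sum_fun => i; apply: continuousM_fun; first exact: coord_continuous.
under [X in continuous X]eq_fun do rewrite mxE; exact: (test_partial_continuous tp).
Qed.

Lemma scaler_line_continuous x : continuous (fun t : R => t *: x).
Proof. by move=> t; exact: scalel_continuous. Qed.

(** Cauchy-Schwarz on the ray from x to l x. *)
Lemma dilate_pointwise phi l x : test_function phi -> 1 < l ->
  (((dilate l phi x - phi x) ^+ 2)%:E <=
   (l - 1)%:E * \int[lebesgue_measure]_(t in `[1%R, l]) (dilate t (euler phi) x ^+ 2)%:E)%E.
Proof.
move=> tp l1.
pose g (t : R) := dilate t phi x.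
pose g' (t : R) := t^-1 * dilate t (euler phi) x.
have pos t : 1 <= t <= l -> 0 < t by move=> /andP[h _]; apply: lt_le_trans h.
have cphi : continuous (fun t : R => euler phi (t *: x)).
  move=> t; apply: (continuous_comp (f := fun t : R => t *: x));
    first exact: scaler_line_continuous.
  exact: continuous_euler.
have dg (t : R) : 1 <= t <= l -> is_derive t 1 g (g' t).
  move=> /pos t0.
  have d1 := @is_derive1_powR R dil_exp t t0.
  have d2 := @is_derive_ray R N phi x t (test_differentiable tp).
  have d3 := is_deriveM d1 d2.
  rewrite (_ : g' t = t `^ dil_exp *: dot x (grad phi (t *: x)) +
    phi (t *: x) *: (dil_exp * t `^ (dil_exp - 1))); first exact: d3.
  rewrite /g' /dilate /euler dotZl /GRing.scale /=.
  rewrite powRB ?(gt_eqF t0) ?implybT// powRr1 ?(ltW t0)//; field.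
  by rewrite gt_eqF.
have cg' (t : R) : 1 <= t <= l -> {for t, continuous g'}.
  move=> /pos t0; apply: cvgM; first by apply: cvgV => //; rewrite gt_eqF.
  apply: cvgM; last exact: cphi.
  exact: (is_derive_continuous (@is_derive1_powR R dil_exp t t0)).
have := segment_CS l1 dg cg'.
rewrite {1 2}/g /dilate powR1 scale1r mul1r => /le_trans; apply.
apply: lee_wpmul2l; first by rewrite lee_fin subr_ge0 ltW.
apply: ge0_le_integral => //.
- by move=> t _; rewrite lee_fin sqr_ge0.
- apply/measurable_EFinP; apply: measurable_funX;
  apply: subspace_continuous_measurable_fun => //.
  by apply: continuous_in_subspaceT => t; rewrite inE/= in_itv/=; exact: cg'.
- apply/measurable_EFinP; apply: measurable_funTS; apply: measurable_funX;
  apply: measurable_funM.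
    exact: measurable_powR.
  exact: Rcontinuous_measurable.
- move=> t; rewrite /= in_itv/= => tl; have t0 := pos _ tl; rewrite lee_fin /g' exprMn.
  rewrite ler_piMl ?sqr_ge0// expr_le1// ?invr_ge0 ?(ltW t0)// invf_le1//.
  by case/andP: tl.
Qed.

Lemma integral_rho_dilate (h : 'rV[R]_N -> R) l : 0 < l -> measurable_fun setT h ->
  (\int[leb N]_x (rho x * dilate l h x ^+ 2)%:E = \int[leb N]_x (rho x * h x ^+ 2)%:E)%E.
Proof.
move=> l0 mh.
rewrite -(integral_leb_subst l0 (f := fun x => rho x * h x ^+ 2)).
- apply: eq_integral => x _; congr EFin.
  by rewrite /dilate rho_scale// exprMn powR_dil_exp_sqr//; ring.
- by apply: measurable_funM; [exact: measurable_rho|exact: measurable_funX].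
- by move=> x; rewrite mulr_ge0 ?sqr_ge0 ?rho_ge0.
Qed.

Lemma measurable_scale_joint :
  measurable_fun setT (fun q : measurableTypeR R * 'rV[R]_N => (q.1 : R) *: q.2).
Proof.
apply: measurable_fun_rV => i; under eq_fun do rewrite mxE.
apply: measurable_funM; first exact: measurable_fst.
exact: (measurableT_comp (@measurable_coord R N i) measurable_snd).
Qed.

(** The integral of rho (dilate t (euler phi))^2 does not depend on t, so that
    Tonelli's theorem gives a second factor l - 1. *)
Lemma integral_rho_dilate_sub phi l : test_function phi -> 1 < l ->
  (\int[leb N]_x (rho x * (dilate l phi x - phi x) ^+ 2)%:E <=
   ((l - 1) ^+ 2)%:E * \int[leb N]_x (rho x * euler phi x ^+ 2)%:E)%E.
Proof.
move=> tp l1.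
have l0 : 0 < l by apply: lt_trans l1.
have l10 : 0 <= l - 1 by rewrite subr_ge0 ltW.
have me := measurable_euler tp.
pose h (q : measurableTypeR R * 'rV[R]_N) : R :=
  \1_(`[1%R, l]%classic : set (measurableTypeR R)) q.1 *
  (rho q.2 * dilate q.1 (euler phi) q.2 ^+ 2).
have h0 q : 0 <= h q.
  by rewrite /h indicE mulr_ge0// mulr_ge0 ?sqr_ge0 ?rho_ge0.
have mh : measurable_fun setT h.
  apply: measurable_funM.
    by apply: (measurableT_comp _ measurable_fst); exact: measurable_indic.
  apply: measurable_funM; first exact: (measurableT_comp measurable_rho measurable_snd).
  apply: measurable_funX; apply: measurable_funM.
    exact: (measurableT_comp (measurable_powR dil_exp) measurable_fst).
  exact: (measurableT_comp me measurable_scale_joint).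
have mhE : measurable_fun setT (fun q => (h q)%:E) by exact/measurable_EFinP.
have hE0 q : (0 <= (h q)%:E)%E by rewrite lee_fin.
apply: (@le_trans _ _ (\int[leb N]_x ((l - 1)%:E * \int[lebesgue_measure]_t
  (h (t, x))%:E))%E).
  apply: ge0_le_integral => //.
  - by move=> x _; rewrite lee_fin mulr_ge0 ?sqr_ge0 ?rho_ge0.
  - apply/measurable_EFinP; apply: measurable_funM; first exact: measurable_rho.
    apply: measurable_funX; apply: measurable_funB; last exact: test_measurable.
    apply: measurable_funM; first exact: measurable_cst.
    exact: (measurableT_comp (test_measurable tp) (measurable_scale l)).
  - apply: emeasurable_funM; first exact: measurable_cst.
    exact: (measurable_fun_fubini_tonelli_G (m1 := lebesgue_measure) (fun q => (h q)%:E)).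
  - move=> x _; rewrite EFinM.
    apply: le_trans (lee_wpmul2l _ (dilate_pointwise x tp l1)) _;
      first by rewrite lee_fin rho_ge0.
    rewrite muleCA; apply: lee_wpmul2l; first by rewrite lee_fin.
    have mU : measurable_fun setT (fun t : R => (dilate t (euler phi) x ^+ 2)%:E).
      apply/measurable_EFinP; apply: measurable_funX; apply: measurable_funM.
        exact: measurable_powR.
      apply: (measurableT_comp me); apply: measurable_fun_rV => i;
        under eq_fun do rewrite mxE.
      by apply: measurable_funM => //; exact: measurable_cst.
    rewrite -ge0_integralZl//; last 3 first.
    + exact: measurable_funTS.
    + by move=> t _; rewrite lee_fin sqr_ge0.
    + by rewrite lee_fin rho_ge0.
    apply: le_of_eq.
    rewrite integral_mkcond; apply: eq_integral => t _; rewrite /patch /h indicE /=.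
    by case: ifP; rewrite ?mul1r// mul0r.
rewrite ge0T_integralZl//; last 2 first.
- exact: (measurable_fun_fubini_tonelli_G (m1 := lebesgue_measure) (fun q => (h q)%:E)).
- by move=> x; apply: integral_ge0 => t _.
rewrite -(@fubini_tonelli _ _ _ _ _ lebesgue_measure (leb N) (fun q => (h q)%:E))//=.
rewrite expr2 [in leRHS]EFinM -muleA; apply: lee_wpmul2l; first by rewrite lee_fin.
set E := (\int[leb N]_x (rho x * euler phi x ^+ 2)%:E)%E.
apply: le_of_eq.
transitivity (\int[lebesgue_measure]_t ((\1_(`[1%R, l]%classic : set (measurableTypeR R))
  t)%:E * E))%E.
  apply: eq_integral => t _; rewrite /h /= indicE.
  have [tl|tl] := boolP (t \in _); last first.
    by rewrite mul0e; apply: integral0_eq => x _; rewrite mul0r.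
  rewrite mul1e /E -(@integral_rho_dilate (euler phi) t)//.
    by apply: eq_integral => x _; rewrite mul1r.
  by move: tl; rewrite inE/= in_itv/= => /andP[h1 _]; apply: lt_le_trans h1.
have E0 : (0 <= E)%E by apply: integral_ge0 => x _;
  rewrite lee_fin mulr_ge0 ?sqr_ge0 ?rho_ge0.
rewrite ge0_integralZr//.
  congr (_ * E)%E; rewrite integral_indic// setIT.
  have := @lebesgue_measure_itv R `[1%R, l]; rewrite /= lte_fin l1 => h2.
  exact: h2.
by apply/measurable_EFinP; exact: measurable_indic.
Qed.

(** The two terms of euler phi are bounded in L^2(rho) by the energy: x.grad phi
    by Cauchy-Schwarz, and phi by the Hardy inequality since rho <= |x_N|^(2
    alpha - 2). *)
Lemma dilate_dist_test : exists2 C : R, 0 < C & forall phi (D l : R), test_function phi ->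
  1 < l -> 0 <= D ->
  (\int[leb N]_x (dens alpha (grad phi) x)%:E <= D%:E)%E ->
  (\int[leb N]_x (rho x * (dilate l phi x - phi x) ^+ 2)%:E <= (C * (l - 1) ^+ 2 * D)%:E)%E.
Proof.
pose CH : R := 4 / (2 * alpha - 1) ^+ 2.
have CH0 : 0 <= CH by rewrite divr_ge0// sqr_ge0.
pose c : R := 2 * dil_exp ^+ 2.
have c0 : 0 <= c by rewrite mulr_ge0 ?sqr_ge0.
exists (c * CH + 2); first by rewrite ltr_wpDl// mulr_ge0.
move=> phi D l tp l1 D0 hD.
apply: le_trans (integral_rho_dilate_sub tp l1) _.
rewrite mulrAC mulrC [leRHS]EFinM; apply: lee_wpmul2l; first by rewrite lee_fin sqr_ge0.
have a0 : 0 < alpha by apply: lt_trans a12; rewrite invr_gt0.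
pose h1 x := `|last_coord x| `^ (2 * alpha - 2) * phi x ^+ 2.
have h10 x : 0 <= h1 x by rewrite mulr_ge0 ?powR_ge0 ?sqr_ge0.
have mh1 : measurable_fun setT (fun x => (h1 x)%:E).
  apply/measurable_EFinP; apply: measurable_funM; first exact: measurable_last_powR.
  by apply: measurable_funX; exact: test_measurable.
have mdens : measurable_fun setT (fun x => (dens alpha (grad phi) x)%:E).
  by apply/measurable_EFinP; apply: measurable_dens; exact: test_grad_measurable.
apply: (@le_trans _ _ (\int[leb N]_x (c%:E * (h1 x)%:E +
  2%:E * (dens alpha (grad phi) x)%:E))%E).
  apply: ge0_le_integral => //.
  - by move=> x _; rewrite lee_fin mulr_ge0 ?sqr_ge0 ?rho_ge0.
  - apply/measurable_EFinP; apply: measurable_funM; first exact: measurable_rho.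
    by apply: measurable_funX; exact: measurable_euler.
  - by apply: emeasurable_funD; apply: emeasurable_funM => //; exact: measurable_cst.
  - move=> x _; rewrite lee_fin /euler.
    set f := phi x; set d := dot x _.
    apply: (@le_trans _ _ (2 * dil_exp ^+ 2 * (rho x * f ^+ 2) + 2 * (rho x * d ^+ 2))).
      rewrite -subr_ge0 (_ : _ - _ = rho x * (dil_exp * f - d) ^+ 2); last by ring.
      by rewrite mulr_ge0 ?sqr_ge0 ?rho_ge0.
    have [x0|x0] := eqVneq (last_coord x) 0.
      rewrite /rho x0 normr0 powR0 ?mulf_neq0 ?(gt_eqF a0)// !mul0r !mulr0 addr0.
      by apply: addr_ge0; apply: mulr_ge0 => //; exact: dens_ge0.
    have xx : last_coord x ^+ 2 <= dot x x by exact: le_coord_dot.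
    have x2 : 0 < last_coord x ^+ 2 by rewrite lt_def sqrf_eq0 x0 sqr_ge0.
    have dx : 0 < dot x x by apply: lt_le_trans xx.
    apply: lerD.
      apply: ler_wpM2l => //; apply: ler_wpM2r; first exact: sqr_ge0.
      rewrite /rho ler_pdivrMr//.
      have -> : `|last_coord x| `^ (2 * alpha) =
        `|last_coord x| `^ (2 * alpha - 2) * last_coord x ^+ 2.
        rewrite -(real_normK (num_real (last_coord x))) -powR_mulrn// -powRD ?subrK//
          normr_eq0 x0 implybT//.
      by apply: ler_wpM2l => //; exact: powR_ge0.
    apply: ler_wpM2l => //; rewrite /rho /dens -mulrA; apply: ler_wpM2l;
      first exact: powR_ge0.
    by rewrite mulrC ler_pdivrMr// mulrC; exact: dot_CS.
rewrite ge0_integralD//; last 4 first.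
- by move=> x _; rewrite mule_ge0 ?lee_fin.
- by apply: emeasurable_funM => //; exact: measurable_cst.
- by move=> x _; rewrite mule_ge0 ?lee_fin ?dens_ge0.
- by apply: emeasurable_funM => //; exact: measurable_cst.
rewrite !ge0T_integralZl//; last by move=> x; rewrite lee_fin dens_ge0.
have hH := hardy_test a12 tp hD.
apply: (@le_trans _ _ (c%:E * (CH * D)%:E + 2%:E * D%:E)%E).
  by apply: leeD; apply: lee_wpmul2l; rewrite ?lee_fin.
by rewrite -!EFinM -EFinD lee_fin; apply: le_of_eq; ring.
Qed.

End dilations_test_functions.

(** * Integrable real functions and the energy space *)

Section itg.
Context {R : realType} d (T : measurableType d) (mu : {measure set T -> \bar R}).
Implicit Types (f g : T -> R).

Definition itg f := mu.-integrable setT (EFin \o f).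
Definition Rint f : R := \int[mu]_x f x.

Lemma itg_measurable f : itg f -> measurable_fun setT f.
Proof. by move=> /measurable_int/measurable_EFinP. Qed.

Lemma itg_lty f : measurable_fun setT f -> (forall x, 0 <= f x) ->
  (\int[mu]_x (f x)%:E < +oo)%E -> itg f.
Proof.
move=> mf f0 h; apply/integrableP; split; first exact/measurable_EFinP.
by under eq_integral do rewrite /= ger0_norm//.
Qed.

Lemma itg_le_real f (b : R) : measurable_fun setT f -> (forall x, 0 <= f x) ->
  (\int[mu]_x (f x)%:E <= b%:E)%E -> itg f.
Proof. by move=> mf f0 h; apply: itg_lty => //; apply: le_lt_trans h _; rewrite ltry. Qed.

Lemma itg_dom f g : measurable_fun setT f -> itg g -> (forall x, `|f x| <= g x) -> itg f.
Proof.
move=> mf ig fg; apply: (le_integrable measurableT _ _ ig); first exact/measurable_EFinP.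
move=> x _ /=; rewrite lee_fin; apply: le_trans (fg x) _; exact: ler_norm.
Qed.

Lemma RintE f : itg f -> (\int[mu]_x (f x)%:E)%E = (Rint f)%:E.
Proof. by move=> h; rewrite /Rint /Rintegral fineK//; exact: integrable_fin_num. Qed.

Lemma itgD f g : itg f -> itg g -> itg (fun x => f x + g x).
Proof. by move=> h1 h2; exact: (integrableD measurableT h1 h2). Qed.

Lemma itgB f g : itg f -> itg g -> itg (fun x => f x - g x).
Proof. by move=> h1 h2; exact: (integrableB measurableT h1 h2). Qed.

Lemma itgZ c f : itg f -> itg (fun x => c * f x).
Proof. by move=> h1; exact: (integrableZl measurableT c h1). Qed.

Lemma RintD f g : itg f -> itg g -> Rint (fun x => f x + g x) = Rint f + Rint g.
Proof. by move=> *; exact: RintegralD. Qed.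

Lemma RintB f g : itg f -> itg g -> Rint (fun x => f x - g x) = Rint f - Rint g.
Proof. by move=> *; exact: RintegralB. Qed.

Lemma RintZ c f : itg f -> Rint (fun x => c * f x) = c * Rint f.
Proof. by move=> *; exact: RintegralZl. Qed.

Lemma Rint_ge0 f : (forall x, 0 <= f x) -> 0 <= Rint f.
Proof. by move=> h; exact: Rintegral_ge0. Qed.

Lemma le_Rint f g : itg f -> itg g -> (forall x, f x <= g x) -> Rint f <= Rint g.
Proof. by move=> h1 h2 h; exact: le_Rintegral. Qed.

Lemma norm_Rint f g : itg f -> itg g -> (forall x, `|f x| <= g x) -> `|Rint f| <= Rint g.
Proof.
move=> h1 h2 h; apply: le_trans (le_normr_Rintegral _ h1) _ => //.
apply: le_Rintegral => //; apply: (itg_dom _ h2) => [|x]; last by rewrite normr_id.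
by apply: measurableT_comp; [exact: normr_measurable|exact: itg_measurable].
Qed.

Lemma eq_Rint f g : (forall x, f x = g x) -> Rint f = Rint g.
Proof. by move=> h; apply: eq_Rintegral => x _; exact: h. Qed.

Lemma eq_itg f g : (forall x, f x = g x) -> itg f -> itg g.
Proof. by move=> h; rewrite (_ : g = f)//; apply/funext => x. Qed.

Lemma Rint_le f b : itg f -> (\int[mu]_x (f x)%:E <= b%:E)%E -> Rint f <= b.
Proof. by move=> h; rewrite RintE. Qed.

End itg.

Section energy_space.
Context {R : realType}.

Lemma itg_subst_ge0 m (l : R) (f : 'rV[R]_m -> R) : 0 < l -> (forall x, 0 <= f x) ->
  itg (leb m) f -> itg (leb m) (fun x => l ^+ m * f (l *: x)) /\
  Rint (leb m) (fun x => l ^+ m * f (l *: x)) = Rint (leb m) f.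
Proof.
move=> l0 f0 itf; have mf := itg_measurable itf.
have lm : 0 <= l ^+ m by rewrite exprn_ge0// ltW.
have h0 x : 0 <= l ^+ m * f (l *: x) by rewrite mulr_ge0.
have e := integral_leb_subst l0 mf f0.
have itg1 : itg (leb m) (fun x => l ^+ m * f (l *: x)).
  apply: itg_lty => //; last by rewrite e RintE// ltry.
  apply: measurable_funM; first exact: measurable_cst.
  exact: (measurableT_comp mf (measurable_scale l)).
by split => //; rewrite /Rint /Rintegral e.
Qed.

Lemma itg_subst m (l : R) (f : 'rV[R]_m -> R) : 0 < l ->
  itg (leb m) f -> itg (leb m) (fun x => l ^+ m * f (l *: x)) /\
  Rint (leb m) (fun x => l ^+ m * f (l *: x)) = Rint (leb m) f.
Proof.
move=> l0 itf; have mf := itg_measurable itf.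
have ia : itg (leb m) (fun x => `|f x|).
  apply/integrableP; split.
    by apply/measurable_EFinP; apply: measurableT_comp => //; exact: normr_measurable.
  have := itf; move=> /integrableP[_]; congr (_ < _)%E.
  by apply: eq_integral => x _ /=; rewrite normr_id.
have ip := itgD ia itf.
have p0 x : 0 <= `|f x| + f x by rewrite -lerBlDr sub0r -normrN ler_norm.
have [a1 a2] := itg_subst_ge0 l0 (fun x => normr_ge0 (f x)) ia.
have [b1 b2] := itg_subst_ge0 l0 p0 ip.
have e x : l ^+ m * (`|f (l *: x)| + f (l *: x)) - l ^+ m * `|f (l *: x)| =
  l ^+ m * f (l *: x).
  by ring.
have h := eq_itg e (itgB b1 a1); split => //.
by rewrite -(eq_Rint _ e) RintB// a2 b2 RintD//; ring.
Qed.

Lemma ae_scale m (l : R) (P : 'rV[R]_m -> Prop) : 0 < l ->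
  {ae leb m, forall x, P x} -> {ae leb m, forall x, P (l *: x)}.
Proof.
move=> l0 [A [mA A0 hA]].
exists ((fun x => l *: x) @^-1` A); split.
- by rewrite -[X in measurable X]setTI; exact: measurable_scale.
- have mind : measurable_fun setT (fun x : 'rV[R]_m => (\1_A x)%:E : \bar R).
    by apply/measurable_EFinP; exact: measurable_indic.
  have e1 : (\int[leb m]_x (\1_A x)%:E = 0)%E by rewrite integral_indic// setIT; exact: A0.
  have e2 : (\int[leb m]_x (\1_A (l *: x))%:E = 0)%E.
    by rewrite (integral_leb_scale l0 mind) ?e1 ?mule0// => x; rewrite lee_fin.
  rewrite -e2; have mpre : measurable ((fun x : 'rV[R]_m => l *: x) @^-1` A).
    by rewrite -[X in measurable X]setTI; exact: measurable_scale.
  by have := @integral_indic _ _ _ (leb m) _ measurableT _ mpre; rewrite setIT => <-.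
- by move=> x /= h; exact: hA.
Qed.

Lemma dens_sub_le n alpha (G H : 'rV[R]_n.+1 -> 'rV[R]_n.+1) x :
  dens alpha (fun x => G x - H x) x <= 2 * dens alpha G x + 2 * dens alpha H x.
Proof.
rewrite /dens mulrCA [2 * (_ * _)]mulrCA -mulrDr; apply: ler_wpM2l; first exact: powR_ge0.
exact: dot_sqrB.
Qed.

Section energy.
Variable n : nat.
Local Notation N := n.+3.
Variable alpha : R.
Hypothesis a12 : 2^-1 < alpha.
Local Notation mu := (leb N).
Implicit Types (x : 'rV[R]_N) (phi z : 'rV[R]_N -> R) (Dz : 'rV[R]_N -> 'rV[R]_N) (l : R).

Let a0 : 0 < alpha. Proof. by apply: lt_trans a12; rewrite invr_gt0. Qed.

(** Convergence in the completed space, with the gradient of the limit as a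
    datum of its own. *)
Definition approx (phi : nat -> 'rV[R]_N -> R) z Dz :=
  [/\ forall k, test_function (phi k),
      {ae mu, forall x, phi k x @[k --> \oo] --> z x} &
      forall e : R, 0 < e -> \forall k \near \oo,
        (\int[mu]_x (dens alpha (fun x => grad (phi k) x - Dz x) x)%:E <= e%:E)%E].

(** The elements of the completed space, as pairs of a function and its
    gradient: differences and dilations act on both components at once. *)
Definition in_energy z Dz := [/\ measurable_fun setT z, measurable_fun setT Dz &
  exists phi : nat -> 'rV[R]_N -> R, approx phi z Dz].

Lemma measurable_rVB (G H : 'rV[R]_N -> 'rV[R]_N) : measurable_fun setT G ->
  measurable_fun setT H ->
  measurable_fun setT (fun x => G x - H x).
Proof.
move=> mG mH; apply: measurable_fun_rV => i; under eq_fun do rewrite !mxE.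
apply: measurable_funB; [exact: (measurableT_comp (measurable_coord i) mG)|exact:
  (measurableT_comp (measurable_coord i) mH)].
Qed.

Lemma measurable_rVZ (c : R) (G : 'rV[R]_N -> 'rV[R]_N) : measurable_fun setT G ->
  measurable_fun setT (fun x => c *: G x).
Proof. by move=> mG; exact: (measurableT_comp (measurable_scale c) mG). Qed.

Lemma itg_test_dens phi : test_function phi -> itg mu (dens alpha (grad phi)).
Proof.
move=> tp; apply: itg_lty; last exact: test_dens_lty.
  by apply: measurable_dens; exact: test_grad_measurable.
exact: dens_ge0.
Qed.

Lemma itg_dens z Dz : in_energy z Dz -> itg mu (dens alpha Dz).
Proof.
move=> [mz mD [phi [tp _ cv]]]; have [k _ /(_ k (leqnn _)) hk] := cv 1 ltr01.
have mB : measurable_fun setT (fun x => grad (phi k) x - Dz x).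
  by apply: measurable_rVB => //; exact: test_grad_measurable.
have i1 := itg_le_real (measurable_dens alpha mB) (fun x => dens_ge0 _ _ x) hk.
have i2 := itg_test_dens (tp k).
apply: (itg_dom _ (itgD (itgZ 2 i2) (itgZ 2 i1))); first exact: measurable_dens.
move=> x; rewrite ger0_norm ?dens_ge0//; apply: le_trans (dens_sub_le _ _ _ _).
by rewrite /dens opprB addrC subrK.
Qed.

(** The factor 4 comes from |b|^2 <= 2 |b - a|^2 + 2 |a|^2. *)
Lemma approx_energy (phi : nat -> 'rV[R]_N -> R) z Dz (D : R) : in_energy z Dz ->
  approx phi z Dz -> 0 < D ->
  (\int[mu]_x (dens alpha Dz x)%:E <= D%:E)%E ->
  \forall k \near \oo, (\int[mu]_x (dens alpha (grad (phi k)) x)%:E <= (4 * D)%:E)%E.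
Proof.
move=> hz [tp _ cv] D0 hD; near=> k.
have mD : measurable_fun setT Dz by case: hz.
have hk : (\int[mu]_x (dens alpha (fun x => grad (phi k) x - Dz x) x)%:E <= D%:E)%E.
  by near: k; exact: cv.
have mB : measurable_fun setT (fun x => grad (phi k) x - Dz x).
  by apply: measurable_rVB => //; exact: test_grad_measurable.
have i1 := itg_le_real (measurable_dens alpha mB) (fun x => dens_ge0 _ _ x) hk.
have i2 := itg_test_dens (tp k).
have i3 := itg_dens hz.
rewrite RintE// lee_fin.
apply: (@le_trans _ _ (Rint mu (fun x => 2 * dens alpha (fun x => grad (phi k) x - Dz x)
  x + 2 * dens alpha Dz x))).
  apply: le_Rint => //; first by apply: itgD; exact: itgZ.
  move=> x; have := dens_sub_le alpha (fun x => grad (phi k) x - Dz x) (fun x => - Dz x) x.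
  by rewrite /dens dotNl dotNr !opprK subrK.
rewrite RintD ?RintZ//; [|exact: itgZ|exact: itgZ].
have := Rint_le i1 hk; have := Rint_le i3 hD; lra.
Unshelve. all: by end_near. Qed.

Lemma in_energy_test phi : test_function phi -> in_energy phi (grad phi).
Proof.
move=> tp; split; [exact: test_measurable|exact: test_grad_measurable|].
exists (fun=> phi); split => //.
  by apply: aeW => x; exact: cvg_cst.
move=> e e0; near=> k; rewrite integral0_eq ?lee_fin ?ltW// => x _.
by rewrite /dens subrr /dot big1 ?mulr0// => i _; rewrite mxE mulr0.
Unshelve. all: by end_near. Qed.

Lemma in_energy_sub z1 D1 z2 D2 : in_energy z1 D1 -> in_energy z2 D2 ->
  in_energy (fun x => z1 x - z2 x) (fun x => D1 x - D2 x).
Proof.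
move=> [mz1 mD1 [p1 [t1 c1 e1]]] [mz2 mD2 [p2 [t2 c2 e2]]]; split.
- exact: measurable_funB.
- exact: measurable_rVB.
exists (fun k x => p1 k x - p2 k x); split.
- by move=> k; exact: test_functionB.
- apply: filterS2 c1 c2 => x h1 h2; exact: cvgB.
move=> e e0; have e40 : 0 < e / 4 by rewrite divr_gt0.
near=> k.
have h1 : (\int[mu]_x (dens alpha (fun x => grad (p1 k) x - D1 x) x)%:E <= (e / 4)%:E)%E.
  by near: k; exact: e1.
have h2 : (\int[mu]_x (dens alpha (fun x => grad (p2 k) x - D2 x) x)%:E <= (e / 4)%:E)%E.
  by near: k; exact: e2.
have m1 : measurable_fun setT (fun x => grad (p1 k) x - D1 x).
  by apply: measurable_rVB => //; exact: test_grad_measurable.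
have m2 : measurable_fun setT (fun x => grad (p2 k) x - D2 x).
  by apply: measurable_rVB => //; exact: test_grad_measurable.
have i1 := itg_le_real (measurable_dens alpha m1) (fun x => dens_ge0 _ _ x) h1.
have i2 := itg_le_real (measurable_dens alpha m2) (fun x => dens_ge0 _ _ x) h2.
have E x : dens alpha (fun x => grad (fun y => p1 k y - p2 k y) x - (D1 x - D2 x)) x =
   dens alpha (fun x => (grad (p1 k) x - D1 x) - (grad (p2 k) x - D2 x)) x.
  rewrite /dens (gradB (test_differentiable (t1 k) x) (test_differentiable (t2 k) x)).
  suff -> : grad (p1 k) x - grad (p2 k) x - (D1 x - D2 x) = grad (p1 k) x - D1 x -
    (grad (p2 k) x - D2 x) by [].
  move: (grad (p1 k) x) (grad (p2 k) x) (D1 x) (D2 x) => a b c d.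
  by apply/rowP => i; rewrite !mxE; ring.
under eq_integral do rewrite E.
have i3 : itg mu (dens alpha (fun x => (grad (p1 k) x - D1 x) - (grad (p2 k) x - D2 x))).
  apply: (itg_dom _ (itgD (itgZ 2 i1) (itgZ 2 i2))).
    by apply: measurable_dens; exact: measurable_rVB.
  by move=> x; rewrite ger0_norm ?dens_ge0//; exact: dens_sub_le.
rewrite RintE// lee_fin; apply: (@le_trans _ _
  (Rint mu (fun x => 2 * dens alpha (fun x => grad (p1 k) x - D1 x) x +
  2 * dens alpha (fun x => grad (p2 k) x - D2 x) x))).
  apply: le_Rint => //; first by apply: itgD; exact: itgZ.
  by move=> x; exact: dens_sub_le.
rewrite RintD ?RintZ//; [|exact: itgZ|exact: itgZ].
have := Rint_le i1 h1; have := Rint_le i2 h2; lra.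
Unshelve. all: by end_near. Qed.

Definition dilate_grad l (G : 'rV[R]_N -> 'rV[R]_N) x :=
  (l `^ dil_exp n alpha * l) *: G (l *: x).

Lemma dot_dilate_grad l (G H : 'rV[R]_N -> 'rV[R]_N) x : 0 < l ->
  `|last_coord x| `^ (2 * alpha) * dot (dilate_grad l G x) (dilate_grad l H x) =
  l ^+ N * (`|last_coord (l *: x)| `^ (2 * alpha) * dot (G (l *: x)) (H (l *: x))).
Proof.
move=> l0; rewrite dotZl dotZr last_powR_scale//.
have -> : l `^ (2 * alpha) = l `^ (2 * alpha - 2) * l ^+ 2.
  by rewrite -powR_mulrn ?(ltW l0)// -powRD ?subrK// (gt_eqF l0) implybT.
have h := powR_dil_exp_sqr n alpha l0.
transitivity ((l `^ dil_exp n alpha) ^+ 2 * l ^+ 2 *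
  (`|last_coord x| `^ (2 * alpha) * dot (G (l *: x)) (H (l *: x)))); first by ring.
by rewrite h; ring.
Qed.

Lemma dens_dilate_grad l (G : 'rV[R]_N -> 'rV[R]_N) x : 0 < l ->
  dens alpha (dilate_grad l G) x = l ^+ N * dens alpha G (l *: x).
Proof. exact: dot_dilate_grad. Qed.

Lemma measurable_dilate_grad l (G : 'rV[R]_N -> 'rV[R]_N) : measurable_fun setT G ->
  measurable_fun setT (dilate_grad l G).
Proof.
move=> mG; apply: measurable_rVZ; exact: (measurableT_comp mG (measurable_scale l)).
Qed.

Lemma measurable_dilate l z : measurable_fun setT z ->
  measurable_fun setT (dilate alpha l z).
Proof.
move=> mz; apply: measurable_funM; first exact: measurable_cst.
exact: (measurableT_comp mz (measurable_scale l)).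
Qed.

Lemma test_dilate l phi : 0 < l -> test_function phi -> test_function (dilate alpha l phi).
Proof. by move=> l0 tp; apply: test_function_dilation => //; rewrite gt_eqF. Qed.

Lemma grad_dilate l phi x : test_function phi -> grad (dilate alpha l phi) x =
  dilate_grad l (grad phi) x.
Proof. by move=> tp; rewrite grad_dilation//; exact: test_differentiable. Qed.

Lemma in_energy_dilate l z Dz : 0 < l -> in_energy z Dz ->
  in_energy (dilate alpha l z) (dilate_grad l Dz).
Proof.
move=> l0 [mz mD [p [tp cp ep]]]; split; [exact: measurable_dilate|exact:
  measurable_dilate_grad|].
exists (fun k => dilate alpha l (p k)); split.
- by move=> k; exact: test_dilate.
- move: (ae_scale l0 cp); apply: filterS => x h; rewrite /dilate; exact: cvgMl_tmp.
move=> e e0; move: (ep e e0); apply: filterS => k; apply: le_trans.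
have E x : dens alpha (fun x => grad (dilate alpha l (p k)) x - dilate_grad l Dz x) x =
    l ^+ N * dens alpha (fun x => grad (p k) x - Dz x) (l *: x).
  by rewrite -dens_dilate_grad// /dens grad_dilate// /dilate_grad scalerBr.
under eq_integral do rewrite E.
rewrite (integral_leb_subst l0)//; last exact: dens_ge0.
by apply: measurable_dens; apply: measurable_rVB => //; exact: test_grad_measurable.
Qed.

(** The estimate for test functions, carried to the limit by Fatou's lemma. *)
Lemma dilate_dist : exists2 C : R, 0 < C & forall z Dz (D l : R), in_energy z Dz ->
  1 < l -> 0 < D ->
  (\int[mu]_x (dens alpha Dz x)%:E <= D%:E)%E ->
  (\int[mu]_x (rho alpha x * (dilate alpha l z x - z x) ^+ 2)%:E <=
    (C * (l - 1) ^+ 2 * D)%:E)%E.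
Proof.
have [C C0 hC] := dilate_dist_test n a12.
exists (C * 4); first by rewrite mulr_gt0.
move=> z Dz D l hz l1 D0 hD.
have l0 : 0 < l by apply: lt_trans l1.
have [mz mD [p ap]] := hz; have [tp cp ep] := ap.
have mq (y : 'rV[R]_N -> R) : measurable_fun setT y ->
    measurable_fun setT (fun x => rho alpha x * (dilate alpha l y x - y x) ^+ 2).
  move=> my; apply: measurable_funM; first exact: measurable_rho.
  by apply: measurable_funX; apply: measurable_funB => //; exact: measurable_dilate.
apply: (@fatou_le _ _ _ mu (fun k x => rho alpha x * (dilate alpha l (p k) x - p k x)
  ^+ 2)).
- by move=> k; apply: mq; exact: test_measurable.
- exact: mq.
- by move=> k x; rewrite mulr_ge0 ?sqr_ge0 ?rho_ge0.
- by move=> x; rewrite mulr_ge0 ?sqr_ge0 ?rho_ge0.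
- apply: filterS2 cp (ae_scale l0 cp) => x h1 h2; apply: cvgMl_tmp.
  apply: (@continuous_cvg _ _ _ _ _ _ (fun t : R => t ^+ 2));
    first by apply: exprn_continuous.
  by apply: cvgB => //; apply: cvgMl_tmp.
- move=> e e0; have := approx_energy hz ap D0 hD; apply: filterS => k hk.
  apply: le_trans (hC _ _ _ (tp k) l1 _ hk) _; first by rewrite mulr_ge0// ltW.
  by rewrite lee_fin (_ : C * 4 * _ * D = C * (l - 1) ^+ 2 * (4 * D));
    [rewrite lerDl ltW|ring].
Qed.

Section hsE.
Variable s : R.
Hypothesis s02 : 0 <= s <= 2.
Local Notation p := (@crit_exp R N s).
Local Notation w := (wt alpha s).

Lemma measurable_wpow z : measurable_fun setT z ->
  measurable_fun setT (fun x => w x * `|z x| `^ p).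
Proof.
move=> mz; apply: measurable_funM; first exact: measurable_wt.
apply: measurable_fun_powR; apply: measurableT_comp => //; exact: normr_measurable.
Qed.

(** The estimate for test functions, carried to the limit by Fatou's lemma. *)
Lemma hardy_sobolev : exists2 C : R, 0 < C & forall z Dz (D : R), in_energy z Dz -> 0 < D ->
  (\int[mu]_x (dens alpha Dz x)%:E <= D%:E)%E ->
  (\int[mu]_x (w x * `|z x| `^ p)%:E <= (C * D `^ (p / 2))%:E)%E.
Proof.
have p0 : 0 < p by apply: lt_le_trans (crit_ge2 n s02).
have [C C0 hC] := hardy_sobolev_test n a12 s02.
exists (C * 4 `^ (p / 2)); first by rewrite mulr_gt0// powR_gt0.
move=> z Dz D hz D0 hD.
have [mz mD [q ap]] := hz; have [tp cp ep] := ap.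
apply: (@fatou_le _ _ _ mu (fun k x => w x * `|q k x| `^ p)).
- by move=> k; apply: measurable_wpow; exact: test_measurable.
- exact: measurable_wpow.
- by move=> k x; rewrite mulr_ge0 ?powR_ge0.
- by move=> x; rewrite mulr_ge0 ?powR_ge0.
- apply: filterS cp => x h1; apply: cvgMl_tmp.
  apply: (@continuous_cvg _ _ _ _ _ _ (fun t : R => `|t| `^ p)); last exact: h1.
  exact: continuous_normpowR.
- move=> e e0; have := approx_energy hz ap D0 hD; apply: filterS => k hk.
  have D40 : 0 < 4 * D by rewrite mulr_gt0.
  apply: le_trans (hC _ _ (tp k) D40 hk) _.
  by rewrite lee_fin powRM ?(ltW D0)// mulrA lerDl ltW.
Qed.

Lemma itg_wpow z Dz : in_energy z Dz -> itg mu (fun x => w x * `|z x| `^ p).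
Proof.
move=> hz; have [C C0 hC] := hardy_sobolev; have id := itg_dens hz.
pose D := Rint mu (dens alpha Dz) + 1.
have D0 : 0 < D by rewrite ltr_wpDl// Rint_ge0// => x; exact: dens_ge0.
have mz : measurable_fun setT z by case: hz.
apply: (itg_le_real (measurable_wpow mz) _ (hC z Dz D hz D0 _)).
  by move=> x; rewrite mulr_ge0 ?powR_ge0.
by rewrite RintE// lee_fin /D lerDl.
Qed.

End hsE.
End energy.

End energy_space.

(** * The weak equation in the energy space *)

Section weak_equation.
Context {R : realType}.

Lemma young_eps (p e a b : R) : 1 < p -> 0 < e -> 0 <= a -> 0 <= b ->
  a `^ (p - 1) * b <= e * a `^ p + e `^ (1 - p) * b `^ p.
Proof.
move=> p1 e0 a0 b0; have p0 : 0 < p by apply: lt_trans p1.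
pose t := (p - 1) / p.
have t01 : 0 <= t <= 1.
  rewrite /t divr_ge0 ?subr_ge0 ?(ltW p1) ?(ltW p0)//=.
  by rewrite ler_pdivrMr// mul1r lerBlDr lerDl.
have h1 : 0 <= e * a `^ p by rewrite mulr_ge0 ?powR_ge0 ?(ltW e0).
have h2 : 0 <= e `^ (1 - p) * b `^ p by rewrite mulr_ge0 ?powR_ge0.
have := powR_young t01 h1 h2.
have -> : (e * a `^ p) `^ t * (e `^ (1 - p) * b `^ p) `^ (1 - t) = a `^ (p - 1) * b.
  rewrite (powRM _ (ltW e0) (powR_ge0 _ _)) (powRM _ (powR_ge0 _ _) (powR_ge0 _ _))
    -!powRrM.
  rewrite (_ : p * t = p - 1); last by rewrite /t; field; rewrite gt_eqF.
  rewrite (_ : p * (1 - t) = 1); last by rewrite /t; field; rewrite gt_eqF.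
  rewrite powRr1// mulrACA -powRD ?(gt_eqF e0) ?implybT//.
  rewrite (_ : t + _ = 0) ?powRr0 ?mul1r//; rewrite /t; field; by rewrite gt_eqF.
move=> /le_trans; apply; apply: lerD; rewrite ler_piMl//; first by case/andP: t01.
by rewrite lerBlDr lerDl; case/andP: t01.
Qed.

Section weak.
Variable n : nat.
Local Notation N := n.+3.
Variables (alpha s : R).
Hypotheses (a12 : 2^-1 < alpha) (s02 : 0 <= s <= 2).
Local Notation mu := (leb N).
Local Notation p := (@crit_exp R N s).
Local Notation w := (wt alpha s).
Variables (K u : 'rV[R]_N -> R) (Du : 'rV[R]_N -> 'rV[R]_N) (M : R).
Hypotheses (mK : measurable_fun setT K) (M0 : 0 < M) (KM : forall x, `|K x| <= M).
Hypothesis uE : in_energy alpha u Du.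

Let p1 : 1 < p.
Proof. by apply: lt_le_trans (crit_ge2 n s02); rewrite ltr1n. Qed.

Definition weak_form z (Dz : 'rV[R]_N -> 'rV[R]_N) x : R :=
  `|last_coord x| `^ (2 * alpha) * dot (Du x) (Dz x) -
  K x * w x * `|u x| `^ (p - 2) * u x * z x.

Hypothesis weak : forall phi, test_function phi ->
  (\int[mu]_x (`|last_coord x| `^ (2 * alpha) * dot (Du x) (grad phi x))%:E =
   \int[mu]_x (K x * w x * `|u x| `^ (p - 2) * u x * phi x)%:E)%E.

Lemma norm_dens_dot (e : R) (G H : 'rV[R]_N -> 'rV[R]_N) x : 0 < e ->
  `| `|last_coord x| `^ (2 * alpha) * dot (G x) (H x)| <= e * dens alpha G x +
    e^-1 * dens alpha H x.
Proof.
move=> e0; rewrite normrM ger0_norm ?powR_ge0// /dens [e * _]mulrCA [e^-1 * _]mulrCA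
  -mulrDr.
by apply: ler_wpM2l; [exact: powR_ge0|exact: dot_young].
Qed.

Lemma norm_weak_rhs (e : R) (z : 'rV[R]_N -> R) x : 0 < e ->
  `|K x * w x * `|u x| `^ (p - 2) * u x * z x| <=
  M * (e * (w x * `|u x| `^ p) + e `^ (1 - p) * (w x * `|z x| `^ p)).
Proof.
move=> e0; rewrite -!mulrA normrM; apply: ler_pM => //.
rewrite normrM (ger0_norm (wt_ge0 _ _ _)) [e * _]mulrCA [e `^ _ * _]mulrCA -mulrDr.
apply: ler_wpM2l; first exact: wt_ge0.
rewrite mulrA normrM.
have -> : `| `|u x| `^ (p - 2) * u x| = `|u x| `^ (p - 1).
  have := @normr_spow R (p - 1) (u x); rewrite /spow (_ : p - 1 - 1 = p - 2); last by ring.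
  by apply; rewrite subr_eq0 gt_eqF.
exact: young_eps.
Qed.

(** The parameter e makes the contribution of u small, at the price of a large
    constant in front of the contribution of z. *)
Lemma norm_weak_form (e : R) z Dz x : 0 < e -> `|weak_form z Dz x| <=
  e * (dens alpha Du x + M * (w x * `|u x| `^ p)) +
  (e^-1 * dens alpha Dz x + M * e `^ (1 - p) * (w x * `|z x| `^ p)).
Proof.
move=> e0; apply: le_trans (ler_normB _ _) _.
apply: le_trans (lerD (norm_dens_dot Du Dz x e0) (norm_weak_rhs z x e0)) _.
by apply: le_of_eq; ring.
Qed.

Lemma measurable_dens_dot (G H : 'rV[R]_N -> 'rV[R]_N) : measurable_fun setT G ->
  measurable_fun setT H ->
  measurable_fun setT (fun x => `|last_coord x| `^ (2 * alpha) * dot (G x) (H x)).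
Proof. by move=> mG mH; apply: measurable_funM;
  [exact: measurable_last_powR|exact: measurable_dot]. Qed.

Lemma itg_dens_dot z1 D1 z2 D2 : in_energy alpha z1 D1 -> in_energy alpha z2 D2 ->
  itg mu (fun x => `|last_coord x| `^ (2 * alpha) * dot (D1 x) (D2 x)).
Proof.
move=> h1 h2; apply: (itg_dom _ (itgD (itgZ 1 (itg_dens a12 h1))
  (itgZ 1^-1 (itg_dens a12 h2)))).
  by case: h1 h2 => [_ m1 _] [_ m2 _]; exact: measurable_dens_dot.
by move=> x; exact: norm_dens_dot.
Qed.

Lemma measurable_weak_rhs z : measurable_fun setT z ->
  measurable_fun setT (fun x => K x * w x * `|u x| `^ (p - 2) * u x * z x).
Proof.
move=> mz; have mu' : measurable_fun setT u by case: uE.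
apply: measurable_funM => //; apply: measurable_funM => //; apply: measurable_funM.
  by apply: measurable_funM => //; exact: measurable_wt.
by apply: measurable_fun_powR; apply: measurableT_comp => //; exact: normr_measurable.
Qed.

Lemma itg_weak_rhs z Dz : in_energy alpha z Dz ->
  itg mu (fun x => K x * w x * `|u x| `^ (p - 2) * u x * z x).
Proof.
move=> hz; apply: (itg_dom _ (itgZ M (itgD (itgZ 1 (itg_wpow a12 s02 uE))
  (itgZ (1 `^ (1 - p)) (itg_wpow a12 s02 hz))))).
  by case: hz => mz _ _; exact: measurable_weak_rhs.
by move=> x; exact: norm_weak_rhs.
Qed.

Lemma itg_weak_form z Dz : in_energy alpha z Dz -> itg mu (weak_form z Dz).
Proof. by move=> hz; apply: itgB; [exact: (itg_dens_dot uE hz)|exact: (itg_weak_rhs hz)].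
  Qed.

Lemma Rint_weak_form_test phi : test_function phi -> Rint mu (weak_form phi (grad phi)) = 0.
Proof.
move=> tp; have hp := in_energy_test alpha tp.
rewrite RintB; [|exact: (itg_dens_dot uE hp)|exact: (itg_weak_rhs hp)].
by rewrite /Rint /Rintegral (weak tp) subrr.
Qed.

(** The test functions q approximating z satisfy the equation, and the error
    term is weak_form evaluated at q - z. Its integral is at most e A + C(e, D),
    where A only depends on u and D bounds the energy of q - z; first e and then
    D are chosen small. *)
Lemma Rint_weak_form z Dz : in_energy alpha z Dz -> Rint mu (weak_form z Dz) = 0.
Proof.
move=> hz; have [C C0 hC] := hardy_sobolev n a12 s02.
have p0 : 0 < p by apply: lt_trans p1.
have iu := itg_dens a12 uE; have iw := itg_wpow a12 s02 uE.
pose A : R := Rint mu (fun x => dens alpha Du x + M * (w x * `|u x| `^ p)).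
have iA : itg mu (fun x => dens alpha Du x + M * (w x * `|u x| `^ p)).
  by apply: itgD => //; exact: itgZ.
have A0 : 0 <= A.
  apply: Rint_ge0 => x; rewrite addr_ge0 ?dens_ge0// mulr_ge0 ?(ltW M0)// mulr_ge0
    ?powR_ge0//.
have key (e D : R) : 0 < e -> 0 < D ->
    `|Rint mu (weak_form z Dz)| <= e * A + (e^-1 * D +
      M * e `^ (1 - p) * (C * D `^ (p / 2))).
  move=> e0 D0; have [mz mD [q [tq cq eq]]] := hz.
  have [k _ /(_ k (leqnn _)) hk] := eq D D0.
  have hq := in_energy_test alpha (tq k); have hd := in_energy_sub hq hz.
  have id := itg_dens a12 hd; have iwd := itg_wpow a12 s02 hd.
  have -> : Rint mu (weak_form z Dz) = - Rint mu
    (weak_form (fun x => q k x - z x) (fun x => grad (q k) x - Dz x)).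
    rewrite (@eq_Rint _ _ _ _ (weak_form (fun x => q k x - z x) _)
      (fun x => weak_form (q k) (grad (q k)) x - weak_form z Dz x)).
      by rewrite RintB ?Rint_weak_form_test ?sub0r ?opprK//; exact: itg_weak_form.
    by move=> x; rewrite /weak_form dotDr dotNr; ring.
  rewrite normrN.
  have i1 := itgZ e iA.
  have i2 := itgZ e^-1 id.
  have i3 := itgZ (M * e `^ (1 - p)) iwd.
  apply: le_trans (norm_Rint (itg_weak_form hd) (itgD i1 (itgD i2 i3)) _) _;
    first by move=> x; exact: norm_weak_form.
  rewrite (RintD i1 (itgD i2 i3)) (RintD i2 i3) !RintZ//; apply: lerD => //; apply: lerD.
    by apply: ler_wpM2l; [rewrite invr_ge0 ltW|exact: (Rint_le id hk)].
  apply: ler_wpM2l; first by rewrite mulr_ge0 ?powR_ge0 ?(ltW M0).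
  exact: (Rint_le iwd (hC _ _ _ hd D0 hk)).
apply/eqP; rewrite -normr_le0; apply/ler_addgt0Pr => eps eps0; rewrite add0r.
(* The two summands below are made at most e each, so that the total is e (A +
   2). *)
pose e : R := eps / (A + 2).
have A2 : 0 < A + 2 by rewrite ltr_wpDl.
have e0 : 0 < e by rewrite divr_gt0.
pose B : R := M * e `^ (1 - p) * C.
have B0 : 0 < B by rewrite mulr_gt0// mulr_gt0// powR_gt0.
pose D : R := Num.min (e ^+ 2) ((e / B) `^ (2 / p)).
have D0 : 0 < D by rewrite lt_min exprn_gt0//= powR_gt0// divr_gt0.
apply: le_trans (key e D e0 D0) _.
rewrite (_ : eps = e * A + (e + e)); last by rewrite /e; field; rewrite gt_eqF.
rewrite lerD2l; apply: lerD.
  by rewrite ler_pdivrMl// -expr2 ge_min lexx.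
rewrite mulrA -/B mulrC -ler_pdivlMr//.
apply: (@le_trans _ _ (((e / B) `^ (2 / p)) `^ (p / 2))).
  have p20 : 0 <= p / 2 by apply: divr_ge0 => //; exact: ltW.
  apply: ge0_ler_powR => //; rewrite ?nnegrE ?powR_ge0 ?(ltW D0)//.
  by rewrite ge_min lexx orbT.
have pp : 2 / p * (p / 2) = 1 by field; rewrite gt_eqF.
by rewrite -powRrM pp powRr1// divr_ge0 ?(ltW e0) ?(ltW B0).
Qed.

End weak.
End weak_equation.

(** * The coefficient along rays *)

Section coefficient.
Context {R : realType}.
Variable m : nat.
Implicit Types (x y : 'rV[R]_m).

Lemma continuous_bounded_on (g : 'rV[R]_m -> R) (C : set 'rV[R]_m) : continuous g ->
  compact C ->
  exists2 M : R, 0 < M & forall x, C x -> `|g x| <= M.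
Proof.
move=> cg cC.
have /compact_bounded[M [_ h]] : compact (g @` C).
  by apply: continuous_compact => //; exact: continuous_subspaceT.
exists (`|M| + 1); first by rewrite ltr_wpDl.
move=> x Cx; have := h (`|M| + 1); rewrite ltr_pwDr ?ler_norm// => /(_ isT) /(_ (g x)) /=.
by apply; exists x.
Qed.

Definition unit_ball : set 'rV[R]_m := [set x | dot x x <= 1].

Lemma continuous_dot (f g : 'rV[R]_m -> 'rV[R]_m) :
  (forall i, continuous (fun x => f x ord0 i)) ->
    (forall i, continuous (fun x => g x ord0 i)) ->
  continuous (fun x => dot (f x) (g x)).
Proof. by move=> cf cg; apply: continuous_sum_fun => i; exact: continuousM_fun. Qed.

Lemma compact_unit_ball : compact unit_ball.
Proof.
apply: bounded_closed_compact.
  exists 2; split; first exact: num_real.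
  move=> M M2 x /= x1; apply: le_trans (ltW M2); apply: ltW; apply: rV_normP => // i.
  apply: (@le_lt_trans _ _ 1); last by rewrite ltr1n.
  rewrite -(@ler_pXn2r _ 2)// ?nnegrE// expr1n real_normK ?num_real//.
  exact: le_trans (le_coord_dot x i) x1.
have cd : continuous (fun x : 'rV[R]_m => dot x x).
  by apply: continuous_dot => i; exact: coord_continuous.
exact: (preimage_closed (fun x _ => cd x) (@closed_le R 1)).
Qed.

Lemma inversionK x : x != 0 -> inversion (inversion x) = x.
Proof.
move=> x0; have d0 : dot x x != 0 by apply: contra_neq x0; exact: dot_eq0.
rewrite /inversion dotZl dotZr scalerA (_ : _ * _ = 1) ?scale1r//.
by field.
Qed.

Lemma dot_inversion x : x != 0 -> dot (inversion x) (inversion x) = (dot x x)^-1.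
Proof.
move=> x0; have d0 : dot x x != 0 by apply: contra_neq x0; exact: dot_eq0.
by rewrite /inversion dotZl dotZr; field.
Qed.

Lemma inversion_scale (t : R) x : t != 0 -> inversion (t *: x) = t^-1 *: inversion x.
Proof.
move=> t0; rewrite /inversion dotZl dotZr !scalerA; congr (_ *: _).
by rewrite mulrA invfM mulrAC; congr (_ * _); field.
Qed.

Section K.
Variables (K Khat : 'rV[R]_m -> R).
Hypotheses (cK : Ck 1 K) (cKh : Ck 1 Khat) (KKh : forall x, x != 0 -> Khat x =
  K (inversion x)).

Let dK x : differentiable K x. Proof. by case: cK. Qed.
Let dKh x : differentiable Khat x. Proof. by case: cKh. Qed.

Lemma inversion_neq0 x : x != 0 -> inversion x != 0.
Proof.
move=> x0; have d0 : dot x x != 0 by apply: contra_neq x0; exact: dot_eq0.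
by rewrite /inversion scaler_eq0 negb_or invr_eq0 d0 x0.
Qed.

Lemma K_out x : x != 0 -> K x = Khat (inversion x).
Proof. by move=> x0; rewrite KKh ?inversion_neq0// inversionK. Qed.

(** K (t x) = Khat (t^-1 x / |x|^2): along a ray K and Khat agree up to the
    reversal t |-> t^-1 of the parameter, whose derivative at 1 is -1. *)
Lemma K_ray_out x : x != 0 -> dot x (grad K x) =
  - dot (inversion x) (grad Khat (inversion x)).
Proof.
move=> x0.
have d1 : is_derive (1 : R) 1 (fun t : R => K (t *: x)) (dot x (grad K x)).
  by have := @is_derive_ray R m K x 1 dK; rewrite scale1r.
have d2 : is_derive (1 : R) 1 (fun t : R => Khat (t *: inversion x))
  (dot (inversion x) (grad Khat (inversion x))).
  by have := @is_derive_ray R m Khat (inversion x) 1 dKh; rewrite scale1r.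
have d3 : is_derive (1 : R) 1 (fun t : R => t^-1) (-1).
  have := @is_deriveV R id 1 1 1 (oner_neq0 _) (is_derive_id _ _).
  by rewrite expr1n invr1 scaleN1r.
have d4 : is_derive (1 : R) 1 (fun t : R => Khat (t^-1 *: inversion x))
  (- dot (inversion x) (grad Khat (inversion x))).
  have d2' : is_derive ((1 : R)^-1) 1 (fun t : R => Khat (t *: inversion x))
    (dot (inversion x) (grad Khat (inversion x))).
    by rewrite invr1.
  by have := @is_derive1_comp R _ _ 1 _ _ d2' d3; rewrite mulrN1.
have near1 : \forall t \near (1 : R), Khat (t^-1 *: inversion x) = K (t *: x).
  near=> t; have t0 : t != 0.
    by rewrite gt_eqF//; near: t; exact: lt_nbhsr.
  by rewrite -inversion_scale// -K_out// scaler_eq0 negb_or t0.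
have [_ <-] := near_eq_is_derive near1 d4.
by have [_ ->] := d1.
Unshelve. all: by end_near. Qed.

Lemma out_ball x : ~ unit_ball x -> x != 0 /\ unit_ball (inversion x).
Proof.
move=> /negP; rewrite -ltNge => x1.
have x0 : x != 0.
  apply: contraTneq x1 => ->; rewrite -leNgt /dot big1// => i _; by rewrite mxE mul0r.
split => //; rewrite /unit_ball /= dot_inversion// invf_le1 ?(ltW x1)//.
exact: lt_trans x1.
Qed.

Lemma K_bound : exists2 M : R, 0 < M & forall x, `|K x| <= M.
Proof.
have [M1 M10 h1] := continuous_bounded_on (Ck_continuous cK) compact_unit_ball.
have [M2 M20 h2] := continuous_bounded_on (Ck_continuous cKh) compact_unit_ball.
exists (M1 + M2); first exact: addr_gt0.
move=> x; have [xB|/out_ball[x0 xB]] := pselect (unit_ball x).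
  by apply: le_trans (h1 _ xB) _; rewrite lerDl ltW.
by rewrite K_out//; apply: le_trans (h2 _ xB) _; rewrite lerDr ltW.
Qed.

Lemma continuous_ray (k : 'rV[R]_m -> R) : Ck 1 k -> continuous (fun x => dot x (grad k x)).
Proof.
move=> [_ pk]; apply: continuous_dot => i; first exact: coord_continuous.
by under [X in continuous X]eq_fun do rewrite mxE; exact: pk.
Qed.

(** The ray derivative is continuous, hence bounded on the unit ball; inversion
    maps the complement of the ball into the ball. *)
Lemma K_ray_bound : exists2 L : R, 0 < L & forall x, `|dot x (grad K x)| <= L.
Proof.
have [M1 M10 h1] := continuous_bounded_on (continuous_ray cK) compact_unit_ball.
have [M2 M20 h2] := continuous_bounded_on (continuous_ray cKh) compact_unit_ball.
exists (M1 + M2); first exact: addr_gt0.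
move=> x; have [xB|/out_ball[x0 xB]] := pselect (unit_ball x).
  by apply: le_trans (h1 _ xB) _; rewrite lerDl ltW.
by rewrite K_ray_out// normrN; apply: le_trans (h2 _ xB) _; rewrite lerDr ltW.
Qed.

(** The mean value theorem along the ray: the derivative of t |-> K (t x) is
    t^-1 times the ray derivative at t x, and t >= 1/2. *)
Lemma K_lip : exists2 L : R, 0 < L & forall (l : R) x, 2^-1 <= l -> `|K (l *: x) - K x| <=
  L * `|l - 1|.
Proof.
have [L L0 hL] := K_ray_bound.
exists (2 * L); first by rewrite mulr_gt0.
move=> l x l2.
have [c] := @mean_value R (fun t => K (t *: x)) _ 1 l
  (fun t => @is_derive_ray R m K x t dK).
rewrite in_itv/= scale1r => /andP[c1 _] ->.
rewrite normrM ler_wpM2r//.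
have c2 : 2^-1 <= c by apply: le_trans c1; rewrite le_min l2 andbT invf_le1// ler1n.
have c0 : 0 < c by apply: lt_le_trans c2; rewrite invr_gt0.
have := hL (c *: x); rewrite dotZl normrM (gtr0_norm c0) => h.
rewrite -(ler_pM2l c0); apply: le_trans h _.
rewrite mulrA -[leLHS]mul1r ler_wpM2r ?(ltW L0)//.
by rewrite -ler_pdivrMr// mul1r.
Qed.

(** Dominated convergence; by K_lip the difference quotients are bounded by a
    multiple of g. *)
Lemma K_dct (mu : {measure set 'rV[R]_m -> \bar R}) (g : 'rV[R]_m -> R) (l_ : nat -> R) :
  itg mu g -> (forall x, 0 <= g x) ->
  (forall k, 2^-1 <= l_ k) -> (forall k, l_ k != 1) -> l_ @ \oo --> (1 : R) ->
  (fun k => Rint mu (fun x => (K (l_ k *: x) - K x) / (l_ k - 1) * g x)) @ \oo -->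
  Rint mu (fun x => dot x (grad K x) * g x).
Proof.
move=> ig g0 l2 l1 cl; have [L L0 hL] := K_lip.
have mK : measurable_fun setT K by apply: continuous_measurable_rV; exact: Ck_continuous cK.
have mg := itg_measurable ig.
pose f_ k x : R := (K (l_ k *: x) - K x) / (l_ k - 1) * g x.
pose f x : R := dot x (grad K x) * g x.
have mf_ k : measurable_fun setT (f_ k).
  apply: measurable_funM => //; apply: measurable_funM; last exact: measurable_cst.
  by apply: measurable_funB => //; exact: (measurableT_comp mK (measurable_scale (l_ k))).
have mf : measurable_fun setT f.
  by apply: measurable_funM => //; apply: continuous_measurable_rV; exact: continuous_ray.
have fb k x : `|f_ k x| <= L * g x.
  rewrite /f_ normrM (ger0_norm (g0 x)) ler_wpM2r// normrM normfV ler_pdivrMr ?hL//.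
  by rewrite normr_gt0 subr_eq0.
have cvf x : f_ k x @[k --> \oo] --> f x.
  rewrite /f_ /f; apply: cvgMr_tmp.
  have d1 : is_derive (1 : R) 1 (fun t : R => K (t *: x)) (dot x (grad K x)).
    by have := @is_derive_ray R m K x 1 dK; rewrite scale1r.
  have [dd dv] := d1.
  pose q (h : R) := h^-1 *: (K ((h *: (1 : R) + 1) *: x) - K ((1 : R) *: x)).
  have cq : q @ 0^' --> dot x (grad K x) by rewrite -dv; exact: dd.
  have ch : (fun k => l_ k - 1) @ \oo --> (0 : R)^'.
    have c0 : (fun k => l_ k - 1) @ \oo --> (0 : R).
      by rewrite -(subrr (1 : R)); apply: cvgB => //; exact: cvg_cst.
    move=> A /= hA.
    have h1 : \forall k \near \oo, l_ k - 1 != 0 -> A (l_ k - 1) by exact: (c0 _ hA).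
    by apply: filterS h1 => k; apply; rewrite subr_eq0.
  have := cvg_comp _ _ ch cq; apply: cvg_trans; apply: near_eq_cvg; near=> k.
  by rewrite /q /= [_%:A]mulr1 subrK scale1r mulrC.
have [] := @dominated_convergence _ _ _ mu setT measurableT (fun k => EFin \o f_ k)
  (EFin \o f) (fun x => (L * g x)%:E).
- by move=> k; exact/measurable_EFinP.
- exact/measurable_EFinP.
- by apply: aeW => x _; apply: cvg_EFin; [exact: nearW|exact: cvf].
- exact: itgZ.
- by apply: aeW => x k _; rewrite lee_fin.
move=> iF _ cI.
have itf_ k : itg mu (f_ k) by apply: (itg_dom (mf_ k) (itgZ L ig)).
have cI' : (fun k => \int[mu]_x (EFin \o f_ k) x)%E @ \oo --> (Rint mu f)%:E.
  by rewrite -(RintE iF); exact: cI.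
exact: (fine_cvg cI').
Unshelve. all: by end_near. Qed.

End K.
End coefficient.

(** * A solution and its dilation *)

Section solution_and_dilation.
Context {R : realType}.

Lemma odd_powR_diff_le (p u v : R) : 2 <= p ->
  `| `|u| `^ (p - 2) * u - `|v| `^ (p - 2) * v| <=
    (p - 1) * (`|u| + `|v|) `^ (p - 2) * `|u - v|.
Proof.
rewrite le_eqVlt => /predU1P[<-|p2].
  by rewrite subrr !powRr0 !mul1r mulr1 (_ : 2 - 1 = 1) ?mul1r//; ring.
have p1 : 1 < p - 1 by rewrite ltrBrDr.
have := @spow_diff_le R (p - 1) v u p1.
by rewrite /spow (_ : p - 1 - 1 = p - 2) ?[`|v| + _]addrC//; ring.
Qed.

Lemma powR_addsq (p t : R) : 2 <= p -> 0 <= t -> t `^ (p - 2) * t ^+ 2 = t `^ p.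
Proof.
move=> p2 t0; rewrite -powR_mulrn// powR_split ?subrK// gt_eqF//.
by apply: lt_le_trans p2.
Qed.

Lemma powR_normM2 (p u : R) : 2 <= p -> `|u| `^ (p - 2) * u * u = `|u| `^ p.
Proof. by move=> p2; rewrite -mulrA -expr2 -[u ^+ 2]real_normK ?num_real// powR_addsq. Qed.

(** The left side is a cross term of the square of |u - v| - L |v|. *)
Lemma cross_term_le (p L u v : R) : 2 <= p -> 0 <= L ->
  L * `| `|v| `^ (p - 2) * v| * `|u - v| <=
  (`|u| + `|v|) `^ (p - 2) * (u - v) ^+ 2 + L ^+ 2 * `|v| `^ p.
Proof.
move=> p2 L0; rewrite normrM (ger0_norm (powR_ge0 _ _)) -(powR_addsq p2 (normr_ge0 v)).
rewrite -[(u - v) ^+ 2]real_normK ?num_real//.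
set c := `|v| `^ (p - 2); set C := (_ + _) `^ _; set a := `|v|; set b := `|u - v|.
have c0 : 0 <= c by exact: powR_ge0.
have cC : c <= C.
  by apply: ge0_ler_powR; rewrite ?nnegrE ?subr_ge0 ?addr_ge0// lerDr.
apply: (@le_trans _ _ (c * b ^+ 2 + L ^+ 2 * (c * a ^+ 2))); last first.
  by rewrite lerD2r ler_wpM2r ?sqr_ge0.
rewrite -subr_ge0.
have h : 0 <= L * a * b by apply: mulr_ge0; [apply: mulr_ge0|]; rewrite ?normr_ge0.
have -> : c * b ^+ 2 + L ^+ 2 * (c * a ^+ 2) - L * (c * a) * b =
  c * ((b - L * a) ^+ 2 + L * a * b) by ring.
by rewrite mulr_ge0// addr_ge0 ?sqr_ge0.
Qed.

Lemma le_powRD2 (p a b : R) : 0 <= p -> 0 <= a -> 0 <= b -> (a + b) `^ p <=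
  2 `^ p * (a `^ p + b `^ p).
Proof.
move=> p0; wlog ab : a b / a <= b => [h a0 b0|a0 b0].
  have [ab|/ltW ba] := leP a b; first exact: h.
  by rewrite addrC [a `^ p + _]addrC; exact: h.
apply: (@le_trans _ _ ((2 * b) `^ p)).
  apply: ge0_ler_powR; rewrite ?nnegrE ?addr_ge0 ?mulr_ge0//.
  by rewrite mulr_natl mulr2n lerD2r.
by rewrite powRM// ler_wpM2l ?powR_ge0// lerDr powR_ge0.
Qed.

Section core.
Variable n : nat.
Local Notation N := n.+3.
Variables (alpha s : R).
Hypotheses (a12 : 2^-1 < alpha) (s02 : 0 <= s <= 2).
Local Notation mu := (leb N).
Local Notation p := (@crit_exp R N s).
Local Notation w := (@wt R n alpha s).
Local Notation rho := (rho alpha).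
Local Notation dilate := (dilate alpha).
Local Notation dilate_grad := (dilate_grad alpha).
Local Notation dil_exp := (dil_exp n alpha).
Variables (K u : 'rV[R]_N -> R) (Du : 'rV[R]_N -> 'rV[R]_N) (M Lip : R).
Hypotheses (mK : measurable_fun setT K) (M0 : 0 < M) (KM : forall x, `|K x| <= M).
Hypotheses (Lip0 : 0 < Lip) (KL : forall (l : R) x, 2^-1 <= l -> `|K (l *: x) - K x| <=
  Lip * `|l - 1|).
Hypothesis uE : in_energy alpha u Du.
Hypothesis weak : forall phi, test_function phi ->
  (\int[mu]_x (`|last_coord x| `^ (2 * alpha) * dot (Du x) (grad phi x))%:E =
   \int[mu]_x (K x * w x * `|u x| `^ (p - 2) * u x * phi x)%:E)%E.

Local Notation LL := (weak_form alpha s K u Du).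

Let a0 : 0 < alpha. Proof. by apply: lt_trans a12; rewrite invr_gt0. Qed.
Let p2 : 2 <= p. Proof. exact: crit_ge2. Qed.
Let p0 : 0 < p. Proof. by apply: lt_le_trans p2. Qed.
Let mu_ : measurable_fun setT u. Proof. by case: uE. Qed.
Let mDu : measurable_fun setT Du. Proof. by case: uE. Qed.
Let mw : measurable_fun setT w. Proof. exact: measurable_wt. Qed.
Let w0 x : 0 <= w x. Proof. exact: wt_ge0. Qed.

Lemma dil_exp_p : dil_exp * p = N%:R + (alpha * p - s).
Proof.
have : p = 2 * (N%:R - s) / n.+1%:R by rewrite /crit_exp N2E.
move=> ->; rewrite /dil_exp; field; by rewrite nat1r pnatr_eq0.
Qed.

Lemma dil_exp_p2 : dil_exp * (p - 2) = alpha * p - s - (2 * alpha - 2).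
Proof. by rewrite mulrBr dil_exp_p /dil_exp -N2E; field. Qed.

Lemma w_scale l x : 0 < l -> w (l *: x) = l `^ (alpha * p - s) * w x.
Proof. by move=> l0; rewrite /wt last_powR_scale. Qed.

Lemma powR_invl (l r : R) : 0 < l -> l^-1 `^ r = (l `^ r)^-1.
Proof. by move=> l0; rewrite -powR_inv1 ?(ltW l0)// -powRrM mulN1r powRN. Qed.

Lemma dil_exp_scale l : 0 < l -> l ^+ N * l `^ (alpha * p - s) =
  (l `^ dil_exp) `^ (p - 2) * (l `^ dil_exp) ^+ 2.
Proof.
move=> l0; rewrite (powR_addsq p2 (powR_ge0 _ _)) -powRrM dil_exp_p.
by rewrite [RHS]powRD ?(gt_eqF l0) ?implybT// powR_mulrn ?(ltW l0).
Qed.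

Lemma dilate_powp l (z : 'rV[R]_N -> R) x : 0 < l ->
  w x * `|dilate l z x| `^ p = l ^+ N * (w (l *: x) * `|z (l *: x)| `^ p).
Proof.
move=> l0; rewrite /dilate w_scale// normrM (ger0_norm (powR_ge0 _ _)) powRM ?powR_ge0//.
by rewrite mulrA [RHS]mulrA [l ^+ N * _]mulrA dil_exp_scale// powR_addsq ?powR_ge0//
  [w x * _]mulrC.
Qed.

Lemma dilate_inv l (z : 'rV[R]_N -> R) x : 0 < l -> dilate l^-1 z (l *: x) =
  (l `^ dil_exp)^-1 * z x.
Proof.
by move=> l0; rewrite /dilate scalerA mulVf ?gt_eqF// scale1r powR_invl.
Qed.

Lemma dilate_grad_inv l (G : 'rV[R]_N -> 'rV[R]_N) x : 0 < l ->
  dilate_grad l (dilate_grad l^-1 G) x = G x.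
Proof.
move=> l0; have c0 : 0 < l `^ dil_exp by exact: powR_gt0.
rewrite /dilate_grad !scalerA mulVf ?(gt_eqF l0)// scale1r powR_invl//.
rewrite (_ : _ * _ = 1) ?scale1r//; field; by rewrite !gt_eqF.
Qed.

(** Together with the next lemma: the equation of u at the point l x, tested
    with u and with dilate l^-1 u, is the equation of dilate l u at x, tested
    with itself and with u. *)
Lemma weak_form_scale_self l x : 0 < l -> l ^+ N * LL u Du (l *: x) =
  `|last_coord x| `^ (2 * alpha) * dot (dilate_grad l Du x) (dilate_grad l Du x) -
    K (l *: x) * (w x * `|dilate l u x| `^ p).
Proof.
move=> l0; rewrite dot_dilate_grad// dilate_powp// -(powR_normM2 _ p2) /weak_form; ring.
Qed.

Lemma weak_form_scale_inv l x : 0 < l -> l ^+ N * LL (dilate l^-1 u) (dilate_grad l^-1 Du)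
  (l *: x) =
  `|last_coord x| `^ (2 * alpha) * dot (dilate_grad l Du x) (Du x) -
  K (l *: x) * w x * `|dilate l u x| `^ (p - 2) * dilate l u x * u x.
Proof.
move=> l0; have c0 : 0 < l `^ dil_exp by exact: powR_gt0.
have h := dot_dilate_grad alpha Du (dilate_grad l^-1 Du) x l0;
  rewrite dilate_grad_inv// in h.
rewrite h /weak_form dilate_inv// {2}/dilate normrM (ger0_norm (powR_ge0 _ _)) powRM
  ?powR_ge0//.
rewrite w_scale// mulrBr; congr (_ - _).
move: (dil_exp_scale l0); set c := l `^ dil_exp in c0 *; set A := l `^ (_ - s) => hA.
transitivity (K (l *: x) * (l ^+ N * A) * w x * `|u (l *: x)| `^ (p - 2) * u (l *: x) *
  (c^-1 * u x)); first by ring.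
rewrite hA; field; by rewrite gt_eqF.
Qed.

(** The pairing of u - dilate l u with the difference of the right-hand sides of
    the equations of u and of its dilation. *)
Definition source_gap l x : R := (K x * (`|u x| `^ (p - 2) * u x) -
   K (l *: x) * (`|dilate l u x| `^ (p - 2) * dilate l u x)) * w x * (u x - dilate l u x).

(** The quadratic quantity that controls both source_gap and the second-order
    Taylor remainder of |t|^p. *)
Definition gap l x : R := w x * (`|u x| + `|dilate l u x|) `^ (p - 2) *
  (u x - dilate l u x) ^+ 2.

Definition diff_dens l := dens alpha (fun x => Du x - dilate_grad l Du x).

Lemma itg_wpow_u : itg mu (fun x => w x * `|u x| `^ p).
Proof. exact: (itg_wpow a12 s02 uE). Qed.

Let W0 := Rint mu (fun x => w x * `|u x| `^ p).

Lemma itg_wpow_dilate l : 0 < l -> itg mu (fun x => w x * `|dilate l u x| `^ p) /\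
   Rint mu (fun x => w x * `|dilate l u x| `^ p) = W0.
Proof.
move=> l0; have [h1 h2] := itg_subst l0 itg_wpow_u.
have e x : l ^+ N * (w (l *: x) * `|u (l *: x)| `^ p) =
  w x * `|dilate l u x| `^ p by rewrite dilate_powp.
by split; [exact: eq_itg e h1|rewrite -(eq_Rint _ e)].
Qed.

(** Test the equations of u and of dilate l u with their difference. *)
Lemma energy_identity l : 0 < l -> [/\ itg mu (diff_dens l), itg mu (source_gap l) &
  Rint mu (diff_dens l) = Rint mu (source_gap l)].
Proof.
move=> l0; have li0 : 0 < l^-1 by rewrite invr_gt0.
have hv := in_energy_dilate l0 uE; have hvi := in_energy_dilate li0 uE.
have hd := in_energy_sub uE hv.
have id : itg mu (diff_dens l) := itg_dens a12 hd.
have i1 := itg_weak_form a12 s02 mK KM uE uE.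
have [i2 e2] := itg_subst l0 i1.
have i3 := itg_weak_form a12 s02 mK KM uE hv.
have [i4 e4] := itg_subst l0 (itg_weak_form a12 s02 mK KM uE hvi).
have E x : source_gap l x = diff_dens l x - ((LL u Du x + l ^+ N * LL u Du (l *: x)) -
    (LL (dilate l u) (dilate_grad l Du) x + l ^+ N * LL (dilate l^-1 u)
      (dilate_grad l^-1 Du) (l *: x))).
  rewrite weak_form_scale_self// weak_form_scale_inv//
    -(powR_normM2 _ p2) /weak_form /diff_dens /dens dotDl !dotDr !dotNr !dotNl.
  by rewrite [dot (dilate_grad l Du x) (Du x)]dotC /source_gap; ring.
have iL := itgB (itgD i1 i2) (itgD i3 i4).
have iX : itg mu (source_gap l) by exact: (eq_itg (fun x => esym (E x)) (itgB id iL)).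
split => //; rewrite (eq_Rint _ E) (RintB id iL) (RintB (itgD i1 i2) (itgD i3 i4))
  (RintD i1 i2) (RintD i3 i4).
rewrite e2 e4 !(Rint_weak_form a12 s02 mK M0 KM uE weak)//; ring.
Qed.

Lemma gap_ge0 l x : 0 <= gap l x.
Proof. by rewrite mulr_ge0 ?sqr_ge0// mulr_ge0 ?powR_ge0. Qed.

Lemma measurable_dilate_u l : measurable_fun setT (dilate l u).
Proof. exact: measurable_dilate. Qed.

Lemma measurable_absum l : measurable_fun setT (fun x => `|u x| + `|dilate l u x|).
Proof.
apply: measurable_funD; apply: measurableT_comp; try exact: normr_measurable.
  exact: mu_.
exact: measurable_dilate_u.
Qed.

Lemma measurable_gap l : measurable_fun setT (gap l).
Proof.
apply: measurable_funM.
  by apply: measurable_funM => //; apply: measurable_fun_powR; exact: measurable_absum.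
by apply: measurable_funX; apply: measurable_funB => //; exact: measurable_dilate_u.
Qed.

Lemma sq_diff_le (a b : R) : (a - b) ^+ 2 <= (`|a| + `|b|) ^+ 2.
Proof. by rewrite -[leLHS]real_normK ?num_real// ler_pXn2r ?nnegrE ?addr_ge0// ler_normB.
  Qed.

Lemma gap_le_sum l x : gap l x <= w x * (`|u x| + `|dilate l u x|) `^ p.
Proof.
rewrite /gap -mulrA ler_wpM2l// -(powR_addsq p2) ?addr_ge0//.
by rewrite ler_wpM2l ?powR_ge0// sq_diff_le.
Qed.

Lemma itg_gap l : 0 < l -> itg mu (gap l).
Proof.
move=> l0; have [iv _] := itg_wpow_dilate l0.
apply: (itg_dom (measurable_gap l) (itgZ (2 `^ p) (itgD itg_wpow_u iv))) => x.
rewrite ger0_norm ?gap_ge0//; apply: le_trans (gap_le_sum _ _) _.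
by rewrite -mulrDr mulrCA ler_wpM2l// le_powRD2// ltW.
Qed.

Let C1 := M * (p - 1) + 1.

(** Split K(x) f(u) - K(l x) f(v) into K(x) (f(u) - f(v)) and (K(x) - K(l x))
    f(v), for f(t) = |t|^(p - 2) t and v = dilate l u. *)
Lemma source_gap_le l x : 1 < l -> `|source_gap l x| <= C1 * gap l x +
  (Lip * (l - 1)) ^+ 2 * (w x * `|dilate l u x| `^ p).
Proof.
move=> l1; have l2 : 2^-1 <= l by apply: le_trans (ltW l1); rewrite invf_le1// ler1n.
rewrite /source_gap /gap; set v := dilate l u x; set fu := _ * u x; set fv := _ * v.
have h1 : `|fu - fv| <= (p - 1) * (`|u x| + `|v|) `^ (p - 2) * `|u x -
  v| by exact: odd_powR_diff_le.
have lip0 : 0 <= Lip * (l - 1) by rewrite mulr_ge0 ?subr_ge0 ?(ltW l1) ?(ltW Lip0).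
have h2 : Lip * (l - 1) * `|fv| * `|u x - v| <=
  (`|u x| + `|v|) `^ (p - 2) * (u x - v) ^+ 2 +
    (Lip * (l - 1)) ^+ 2 * `|v| `^ p by exact: cross_term_le.
have h3 : `|K x - K (l *: x)| <= Lip * (l - 1).
  by rewrite distrC; have := KL x l2; rewrite [X in _ * X]ger0_norm// subr_ge0 ltW.
have -> : (K x * fu - K (l *: x) * fv) * w x * (u x - v) =
  w x * (K x * (fu - fv) * (u x - v) + (K x - K (l *: x)) * fv * (u x - v)) by ring.
rewrite normrM (ger0_norm (w0 x)).
set S := (_ + _) `^ _ in h1 h2 *; set V := `|v| `^ p in h2 *.
have S0 : 0 <= S by exact: powR_ge0.
have -> : C1 * (w x * S * (u x - v) ^+ 2) + (Lip * (l - 1)) ^+ 2 * (w x * V) =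
  w x * (M * (p - 1) * S * (u x - v) ^+ 2 + (S * (u x - v) ^+ 2 +
    (Lip * (l - 1)) ^+ 2 * V)).
  by rewrite /C1; ring.
apply: ler_wpM2l => //; apply: le_trans (ler_normD _ _) _; apply: lerD.
  rewrite !normrM -[(u x - v) ^+ 2]real_normK ?num_real// expr2 mulrA ler_wpM2r//.
  rewrite -!mulrA; apply: ler_pM => //; rewrite ?mulr_ge0//; apply: le_trans h1 _;
    by rewrite mulrA.
apply: le_trans h2; rewrite !normrM ler_wpM2r// ler_wpM2r//.
Qed.

Lemma diff_dens_le l : 1 < l -> Rint mu (diff_dens l) <= C1 * Rint mu (gap l) +
  (Lip * (l - 1)) ^+ 2 * W0.
Proof.
move=> l1; have l0 : 0 < l by apply: lt_trans l1.
have [id iX ->] := energy_identity l0.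
have [iv <-] := itg_wpow_dilate l0; have iQ := itg_gap l0.
have i1 := itgZ C1 iQ; have i2 := itgZ ((Lip * (l - 1)) ^+ 2) iv.
rewrite -RintZ// -[X in _ + X]RintZ// -RintD//; apply: le_Rint => //; first exact: itgD.
by move=> x; apply: le_trans (ler_norm _) (source_gap_le x l1).
Qed.

(** * Concentration of the potential *)

(** Off this set, the potential w (2 |u|)^(p - 2) is dominated by the weight T
    rho of the dilation estimate; tail is the density of the mass of u on it. *)
Definition conc T : set 'rV[R]_N := [set x | T * rho x < w x * (2 * `|u x|) `^ (p - 2)].
Definition tail T x : R := \1_(conc T) x * (w x * `|u x| `^ p).
Definition conc_pair T l : set 'rV[R]_N := [set x | T * rho x < w x *
  (`|u x| + `|dilate l u x|) `^ (p - 2)].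
Definition tail_pair T l x : R := \1_(conc_pair T l) x *
  (w x * (`|u x| + `|dilate l u x|) `^ p).

Lemma measurable_lt_set (f g : 'rV[R]_N -> R) : measurable_fun setT f ->
  measurable_fun setT g ->
  measurable [set x | f x < g x].
Proof.
move=> mf mg; rewrite (_ : [set x | _] = setT `&` (fun x => g x - f x) @^-1`
  `]0%R, +oo[%classic).
  exact: (measurable_funB mg mf) measurableT _ (measurable_itv _).
by rewrite setTI; apply/seteqP; split => x /=; rewrite in_itv/= andbT subr_gt0.
Qed.

Lemma measurable_conc T : measurable (conc T).
Proof.
apply: measurable_lt_set.
  by apply: measurable_funM; [exact: measurable_cst|exact: measurable_rho].
apply: measurable_funM => //; apply: measurable_fun_powR; apply: measurable_funM.
  exact: measurable_cst.
by apply: measurableT_comp => //; exact: normr_measurable.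
Qed.

Lemma measurable_conc_pair T l : measurable (conc_pair T l).
Proof.
apply: measurable_lt_set.
  by apply: measurable_funM; [exact: measurable_cst|exact: measurable_rho].
by apply: measurable_funM => //; apply: measurable_fun_powR; exact: measurable_absum.
Qed.

Lemma indic01 (A : set 'rV[R]_N) x : 0 <= (\1_A x : R) <= 1.
Proof. by rewrite indicE; case: (x \in A); rewrite /= ?lexx ?ler01. Qed.

Lemma itg_indicM (A : set 'rV[R]_N) f : measurable A -> (forall x, 0 <= f x) -> itg mu f ->
  itg mu (fun x => \1_A x * f x).
Proof.
move=> mA f0 i; apply: (itg_dom _ i).
  by apply: measurable_funM; [exact: measurable_indic|exact: itg_measurable i].
move=> x; have /andP[h0 h1] := indic01 A x.
by rewrite ger0_norm ?mulr_ge0// ler_piMl.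
Qed.

Lemma wpow_ge0 x : 0 <= w x * `|u x| `^ p.
Proof. by rewrite mulr_ge0 ?powR_ge0. Qed.

Lemma tail_ge0 T x : 0 <= tail T x.
Proof. by rewrite mulr_ge0 ?wpow_ge0//; case/andP: (indic01 (conc T) x). Qed.

Lemma itg_tail T : itg mu (tail T).
Proof. by apply: itg_indicM; [exact: measurable_conc|exact: wpow_ge0|exact: itg_wpow_u].
  Qed.

(** Dominated convergence: rho is positive off the hyperplane x_N = 0, so that
    almost every point leaves conc T as T grows. *)
Lemma tail_small e : 0 < e -> exists2 T, 0 < T & Rint mu (tail T) <= e.
Proof.
move=> e0.
have cvf x : last_coord x != 0 -> (tail k.+1%:R x @[k --> \oo] --> (0 : R)).
  move=> x0; have r0 : 0 < rho x.
    have dx : 0 < dot x x.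
      by apply: lt_le_trans (le_coord_dot x ord_max); rewrite lt_def sqrf_eq0 sqr_ge0 andbT.
    by rewrite divr_gt0// powR_gt0// normr_gt0.
  apply: cvg_near_cst; near=> k.
  rewrite /tail indicE memNset ?mul0r// /conc /=; apply/negP; rewrite -leNgt.
  rewrite -ler_pdivrMr//; apply: (@le_trans _ _ k%:R); last by rewrite ler_nat.
  by near: k; exact: nbhs_infty_ger.
have ae_cvg : {ae mu, forall x, setT x -> (EFin \o tail k.+1%:R) x @[k --> \oo] --> 0%E}.
  exists [set x : 'rV[R]_N | x ord0 ord_max = 0]; split;
    [exact: measurable_hyperplane|exact: hyperplane_null|].
  move=> x /= h; apply: contrapT => x0; apply: h => _.
  apply: cvg_EFin; first exact: nearW.
  apply: cvf; apply/eqP => h; apply: x0; by rewrite -h last_coordE.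
have [] := @dominated_convergence _ _ _ mu setT measurableT
  (fun k => EFin \o tail k.+1%:R) (cst 0%E) (fun x => (w x * `|u x| `^ p)%:E).
- by move=> k; exact: (measurable_int _ (itg_tail _)).
- exact: measurable_cst.
- exact: ae_cvg.
- exact: itg_wpow_u.
- apply: aeW => x k _; rewrite lee_fin ger0_norm ?tail_ge0// ler_piMl ?wpow_ge0//.
move=> _ _; rewrite integral0 => cI.
have /fine_cvg cI' : (fun k => \int[mu]_x (EFin \o tail k.+1%:R) x)%E @ \oo -->
  (0%R)%:E by exact: cI.
have /cvgrPdist_le/(_ e e0)[k _ /(_ k (leqnn _)) hk] := cI'.
exists k.+1%:R; first by rewrite ltr0n.
apply: le_trans (ler_norm _) _; move: hk; by rewrite /= sub0r normrN.
Unshelve. all: by end_near. Qed.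

Lemma tail_pair_ge0 T l x : 0 <= tail_pair T l x.
Proof.
by rewrite mulr_ge0// mulr_ge0 ?powR_ge0.
Qed.

(** Let x be in conc_pair T l. If |dilate l u x| <= |u x|, then x is in conc T.
    Otherwise l x is: both sides of the inequality that defines conc scale with
    the same power of l, because of dil_exp_p2. *)
Lemma tail_pair_le T l x : 0 < l ->
  tail_pair T l x <= 2 `^ p * (tail T x + l ^+ N * tail T (l *: x)).
Proof.
move=> l0; have lN : 0 <= l ^+ N by rewrite exprn_ge0// ltW.
rewrite /tail_pair indicE; have [|_] := boolP (x \in _); last first.
  by rewrite mul0r; apply: mulr_ge0; rewrite ?powR_ge0// addr_ge0 ?tail_ge0//;
    apply: mulr_ge0; rewrite ?tail_ge0.
move=> /set_mem; rewrite mul1r /conc_pair /= => xA; have [vu|uv] :=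
  leP `|dilate l u x| `|u x|.
  have le2 : `|u x| + `|dilate l u x| <= 2 * `|u x| by rewrite mulr_natl mulr2n lerD2l.
  have xS : conc T x.
    apply: (lt_le_trans xA); apply: ler_wpM2l => //.
    by apply: ge0_ler_powR; rewrite ?nnegrE ?subr_ge0 ?addr_ge0.
  apply: (@le_trans _ _ (2 `^ p * tail T x)); last first.
    by rewrite ler_wpM2l ?powR_ge0// lerDl mulr_ge0 ?tail_ge0.
  rewrite /tail indicE mem_set// mul1r mulrCA -powRM//; apply: ler_wpM2l => //.
  by apply: ge0_ler_powR; rewrite ?nnegrE ?addr_ge0 ?(ltW p0).
have le2 : `|u x| + `|dilate l u x| <= 2 * `|dilate l u x| by rewrite mulr_natl mulr2n
  lerD2r ltW.
have xS : conc T (l *: x).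
  have xA' : T * rho x < w x * (2 * `|dilate l u x|) `^ (p - 2).
    apply: (lt_le_trans xA); apply: ler_wpM2l => //.
    by apply: ge0_ler_powR; rewrite ?nnegrE ?subr_ge0 ?addr_ge0.
  rewrite /conc /= rho_scale// w_scale//.
  have c0 : 0 < l `^ (2 * alpha - 2) by exact: powR_gt0.
  have e : l `^ (alpha * p - s) = l `^ (2 * alpha - 2) * (l `^ dil_exp) `^ (p - 2).
    rewrite -powRrM dil_exp_p2 -powRD ?(gt_eqF l0) ?implybT//; congr (_ `^ _); ring.
  rewrite e mulrCA -!mulrA ltr_pM2l//; apply: (lt_le_trans xA').
  apply: le_of_eq.
  rewrite /dilate normrM (ger0_norm (powR_ge0 _ _)) !powRM ?mulr_ge0 ?powR_ge0//; ring.
apply: (@le_trans _ _ (2 `^ p * (l ^+ N * tail T (l *: x)))); last first.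
  by rewrite ler_wpM2l ?powR_ge0// lerDr tail_ge0.
rewrite /tail indicE mem_set// mul1r -dilate_powp// mulrCA -powRM//; apply: ler_wpM2l => //.
by apply: ge0_ler_powR; rewrite ?nnegrE ?addr_ge0 ?(ltW p0).
Qed.

Lemma measurable_tail_pair T l : measurable_fun setT (tail_pair T l).
Proof.
apply: measurable_funM; first exact: measurable_indic (measurable_conc_pair T l).
by apply: measurable_funM => //; apply: measurable_fun_powR; exact: measurable_absum.
Qed.

Lemma itg_tail_pair T l : 0 < l -> itg mu (tail_pair T l) /\ Rint mu (tail_pair T l) <=
  2 `^ p * (2 * Rint mu (tail T)).
Proof.
move=> l0; have [i2 e2] := itg_subst l0 (itg_tail T).
have i := itgZ (2 `^ p) (itgD (itg_tail T) i2).
have it : itg mu (tail_pair T l).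
  apply: (itg_dom (measurable_tail_pair T l) i) => x.
  by rewrite ger0_norm ?tail_pair_ge0//; exact: tail_pair_le.
split => //; apply: le_trans (le_Rint it i (fun x => tail_pair_le T x l0)) _.
by rewrite (RintZ _ (itgD (itg_tail T) i2)) (RintD (itg_tail T) i2) e2 mulr_natl mulr2n.
Qed.

Lemma dilate_dist_u : exists2 C : R, 0 < C & forall l, 1 < l ->
  itg mu (fun x => rho x * (dilate l u x - u x) ^+ 2) /\
  Rint mu (fun x => rho x * (dilate l u x - u x) ^+ 2) <= C * (l - 1) ^+ 2.
Proof.
have [C C0 hC] := dilate_dist n a12; have id := itg_dens a12 uE.
pose D := Rint mu (dens alpha Du) + 1.
have D0 : 0 < D by rewrite ltr_wpDl// Rint_ge0// => x; exact: dens_ge0.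
exists (C * D); first exact: mulr_gt0.
move=> l l1.
have hD : (\int[mu]_x (dens alpha Du x)%:E <= D%:E)%E by rewrite RintE// lee_fin /D lerDl.
have h := hC u Du D l uE l1 D0 hD.
have i : itg mu (fun x => rho x * (dilate l u x - u x) ^+ 2).
  apply: (itg_le_real _ _ h) => [|x]; last by rewrite mulr_ge0 ?sqr_ge0 ?rho_ge0.
  apply: measurable_funM; first exact: measurable_rho.
  by apply: measurable_funX; apply: measurable_funB => //; exact: measurable_dilate_u.
split => //; apply: (Rint_le i); rewrite (_ : C * D * _ = C * (l - 1) ^+ 2 * D)//; ring.
Qed.

Definition gap_conc T l x := \1_(conc_pair T l) x * gap l x.

Lemma itg_gap_conc T l : 0 < l -> itg mu (gap_conc T l).
Proof.
move=> l0; apply: itg_indicM; [exact: measurable_conc_pair|exact: gap_ge0|exact: itg_gap].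
Qed.

Lemma gap_split T l x : 0 < T -> gap l x <= T * (rho x * (dilate l u x - u x) ^+ 2) +
  gap_conc T l x.
Proof.
move=> T0; rewrite /gap_conc indicE; have [_|] := boolP (x \in _).
  by rewrite mul1r lerDr mulr_ge0 ?(ltW T0)// mulr_ge0 ?sqr_ge0 ?rho_ge0.
move=> xA; rewrite mul0r addr0 mulrA /gap -sqrrN opprB ler_wpM2r ?sqr_ge0//.
by rewrite leNgt; apply: contra xA => h; exact: mem_set.
Qed.

Lemma Rint_gap_split : exists2 C : R, 0 < C & forall T l, 0 < T -> 1 < l ->
  Rint mu (gap l) <= T * C * (l - 1) ^+ 2 + Rint mu (gap_conc T l).
Proof.
have [C C0 hC] := dilate_dist_u; exists C => // T l T0 l1.
have l0 : 0 < l by apply: lt_trans l1.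
have [i h] := hC l l1; have iT := itgZ T i; have ic := itg_gap_conc T l0.
apply: le_trans (le_Rint (itg_gap l0) (itgD iT ic) (fun x => gap_split l x T0)) _.
by rewrite (RintD iT ic) (RintZ _ i) lerD2r -mulrA ler_wpM2l// ltW.
Qed.

Lemma gap_conc_le_tail_pair T l x : gap_conc T l x <= tail_pair T l x.
Proof. by rewrite /gap_conc /tail_pair; apply: ler_wpM2l => //; exact: gap_le_sum. Qed.

Lemma Rint_gap_conc_le T l : 0 < l -> Rint mu (gap_conc T l) <=
  2 `^ p * (2 * Rint mu (tail T)).
Proof.
move=> l0; have [it h] := itg_tail_pair T l0; apply: le_trans h.
by apply: le_Rint => //; [exact: itg_gap_conc|move=> x; exact: gap_conc_le_tail_pair].
Qed.

(** First T is chosen large to make the concentrated part small for all l, then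
    l close to 1. *)
Lemma gap_small e : 0 < e -> exists2 d : R, 0 < d & forall l, 1 < l <= 1 + d ->
  Rint mu (gap l) <= e.
Proof.
move=> e0; have [C C0 hC] := Rint_gap_split.
have c0 : 0 < 2 `^ p * 2 :> R by rewrite mulr_gt0// powR_gt0.
have [T T0 hT] := @tail_small (e / 2 / (2 `^ p * 2)) ltac:(by rewrite !divr_gt0).
exists (Num.min 1 (e / 2 / (T * C))).
  by rewrite lt_min ltr01/= !divr_gt0// mulr_gt0.
move=> l /andP[l1]; rewrite -lerBlDl le_min => /andP[h1 h2].
have l0 : 0 < l by apply: lt_trans l1.
have t0 : 0 < l - 1 by rewrite subr_gt0.
apply: le_trans (hC T l T0 l1) _; rewrite [leRHS]splitr; apply: lerD.
  rewrite mulrC -ler_pdivlMr ?mulr_gt0//; apply: le_trans h2.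
  by rewrite expr2 ler_piMl// ltW.
by apply: le_trans (Rint_gap_conc_le _ l0) _; rewrite mulrA mulrC -ler_pdivlMr.
Qed.

Lemma gap_conc_powR T l x : 2 < p ->
  gap_conc T l x = tail_pair T l x `^ ((p - 2) / p) * (w x * `|u x - dilate l u x| `^ p)
    `^ (1 - (p - 2) / p).
Proof.
move=> pgt2; rewrite /gap_conc /tail_pair indicE.
have th0 : (p - 2) / p != 0 by rewrite mulf_neq0 ?invr_eq0 ?gt_eqF ?subr_gt0.
case: (x \in _); rewrite ?mul1r ?mul0r; last by rewrite powR0// mul0r.
have e1 : p * ((p - 2) / p) = p - 2 by field; rewrite gt_eqF.
have e2 : p * (1 - (p - 2) / p) = 2 by field; rewrite gt_eqF.
rewrite /gap; move: (w x) (w0 x) => W Wge0.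
rewrite !powRM ?powR_ge0// -!powRrM e1 e2 [RHS]mulrACA powR_split ?subrKC ?oner_eq0//.
by rewrite powRr1// powR_mulrn// real_normK ?num_real// mulrA.
Qed.

(** Hoelder's inequality between the tail and the Hardy-Sobolev bound of u -
    dilate l u; since p > 2 a positive power of the small mass of the tail is
    left. *)
Lemma Rint_gap_conc_powR : 2 < p -> exists2 C : R, 0 < C & forall T l A D, 1 < l ->
  0 < A -> 0 < D ->
  2 `^ p * (2 * Rint mu (tail T)) <= A -> Rint mu (diff_dens l) <= D ->
  Rint mu (gap_conc T l) <= A `^ ((p - 2) / p) * (C * D).
Proof.
move=> pgt2; have [C C0 hC] := hardy_sobolev n a12 s02.
set th := (p - 2) / p.
have th01 : 0 <= th <= 1.
  by rewrite /th divr_ge0 ?subr_ge0 ?(ltW p0)//= ler_pdivrMr// mul1r lerBlDr lerDl.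
have e2 : p / 2 * (1 - th) = 1 by rewrite /th; field; rewrite gt_eqF.
exists (C `^ (1 - th)); first exact: powR_gt0.
move=> T l A D l1 A0 D0 hA hD; have l0 : 0 < l by apply: lt_trans l1.
have hd := in_energy_sub uE (in_energy_dilate l0 uE).
have id := itg_dens a12 hd.
have [it ht] := itg_tail_pair T l0.
have h1 : (\int[mu]_x (tail_pair T l x)%:E <= A%:E)%E by rewrite RintE// lee_fin
  (le_trans ht).
have h2 : (\int[mu]_x (w x * `|u x - dilate l u x| `^ p)%:E <= (C * D `^ (p / 2))%:E)%E.
  by apply: (hC _ _ _ hd D0); rewrite RintE// lee_fin.
have B0 : 0 < C * D `^ (p / 2) by rewrite mulr_gt0// powR_gt0.
have mW : measurable_fun setT (fun x => w x * `|u x - dilate l u x| `^ p).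
  by apply: measurable_wpow; apply: measurable_funB => //; exact: measurable_dilate_u.
have W0' x : 0 <= w x * `|u x - dilate l u x| `^ p by rewrite mulr_ge0 ?powR_ge0.
apply: (Rint_le (itg_gap_conc T l0)).
under eq_integral do rewrite gap_conc_powR//.
apply: le_trans (le_integral_powRM (measurable_tail_pair T l) mW (tail_pair_ge0 T l) W0'
  th01 A0 B0 h1 h2) _.
by rewrite lee_fin powRM ?powR_ge0 ?(ltW C0)// -powRrM e2 powRr1// ltW.
Qed.

(** Choosing T large makes the concentrated part of the integral of gap at most
    kappa (d + (l - 1)^2), where d is the energy of u - dilate l u. As C1 kappa
    = 1/2, it is absorbed on the left of diff_dens_le. *)
Lemma quadratic_bounds : 2 < p -> exists2 C : R, 0 < C & forall l, 1 < l ->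
  Rint mu (diff_dens l) <= C * (l - 1) ^+ 2 /\ Rint mu (gap l) <= C * (l - 1) ^+ 2.
Proof.
move=> pgt2; have [CQ CQ0 hQ] := Rint_gap_conc_powR pgt2; have [Cg Cg0 hg] :=
  Rint_gap_split.
have C10 : 0 < C1 by rewrite /C1 ltr_wpDl// mulr_ge0 ?(ltW M0)// subr_ge0
  (le_trans _ p2)// ler1n.
have th0 : 0 < (p - 2) / p by rewrite divr_gt0 ?subr_gt0.
pose kappa := (2 * C1)^-1.
have k0 : 0 < kappa by rewrite invr_gt0 mulr_gt0.
(* A is the mass of the tail for which the constant of Rint_gap_conc_powR is
   kappa. *)
pose A := (kappa / CQ) `^ ((p - 2) / p)^-1.
have A0 : 0 < A by rewrite powR_gt0// divr_gt0.
have Ath : A `^ ((p - 2) / p) * CQ = kappa.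
  rewrite /A -powRrM mulVf ?gt_eqF// powRr1 ?divr_ge0 ?(ltW k0) ?(ltW CQ0)//.
  by rewrite divfK// gt_eqF.
have c0 : 0 < 2 `^ p * 2 :> R by rewrite mulr_gt0// powR_gt0.
have [T T0 hT] := @tail_small (A / (2 `^ p * 2)) ltac:(by rewrite !divr_gt0).
have W00 : 0 <= W0 by apply: Rint_ge0 => x; exact: wpow_ge0.
pose Cd := 2 * (C1 * (T * Cg) + 2^-1 + Lip ^+ 2 * W0).
have Cd0 : 0 < Cd.
  have h1 : 0 < C1 * (T * Cg) by rewrite !mulr_gt0.
  have h2 : 0 <= Lip ^+ 2 * W0 by apply: mulr_ge0 => //; exact: sqr_ge0.
  by rewrite /Cd mulr_gt0// ltr_wpDr// addr_gt0// invr_gt0.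
have TC0 : 0 < T * Cg by exact: mulr_gt0.
exists (Cd + (T * Cg + kappa * (Cd + 1))).
  by rewrite addr_gt0// addr_gt0// mulr_gt0// addr_gt0.
move=> l l1; set t := (l - 1) ^+ 2; set d := Rint mu (diff_dens l); set q :=
  Rint mu (gap l).
have t0 : 0 < t by rewrite exprn_gt0// subr_gt0.
have d0 : 0 <= d by apply: Rint_ge0 => x; exact: dens_ge0.
have hd : d <= C1 * q + Lip ^+ 2 * W0 * t.
  by have := diff_dens_le l1; rewrite exprMn -/t -/d -/q mulrAC.
have hq : q <= T * Cg * t + kappa * (d + t).
  apply: le_trans (hg T l T0 l1) _; rewrite -/t lerD2l -Ath -mulrA.
  apply: hQ => //; [exact: ltr_wpDl| |by rewrite lerDl ltW].
  by rewrite mulrA mulrC -ler_pdivlMr.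
have hC : C1 * kappa = 2^-1 by rewrite /kappa; field; rewrite gt_eqF.
have hdt : d <= Cd * t.
  have h1 : C1 * q <= C1 * (T * Cg * t + kappa * (d + t)) by rewrite ler_wpM2l// ltW.
  have h2 : C1 * (T * Cg * t + kappa * (d + t)) = C1 * (T * Cg) * t + 2^-1 * (d + t).
    by rewrite -hC; ring.
  rewrite /Cd; lra.
have hqt : q <= (T * Cg + kappa * (Cd + 1)) * t.
  apply: le_trans hq _; rewrite [leRHS]mulrDl lerD2l -mulrA ler_wpM2l ?(ltW k0)//.
  by rewrite mulrDl mul1r lerD2r.
split.
  by apply: le_trans hdt _; rewrite mulrDl lerDl mulr_ge0 ?(ltW t0)// addr_ge0
    ?(ltW TC0)// mulr_ge0 ?(ltW k0)// addr_ge0 ?(ltW Cd0).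
by apply: le_trans hqt _; rewrite [leRHS]mulrDl lerDr mulr_ge0 ?(ltW Cd0) ?(ltW t0).
Qed.

(** * Difference quotients in the scale *)

Lemma itg_bddM (k g : 'rV[R]_N -> R) B : measurable_fun setT k -> (forall x, `|k x| <= B) ->
  (forall x, 0 <= g x) -> itg mu g -> itg mu (fun x => k x * g x).
Proof.
move=> mk kB g0 ig; apply: (itg_dom _ (itgZ B ig)).
  by apply: measurable_funM => //; exact: itg_measurable ig.
by move=> x; rewrite normrM (ger0_norm (g0 x)) ler_wpM2r.
Qed.

Lemma measurable_K_scale l : measurable_fun setT (fun x : 'rV[R]_N => K (l *: x)).
Proof. exact: (measurableT_comp mK (measurable_scale l)). Qed.

Lemma itg_Kscale l : itg mu (fun x : 'rV[R]_N => K (l *: x) * (w x * `|u x| `^ p)).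
Proof.
apply: (@itg_bddM (fun x : 'rV[R]_N => K (l *: x)) _ M) => //;
  first exact: measurable_K_scale.
  by move=> x; exact: wpow_ge0.
exact: itg_wpow_u.
Qed.

Lemma Rint_K_dilate (c l : R) : 0 < l ->
  itg mu (fun x => K (c *: x) * (w x * `|dilate l u x| `^ p)) /\
  Rint mu (fun x => K (c *: x) * (w x * `|dilate l u x| `^ p)) =
  Rint mu (fun x => K ((c / l) *: x) * (w x * `|u x| `^ p)).
Proof.
move=> l0; have [h1 h2] := itg_subst l0 (itg_Kscale (c / l)).
have e x : l ^+ N * (K ((c / l) *: (l *: x)) * (w (l *: x) * `|u (l *: x)| `^ p)) =
    K (c *: x) * (w x * `|dilate l u x| `^ p).
  by rewrite dilate_powp// scalerA divfK ?gt_eqF// mulrCA.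
by split; [exact: (eq_itg e h1)|rewrite -(eq_Rint _ e)].
Qed.

(** Since u and v = dilate l u have the same energy, pairing grad u with grad v
    - grad u gives half the energy of the difference, with a minus sign. *)
Lemma weak_increment l : 0 < l ->
  itg mu (fun x => K x * w x * `|u x| `^ (p - 2) * u x * (dilate l u x - u x)) /\
  Rint mu (fun x => K x * w x * `|u x| `^ (p - 2) * u x * (dilate l u x - u x)) =
    - (2^-1 * Rint mu (diff_dens l)).
Proof.
move=> l0; have hv := in_energy_dilate l0 uE; have hd := in_energy_sub hv uE.
have iK := itg_weak_rhs a12 s02 mK KM uE hd.
split; first exact: iK.
have id : itg mu (diff_dens l) := itg_dens a12 (in_energy_sub uE hv).
have iu := itg_dens a12 uE; have iv := itg_dens a12 hv.
have Iv : Rint mu (dens alpha (dilate_grad l Du)) = Rint mu (dens alpha Du).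
  have [_ <-] := itg_subst l0 iu; apply: eq_Rint => x; exact: dens_dilate_grad.
have iL := itg_weak_form a12 s02 mK KM uE hd.
have E x : K x * w x * `|u x| `^ (p - 2) * u x * (dilate l u x - u x) =
   (2^-1 * (dens alpha (dilate_grad l Du) x - dens alpha Du x) - 2^-1 * diff_dens l x) -
   LL (fun x => dilate l u x - u x) (fun x => dilate_grad l Du x - Du x) x.
  rewrite /weak_form /diff_dens /dens !dotDr !dotDl !dotNr !dotNl
    [dot (dilate_grad l Du x) (Du x)]dotC.
  by field.
have i1 := itgZ 2^-1 (itgB iv iu); have i2 := itgZ 2^-1 id.
rewrite (eq_Rint _ E) (RintB (itgB i1 i2) iL) (Rint_weak_form a12 s02 mK M0 KM uE weak hd)
  (RintB i1 i2).
by rewrite (RintZ _ (itgB iv iu)) (RintB iv iu) (RintZ _ id) Iv; ring.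
Qed.

(** Expand |v|^p around u to second order: the linear term is given by
    weak_increment, the remainder by gap, and both are O((l - 1)^2). *)
Lemma dilation_gt2 : 2 < p -> exists2 C : R, 0 < C & forall l, 1 < l ->
  `|Rint mu (fun x => (K (l^-1 *: x) - K x) * (w x * `|u x| `^ p))| <= C * (l - 1) ^+ 2.
Proof.
move=> pgt2; have [C C0 hC] := quadratic_bounds pgt2.
(* The constant of powR_taylor_le times the bound of K; the factor 2 `^ (p - 2)
   comes from doubling |u| + |v|. *)
pose c := M * (p * (p - 1) * 2 `^ (p - 2)).
have c0 : 0 < c.
  by rewrite mulr_gt0// mulr_gt0 ?powR_gt0// mulr_gt0// subr_gt0 (lt_trans _ pgt2)// ltr1n.
exists (c * C + p / 2 * C); first by rewrite addr_gt0// mulr_gt0// divr_gt0.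
move=> l l1; have l0 : 0 < l by apply: lt_trans l1.
have [hd hq] := hC l l1; have [iw ew] := weak_increment l0.
have [iKv eKv] := Rint_K_dilate 1 l0; have iKu := itg_Kscale 1.
have iQ := itg_gap l0.
have d0 : 0 <= Rint mu (diff_dens l) by apply: Rint_ge0 => x; exact: dens_ge0.
pose H x := K (1 *: x) * (w x * `|dilate l u x| `^ p) - K (1 *: x) * (w x * `|u x| `^ p) -
   p * (K x * w x * `|u x| `^ (p - 2) * u x * (dilate l u x - u x)).
have iH : itg mu H := itgB (itgB iKv iKu) (itgZ p iw).
have Hle x : `|H x| <= c * gap l x.
  have h := powR_taylor_le (u x) (dilate l u x) pgt2.
  rewrite /spow in h; rewrite /H !scale1r.
  rewrite [X in `|X|](_ : _ = K x * w x * (`|dilate l u x| `^ p - `|u x| `^ p -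
    p * (`|u x| `^ (p - 1 - 1) * u x) * (dilate l u x - u x))); last first.
    by rewrite (_ : p - 1 - 1 = p - 2); ring.
  rewrite normrM normrM (ger0_norm (w0 x)).
  rewrite (_ : c * gap l x = M * w x * (p * (p - 1) * ((`|u x| + `|dilate l u x|) *+ 2) `^
    (p - 2) * (dilate l u x - u x) ^+ 2)); last first.
    rewrite -[(`|u x| + _) *+ 2]mulr_natl (powRM _ (ler0n _ 2)); last by rewrite addr_ge0.
    by rewrite /c /gap; ring.
  apply: ler_pM h; [by rewrite mulr_ge0|exact: normr_ge0|].
  by apply: ler_wpM2r; [exact: w0|exact: KM].
have eH : Rint mu H = Rint mu (fun x => (K (l^-1 *: x) - K x) * (w x * `|u x| `^ p)) +
  p / 2 * Rint mu (diff_dens l).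
  rewrite (RintB (itgB iKv iKu) (itgZ p iw)) (RintB iKv iKu) (RintZ _ iw) ew eKv div1r.
  rewrite [X in _ = X + _](@eq_Rint _ _ _ _ _ (fun x : 'rV[R]_N => K (l^-1 *: x) *
    (w x * `|u x| `^ p) - K (1 *: x) * (w x * `|u x| `^ p))); last first.
    by move=> x; rewrite scale1r mulrBl.
  by rewrite (RintB (itg_Kscale _) iKu); ring.
have hH : `|Rint mu H| <= c * Rint mu (gap l).
  by rewrite -(RintZ _ iQ); exact: (norm_Rint iH (itgZ c iQ) Hle).
rewrite (_ : Rint mu (fun x => _) = Rint mu H - p / 2 * Rint mu (diff_dens l));
  last by rewrite eH addrK.
apply: le_trans (ler_normB _ _) _; rewrite mulrDl; apply: lerD.
  by apply: le_trans hH _; rewrite -mulrA; apply: (ler_wpM2l (ltW c0)).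
have p20 : 0 <= p / 2 := divr_ge0 (ltW p0) (ler0n _ 2).
rewrite ger0_norm; last exact: mulr_ge0.
by rewrite -[leRHS]mulrA; apply: ler_wpM2l.
Qed.

Lemma itg_K_increment l :
  itg mu (fun x : 'rV[R]_N => (K (l *: x) - K x) * (w x * `|u x| `^ p)).
Proof.
have := itgB (itg_Kscale l) (itg_Kscale 1); apply: eq_itg => x.
by rewrite scale1r mulrBl.
Qed.

(** For p = 2, testing the equation of u with v = dilate l u and that of v with
    u shows that (K(l x) - K(x)) w u v has integral zero; then 2 u v = u^2 + v^2
    - (u - v)^2. *)
Lemma dilation_eq2 : p = 2 -> forall l, 1 < l ->
  `|Rint mu (fun x : 'rV[R]_N => (K (l *: x) - K x) * (w x * `|u x| `^ p)) -
    Rint mu (fun x : 'rV[R]_N => (K (l^-1 *: x) - K x) * (w x * `|u x| `^ p))| <=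
  Lip * (l - 1) * Rint mu (gap l).
Proof.
move=> pE l l1; have l0 : 0 < l by apply: lt_trans l1.
have li0 : 0 < l^-1 by rewrite invr_gt0.
have l2 : 2^-1 <= l by apply: le_trans (ltW l1); rewrite invf_le1// ler1n.
have hv := in_energy_dilate l0 uE; have hvi := in_energy_dilate li0 uE.
have i3 := itg_weak_form a12 s02 mK KM uE hv.
have i4' := itg_weak_form a12 s02 mK KM uE hvi.
have [i4 e4] := itg_subst l0 i4'.
have iQ := itg_gap l0.
have [j1 f1] := Rint_K_dilate l l0; have [j2 f2] := Rint_K_dilate 1 l0.
have k1 := itg_Kscale l; have k2 := itg_Kscale 1.
rewrite (divff (lt0r_neq0 l0)) in f1; rewrite div1r in f2.
pose V (k : R) (z : 'rV[R]_N -> R) (x : 'rV[R]_N) := K (k *: x) * (w x * `|z x| `^ p).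
pose G x := (V l u x - V 1 u x) + (V l (dilate l u) x - V 1 (dilate l u) x).
have iG : itg mu G := itgD (itgB k1 k2) (itgB j1 j2).
have IG : Rint mu G = Rint mu (fun x : 'rV[R]_N => (K (l *: x) - K x) *
  (w x * `|u x| `^ p)) -
    Rint mu (fun x : 'rV[R]_N => (K (l^-1 *: x) - K x) * (w x * `|u x| `^ p)).
  have E c : Rint mu (fun x : 'rV[R]_N => (K (c *: x) - K x) * (w x * `|u x| `^ p)) =
     Rint mu (V c u) - Rint mu (V 1 u).
    rewrite -(RintB (itg_Kscale c) k2); apply: eq_Rint => x; by rewrite scale1r mulrBl.
  rewrite !E (RintD (itgB k1 k2) (itgB j1 j2)) (RintB k1 k2) (RintB j1 j2) f1 f2 /V; ring.
pose Z x := LL (dilate l u) (dilate_grad l Du) x -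
  l ^+ N * LL (dilate l^-1 u) (dilate_grad l^-1 Du) (l *: x).
have iZ : itg mu Z := itgB i3 i4.
have IZ0 : Rint mu Z = 0.
  by rewrite (RintB i3 i4) e4 (Rint_weak_form a12 s02 mK M0 KM uE weak hv)
    (Rint_weak_form a12 s02 mK M0 KM uE weak hvi) subrr.
have E x : G x - 2 * Z x = (K (l *: x) - K x) * gap l x.
  have e0 (y : R) : y `^ (p - 2) = 1 by rewrite pE subrr powRr0.
  have ep (y : R) : `|y| `^ p = y ^+ 2.
    by rewrite pE (powR_mulrn 2 (normr_ge0 y)) real_normK ?num_real.
  rewrite /Z (weak_form_scale_inv x l0) /weak_form
    [dot (dilate_grad l Du x) (Du x)]dotC /G /V /gap.
  rewrite !e0 !ep scale1r.
  move: (w x) (K x) (K (l *: x)) (u x) (dilate l u x) (dot _ _) (_ `^ _) => *; ring.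
rewrite -IG; have -> : Rint mu G = Rint mu (fun x : 'rV[R]_N => (K (l *: x) - K x) * gap l
  x).
  by rewrite -(eq_Rint _ E) (RintB iG (itgZ 2 iZ)) (RintZ _ iZ) IZ0 mulr0 subr0.
have iKQ : itg mu (fun x : 'rV[R]_N => (K (l *: x) - K x) * gap l x).
  exact: (eq_itg E (itgB iG (itgZ 2 iZ))).
rewrite -(RintZ _ iQ); apply: (norm_Rint iKQ (itgZ _ iQ)) => x.
rewrite normrM (ger0_norm (gap_ge0 l x)); apply: ler_wpM2r; first exact: gap_ge0.
by apply: le_trans (KL x l2) _; rewrite gtr0_norm ?subr_gt0.
Qed.

Let l_ (k : nat) : R := 1 + k.+1%:R^-1.

Let l_gt1 k : 1 < l_ k.
Proof. by rewrite /l_ ltrDl invr_gt0 ltr0n. Qed.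

Let l_le2 k : l_ k <= 2.
Proof. by rewrite /l_ -[leRHS]/(1 + 1) lerD2l invf_le1 ?ltr0n// ler1n. Qed.

Let cvg_l : l_ @ \oo --> (1 : R).
Proof.
rewrite -[X in _ --> X](addr0 1); apply: cvgD; first exact: cvg_cst.
exact: cvg_harmonic.
Qed.

Let cvg_li : (fun k => (l_ k)^-1) @ \oo --> (1 : R).
Proof. by rewrite -[X in _ --> X]invr1; apply: cvgV. Qed.

Let inv_sub1 (c : R) : 1 < c -> (c^-1 - 1)^-1 = - (c / (c - 1)).
Proof.
move=> c1; have c0 : c != 0 by rewrite gt_eqF// (lt_trans ltr01).
rewrite (_ : c^-1 - 1 = - ((c - 1) / c)); last by field.
by rewrite invrN invf_div.
Qed.

Section limit.
Variable Khat : 'rV[R]_N -> R.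
Hypotheses (cK : Ck 1 K) (cKh : Ck 1 Khat)
  (KKh : forall x, x != 0 -> Khat x = K (inversion x)).

Let g x := w x * `|u x| `^ p.
Let Linf := Rint mu (fun x => dot x (grad K x) * g x).
Let F (l : R) := Rint mu (fun x : 'rV[R]_N => (K (l *: x) - K x) / (l - 1) * g x).

Let FE (l : R) : F l = (l - 1)^-1 * Rint mu (fun x : 'rV[R]_N => (K (l *: x) - K x) * g x).
Proof.
rewrite -(RintZ _ (itg_K_increment l)); apply: eq_Rint => x; by rewrite mulrAC mulrC.
Qed.

Let cvg_F : (fun k => F (l_ k)) @ \oo --> Linf.
Proof.
apply: (K_dct cK cKh KKh itg_wpow_u wpow_ge0 _ _ cvg_l) => k.
  by apply: le_trans (ltW (l_gt1 k)); rewrite invf_le1// ler1n.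
by rewrite gt_eqF.
Qed.

Let cvg_Fi : (fun k => F (l_ k)^-1) @ \oo --> Linf.
Proof.
apply: (K_dct cK cKh KKh itg_wpow_u wpow_ge0 _ _ cvg_li) => k.
  by rewrite lef_pV2 ?posrE// (lt_trans ltr01).
by rewrite invr_eq1 gt_eqF.
Qed.

(** The difference quotients F l and F (l^-1) have the same limit. For p > 2,
    dilation_gt2 says that F (l^-1) is O(l - 1); for p = 2, dilation_eq2 and
    gap_small say that F l + l^-1 F (l^-1) tends to 0. *)
Lemma ray_integral_eq0 : Linf = 0.
Proof.
have := p2; rewrite le_eqVlt => /predU1P[pE|pgt2].
  suff h : (fun k => F (l_ k) + (l_ k)^-1 * F (l_ k)^-1) @ \oo --> (0 : R).
    have h2 : (fun k => F (l_ k) + (l_ k)^-1 * F (l_ k)^-1) @ \oo --> Linf + 1 * Linf.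
      by apply: cvgD => //; apply: cvgM.
    have : 0 = Linf + 1 * Linf :> R by exact: norm_cvg_unique h h2.
    by move=> h3; move: h3; lra.
  apply/cvgrPdist_le => e e0.
  have [d d0 hd] := @gap_small (e / Lip) ltac:(by rewrite divr_gt0).
  have : \forall k \near \oo, `|1 - l_ k| <= d by move/cvgrPdist_le: cvg_l; exact.
  apply: filterS => k; rewrite distrC ger0_norm ?subr_ge0 ?(ltW (l_gt1 k))// => hk.
  have lpos : 0 < l_ k - 1 by rewrite subr_gt0.
  have lk0 : 0 < l_ k by apply: lt_trans (l_gt1 k).
  have hq : Rint mu (gap (l_ k)) <= e / Lip by apply: hd; rewrite l_gt1 -lerBlDl.
  have h := dilation_eq2 (esym pE) (l_gt1 k).
  rewrite sub0r normrN !FE.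
  set A := Rint mu _ in h *; set B := Rint mu _ in h *.
  rewrite inv_sub1// (_ : _ + _ = (l_ k - 1)^-1 * (A - B)); last first.
    move: (l_ k) lpos lk0 => c c1 c0; field.
    by rewrite !gt_eqF.
  rewrite normrM gtr0_norm ?invr_gt0// ler_pdivrMl//; apply: le_trans h _.
  rewrite mulrAC [leRHS]mulrC; apply: ler_wpM2r; first exact: ltW.
  by rewrite mulrC -ler_pdivlMr.
have [C C0 hC] := dilation_gt2 pgt2.
suff h : (fun k => F (l_ k)^-1) @ \oo --> (0 : R) by exact: norm_cvg_unique cvg_Fi h.
apply/cvgrPdist_le => e e0.
have d0 : 0 < e / (2 * C) by rewrite divr_gt0// mulr_gt0.
have : \forall k \near \oo, `|1 - l_ k| <= e / (2 * C) by move/cvgrPdist_le: cvg_l; exact.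
apply: filterS => k; rewrite distrC ger0_norm ?subr_ge0 ?(ltW (l_gt1 k))// => hk.
have lpos : 0 < l_ k - 1 by rewrite subr_gt0.
have lk0 : 0 < l_ k by apply: lt_trans (l_gt1 k).
have h := hC _ (l_gt1 k).
rewrite sub0r normrN FE; set A := Rint mu _ in h *.
rewrite inv_sub1// mulNr normrN normrM gtr0_norm ?divr_gt0//.
apply: (@le_trans _ _ (2 / (l_ k - 1) * (C * (l_ k - 1) ^+ 2))).
  apply: ler_pM => //; first by rewrite divr_ge0 ?ltW.
  by rewrite ler_pM2r ?invr_gt0.
move: (l_ k - 1) lpos hk => c c0 hc.
rewrite [leLHS](_ : _ = c * (2 * C)); last by field; rewrite gt_eqF.
by rewrite -ler_pdivlMr// mulr_gt0.
Qed.

End limit.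

End core.
End solution_and_dilation.

(** * The integral identity *)

Section limit_gradient.
Context {R : realType}.

(** The norm is the square root of the energy, so that its convergence to 0 is
    compared with the square root of e. *)
Lemma X_gradient_in_energy n (alpha : R) (u : 'rV[R]_n.+3 -> R) Du : measurable_fun setT
  u ->
  X_gradient alpha u Du -> in_energy alpha u Du.
Proof.
move=> mu_ [mDu [phi [tp _ cp] hphi]]; split => //; exists phi; split => // e e0.
have c0 : 0 < e `^ 2^-1 by rewrite powR_gt0.
have [k0 _ hk0] : \forall k \near \oo,
    (weighted_norm alpha (fun x => grad (phi k) x - Du x)%R < (e `^ 2^-1)%:E)%E.
  apply: (hphi [set y | (y < (e `^ 2^-1)%:E)%E]).
  exact: (@nbhs_open_ereal_lt R 0 (fun=> e `^ 2^-1)).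
exists k0 => // k /= /hk0; rewrite /weighted_norm /dens.
set J := (\int[_]_x _)%E.
have J0 : (0 <= J)%E by apply: integral_ge0 => x _;
  rewrite lee_fin mulr_ge0 ?powR_ge0 ?dot_ge0.
move: J J0 => [j|//|//]; last by rewrite poweRyr// ltNge leey.
rewrite poweR_EFin !lte_fin !lee_fin => j0; apply: contraTT;
  rewrite -!leNgt -ltNge => /ltW ej.
by apply: ge0_ler_powR; rewrite ?nnegrE ?invr_ge0 ?(ltW e0).
Qed.

End limit_gradient.

Theorem corollary6p2 (R : realType) (N : nat) (alpha s : R)
    (K u : 'rV[R]_N -> R) :
  (3 <= N)%N -> 1 / 2 < alpha -> 0 <= s <= 2 ->
  C1_Linfty K ->
  (exists2 Khat : 'rV[R]_N -> R,
     forall x, x != 0 -> Khat x = K (inversion x) & C1_Linfty Khat) ->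
  in_X alpha u ->
  weak_solution alpha s K u ->
  (\int[leb N]_x
     (dot x (grad K x) * `|last_coord x| `^ (alpha * crit_exp N s - s) *
      `|u x| `^ crit_exp N s)%:E = 0)%E.
Proof.
case: N K u => [|[|[|n]]]// K u _; rewrite div1r => a12 s02 [cK _] [Khat KKh [cKh _]]
  [mu_ _] [Du gDu weak].
have uE := X_gradient_in_energy mu_ gDu.
have mK : measurable_fun setT K by apply: continuous_measurable_rV; exact: Ck_continuous cK.
have [M M0 KM] := K_bound cK cKh KKh.
have [Lip Lip0 KL] := K_lip cK cKh KKh.
have [L L0 hL] := K_ray_bound cK cKh KKh.
have := ray_integral_eq0 a12 s02 mK M0 KM Lip0 KL uE weak cK cKh KKh.
set f := (fun x => _) => If.
under eq_integral => x _ do rewrite -mulrA -/(f x).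
rewrite RintE ?If//.
apply: (itg_bddM _ hL); first by apply: continuous_measurable_rV; exact: continuous_ray.
- by move=> x; exact: wpow_ge0.
- exact: (itg_wpow a12 s02 uE).
Qed.
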